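(* Let $T>0$ be a (rescaled) time horizon and let $\mathbf v$ and $\eta$ (with pressure $p$) be classical solutions of the rescaled fluid-structure interaction problem described in the context. Then for every $t\in(0,T)$ $$\frac12\|\mathbf v(t)\|^2_{L^2(\Omega_\eta(t))}+\frac{\varepsilon^{-2}}2\int_0^t\!\!\int_{\Omega_\eta(s)}|\nabla\mathbf v|^2\,d\mathbf x\,ds+\frac{\varrho\varepsilon^5}2\|\partial_t\eta(t)\|^2_{L^2(\omega)}+\delta\varepsilon^{2-r}\int_0^t\|\partial_t\partial_x\eta(s)\|^2_{L^2(\omega)}\,ds+\frac{\beta\varepsilon^{-1}}2\|\partial_x^2\eta(t)\|^2_{L^2(\omega)}\le C\varepsilon,$$ where $C>0$ is independent of $\varepsilon$ and of all variables (the solution and $t\in(0,T)$).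
   Context: Notation: $\omega=(0,1)$; the subscript $\#$ denotes spaces of $\omega$-periodic functions in $x$. For a positive function $\eta(x,t)$, $\Omega_\eta(t)=\{(x,z): x\in\omega,\ 0<z<\eta(x,t)\}\subset\mathbb R^2$, and $\Omega_\eta(t)\times(0,T)$ denotes the space-time domain $\bigcup_{t\in(0,T)}\Omega_\eta(t)\times\{t\}$. $D(\mathbf v)=\frac12(\nabla\mathbf v+(\nabla\mathbf v)^T)$, $\sigma_f(\mathbf v,p)=2D(\mathbf v)-pI_2$, $J^\eta=\sqrt{1+(\partial_x\eta)^2}$, $\mathbf n^\eta$ is the unit outer normal on the top boundary $z=\eta(x,t)$, $\mathbf e_z=(0,1)$. Rescaled FSI problem. Fix constants $\varrho,\delta,\beta>0$, $r\in[1,3]$, and a strictly positive $\omega$-periodic $\eta_0\in H^3_\#(\omega)$, all independent of $\varepsilon$. For a small parameter $0<\varepsilon\ll1$ (original structure coefficients: density $\varrho\varepsilon$, viscoelasticity $\delta\varepsilon^{-r}$, bending $\beta\varepsilon^{-1}$; original time equals $\varepsilon^{-2}t$), the unknowns $(\mathbf v,p,\eta)$ in rescaled time $t$ satisfy $$\varepsilon^2\partial_t\mathbf v+(\mathbf v\cdot\nabla)\mathbf v-\operatorname{div}\sigma_f(\mathbf v,p)=\mathbf f,\qquad \operatorname{div}\mathbf v=0\qquad\text{in }\Omega_\eta(t)\times(0,T),$$ $$\varrho\varepsilon^5\partial_{tt}\eta-\delta\varepsilon^{2-r}\partial_x^2\partial_t\eta+\beta\varepsilon^{-1}\partial_x^4\eta=-J^\eta\,\big(\sigma_f(\mathbf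 v,p)\mathbf n^\eta\big)(x,\eta(x,t),t)\cdot\mathbf e_z\qquad\text{in }\omega\times(0,T),$$ $$\mathbf v(x,\eta(x,t),t)=(0,\varepsilon^2\partial_t\eta(x,t))\qquad\text{in }\omega\times(0,T),$$ with no-slip condition $\mathbf v(x,0,t)=0$, $\omega$-periodicity in $x$, and initial conditions $\mathbf v(\cdot,0)=0$, $\partial_t\eta(\cdot,0)=0$, $\eta(\cdot,0)=\varepsilon\eta_0$. The force $\mathbf f$ satisfies $\|\mathbf f\|_{L^\infty(0,\infty;L^\infty(\Omega_\eta(t);\mathbb R^2))}\le C_f$ with $C_f$ independent of $\varepsilon$. Constants ''independent of $\varepsilon$'' may depend on $T,\varrho,\delta,\beta,r,\eta_0,C_f$. *)

(* Defs.v *)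
From HB Require Import structures.
From mathcomp Require Import all_boot all_order all_algebra.
From mathcomp Require Import all_classical all_reals all_analysis ess_sup_inf.

Set Implicit Arguments.
Unset Strict Implicit.
Unset Printing Implicit Defensive.

Import Order.TTheory GRing.Theory Num.Theory.
Import numFieldNormedType.Exports.

Local Open Scope classical_set_scope.
Local Open Scope ring_scope.

(* Functions on omega x time take a pair (x, t); functions on the fluid
   space-time domain take a triple (x, z, t).  All of them are total functions
   on R^2 or R^3; only their values for the relevant arguments matter, and
   omega-periodic objects are 1-periodic in x over the whole real line. *)

Section PartialDerivatives.
Variable R : realType.

(* functions of (x, t) *)
Definition px (g : R * R -> R) : R * R -> R :=
  fun q => derive1 (fun x => g (x, q.2)) q.1.
Definition pt (g : R * R -> R) : R * R -> R :=
  fun q => derive1 (fun t => g (q.1, t)) q.2.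
Definition derivable_px (g : R * R -> R) (q : R * R) : Prop :=
  derivable (fun x => g (x, q.2)) q.1 1.
Definition derivable_pt (g : R * R -> R) (q : R * R) : Prop :=
  derivable (fun t => g (q.1, t)) q.2 1.

(* functions of (x, z, t); the space variables x, z have index 0, 1 *)
Definition dsp (j : 'I_2) (u : R * R * R -> R) : R * R * R -> R :=
  fun q => if j == 0 then derive1 (fun x => u (x, q.1.2, q.2)) q.1.1
           else derive1 (fun z => u (q.1.1, z, q.2)) q.1.2.
Definition dtm (u : R * R * R -> R) : R * R * R -> R :=
  fun q => derive1 (fun t => u (q.1.1, q.1.2, t)) q.2.
Definition derivable_dsp (j : 'I_2) (u : R * R * R -> R) (q : R * R * R) : Prop :=
  if j == 0 then derivable (fun x => u (x, q.1.2, q.2)) q.1.1 1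
  else derivable (fun z => u (q.1.1, z, q.2)) q.1.2 1.
Definition derivable_dtm (u : R * R * R -> R) (q : R * R * R) : Prop :=
  derivable (fun t => u (q.1.1, q.1.2, t)) q.2 1.

(* the i-th component of a vector field *)
Definition vcomp (v : R * R * R -> 'rV[R]_2) (i : 'I_2) : R * R * R -> R :=
  fun q => v q 0 i.

End PartialDerivatives.

Section FluidOperators.
Variable R : realType.
Implicit Types (v : R * R * R -> 'rV[R]_2) (p : R * R * R -> R).

(* (grad v)_ij = d_j v_i *)
Definition gradv v (q : R * R * R) : 'M[R]_2 :=
  \matrix_(i, j) dsp j (vcomp v i) q.

Definition symgrad v (q : R * R * R) : 'M[R]_2 :=
  2^-1 *: (gradv v q + (gradv v q)^T).

Definition stress v p (q : R * R * R) : 'M[R]_2 :=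
  2 *: symgrad v q - (p q)%:M.

Definition div_stress v p (q : R * R * R) : 'rV[R]_2 :=
  \row_i \sum_j dsp j (fun q' => stress v p q' i j) q.

Definition divergence v (q : R * R * R) : R := \sum_i dsp i (vcomp v i) q.

Definition time_deriv v (q : R * R * R) : 'rV[R]_2 := \row_i dtm (vcomp v i) q.

(* (v . grad) v *)
Definition convection v (q : R * R * R) : 'rV[R]_2 :=
  \row_i \sum_j v q 0 j * dsp j (vcomp v i) q.

(* The derivatives of v at the moving boundary z = eta(x, t) are traces from
   inside the fluid domain: v is meaningless above z = eta(x, t). *)
Definition stress_trace v p (eta : R * R -> R) (q : R * R) : 'M[R]_2 :=
  \matrix_(i, j)
    lim (stress v p (q.1, z, q.2) i j @[z --> (eta q)^'-]).

Definition jac (eta : R * R -> R) (q : R * R) : R :=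
  Num.sqrt (1 + px eta q ^+ 2).

Definition normal (eta : R * R -> R) (q : R * R) : 'cV[R]_2 :=
  (jac eta q)^-1 *: \col_i (if i == 0 then - px eta q else 1).

Definition e_z : 'cV[R]_2 := \col_i (if i == 0 then 0 else 1).

Definition dot (a b : 'cV[R]_2) : R := \sum_i a i 0 * b i 0.

Definition normsq (a : 'rV[R]_2) : R := \sum_i a 0 i ^+ 2.

Definition mxnormsq (A : 'M[R]_2) : R := \sum_i \sum_j A i j ^+ 2.

End FluidOperators.

Arguments e_z R : clear implicits.

Section Domains.
Variable R : realType.
Implicit Types (eta : R * R -> R) (T : R).

Definition omega : set R := `]0, 1[.

Definition Omega eta (t : R) : set (R * R) :=
  [set xz | omega xz.1 /\ 0 < xz.2 < eta (xz.1, t)].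

(* Space-time sets used to express regularity; x ranges over the whole line,
   so that regularity is that of the periodic extension. *)
Definition lateral T : set (R * R) := [set q | 0 < q.2 < T].
Definition lateral0 T : set (R * R) := [set q | 0 <= q.2 < T].
Definition fluid eta T : set (R * R * R) :=
  [set q | 0 < q.2 < T /\ 0 < q.1.2 < eta (q.1.1, q.2)].
Definition fluid_cl eta T : set (R * R * R) :=
  [set q | 0 < q.2 < T /\ 0 <= q.1.2 <= eta (q.1.1, q.2)].
Definition fluid_cl0 eta T : set (R * R * R) :=
  [set q | 0 <= q.2 < T /\ 0 <= q.1.2 <= eta (q.1.1, q.2)].

(* u, given on Q, is continuous on Q and extends continuously to K *)
Definition extends_cont (U : topologicalType) (Q K : set U) (u : U -> R) : Prop :=
  exists g : U -> R, {within K, continuous g} /\ (forall q, Q q -> g q = u q).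

End Domains.

Arguments omega R : clear implicits.

Section PeriodicSobolev.
Variable R : realType.
Local Notation mu := (@lebesgue_measure R).

Definition periodic1 (g : R -> R) : Prop := forall x, g (x + 1) = g x.

Definition L2_per (g : R -> R) : Prop :=
  [/\ periodic1 g, measurable_fun setT g &
      (\int[mu]_(x in omega R) (g x ^+ 2)%:E < +oo)%E].

Definition smooth_per (phi : R -> R) : Prop :=
  periodic1 phi /\ forall (k : nat) (x : R), derivable (derive1n k phi) x 1.

(* g is the k-th weak derivative of h on the torus *)
Definition weak_deriv_per (k : nat) (h g : R -> R) : Prop :=
  forall phi, smooth_per phi ->
    (\int[mu]_(x in omega R) (h x * derive1n k phi x)%:E =
     \int[mu]_(x in omega R) ((-1) ^+ k * (g x * phi x))%:E)%E.

(* H^3_#(omega) *)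
Definition H3_per (h : R -> R) : Prop :=
  L2_per h /\
  forall k : nat, (1 <= k <= 3)%N -> exists g, L2_per g /\ weak_deriv_per k h g.

End PeriodicSobolev.

Section Norms.
Variable R : realType.
Local Notation mu := (@lebesgue_measure R).
Local Notation mu2 := (mu \x mu)%E.
Local Open Scope ereal_scope.

(* squared norm in L^2(Omega_eta(t)) of a vector field *)
Definition L2sq_vec (eta : R * R -> R) (v : R * R * R -> 'rV[R]_2) (t : R) : \bar R :=
  \int[mu2]_(xz in Omega eta t) (normsq (v (xz, t)))%:E.

Definition L2sq_grad (eta : R * R -> R) (v : R * R * R -> 'rV[R]_2) (t : R) : \bar R :=
  \int[mu2]_(xz in Omega eta t) (mxnormsq (gradv v (xz, t)))%:E.

(* squared norm in L^2(omega) *)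
Definition L2sq_omega (g : R * R -> R) (t : R) : \bar R :=
  \int[mu]_(x in omega R) (g (x, t) ^+ 2)%:E.

(* norm of f in L^oo(0, T; L^oo(Omega_eta(t); R^2)); restricting a nonnegative
   function by 0 outside of a set does not change its essential supremum.  The
   domain Omega_eta(t), hence the norm, only makes sense as long as eta exists,
   so times range over (0, T) rather than (0, oo). *)
Definition Linf_space (eta : R * R -> R) (f : R * R * R -> 'rV[R]_2) (t : R) : \bar R :=
  ess_sup mu2
    ((fun xz => (Num.sqrt (normsq (f (xz, t))))%:E) \_ (Omega eta t)).

Definition Linf_Linf (T : R) (eta : R * R -> R) (f : R * R * R -> 'rV[R]_2) : \bar R :=
  ess_sup mu (Linf_space eta f \_ `]0%R, T[).

End Norms.

Section FSI.
Variable R : realType.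
Implicit Types (v f : R * R * R -> 'rV[R]_2) (p : R * R * R -> R)
  (eta : R * R -> R).

(* Regularity of classical solutions: all derivatives in the equations exist in
   the usual sense and are continuous, up to the bottom and top boundary, at
   positive times; at t = 0 only continuity of v, eta, eta_x, eta_xx, eta_t is
   required, which is what the initial conditions call for. *)
Record structure_regular (T : R) eta : Prop := {
  eta_positive : forall q, lateral0 T q -> 0 < eta q;
  eta_periodic : forall x t, lateral0 T (x, t) -> eta (x + 1, t) = eta (x, t);
  eta_cont : forall k : nat, (k <= 2)%N ->
    {within lateral0 T, continuous (iter k (@px R) eta)};
  eta_px0 : forall (k : nat) q, (k < 2)%N -> lateral0 T q ->
    derivable_px (iter k (@px R) eta) q;
  eta_px : forall (k : nat) q, (k < 4)%N -> lateral T q ->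
    derivable_px (iter k (@px R) eta) q;
  eta_px_cont : forall k : nat, (k <= 4)%N ->
    {within lateral T, continuous (iter k (@px R) eta)};
  eta_pt : forall q, lateral T q -> derivable_pt eta q;
  eta_pt_cont : extends_cont (lateral T) (lateral0 T) (pt eta);
  eta_ptt : forall q, lateral T q -> derivable_pt (pt eta) q;
  eta_ptt_cont : {within lateral T, continuous (pt (pt eta))};
  eta_pxt : forall (k : nat) q, (k < 2)%N -> lateral T q ->
    derivable_px (iter k (@px R) (pt eta)) q;
  eta_pxt_cont : forall k : nat, (k <= 2)%N ->
    {within lateral T, continuous (iter k (@px R) (pt eta))}
}.

Record fluid_regular (T : R) eta v p : Prop := {
  v_periodic : forall x z t, fluid_cl0 eta T (x, z, t) ->
    v (x + 1, z, t) = v (x, z, t);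
  p_periodic : forall x z t, fluid eta T (x, z, t) ->
    p (x + 1, z, t) = p (x, z, t);
  v_cont : forall i, {within fluid_cl0 eta T, continuous (vcomp v i)};
  v_dtm : forall i q, fluid eta T q -> derivable_dtm (vcomp v i) q;
  v_dtm_cont : forall i,
    extends_cont (fluid eta T) (fluid_cl eta T) (dtm (vcomp v i));
  v_dsp : forall i j q, fluid eta T q -> derivable_dsp j (vcomp v i) q;
  v_dsp_cont : forall i j,
    extends_cont (fluid eta T) (fluid_cl eta T) (dsp j (vcomp v i));
  v_dsp2 : forall i j k q, fluid eta T q ->
    derivable_dsp k (dsp j (vcomp v i)) q;
  v_dsp2_cont : forall i j k,
    extends_cont (fluid eta T) (fluid_cl eta T) (dsp k (dsp j (vcomp v i)));
  p_cont : extends_cont (fluid eta T) (fluid_cl eta T) p;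
  p_dsp : forall j q, fluid eta T q -> derivable_dsp j p q;
  p_dsp_cont : forall j,
    extends_cont (fluid eta T) (fluid_cl eta T) (dsp j p)
}.

Record classical_solution (rho delta beta r : R) (eta0 : R -> R) (eps T : R)
    f v p eta : Prop := {
  sol_structure_regular : structure_regular T eta;
  sol_fluid_regular : fluid_regular T eta v p;
  sol_momentum : forall x z t, 0 < t < T -> Omega eta t (x, z) ->
    eps ^+ 2 *: time_deriv v (x, z, t) + convection v (x, z, t)
      - div_stress v p (x, z, t) = f (x, z, t);
  sol_incompressible : forall x z t, 0 < t < T -> Omega eta t (x, z) ->
    divergence v (x, z, t) = 0;
  sol_structure : forall x t, 0 < t < T -> omega R x ->
    rho * eps ^+ 5 * pt (pt eta) (x, t)
      - delta * eps `^ (2 - r) * px (px (pt eta)) (x, t)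
      + beta * eps^-1 * px (px (px (px eta))) (x, t)
    = - jac eta (x, t)
        * dot (stress_trace v p eta (x, t) *m normal eta (x, t)) (e_z R);
  sol_kinematic : forall x t, 0 < t < T -> omega R x ->
    v (x, eta (x, t), t) = \row_i (if i == 0 then 0 else eps ^+ 2 * pt eta (x, t));
  sol_noslip : forall x t, 0 < t < T -> omega R x -> v (x, 0, t) = 0;
  sol_init_v : forall x z, Omega eta 0 (x, z) -> v (x, z, 0) = 0;
  sol_init_eta : forall x, eta (x, 0) = eps * eta0 x;
  sol_init_pt_eta : forall x, omega R x -> pt eta (x, t) @[t --> 0^'+] --> 0
}.

(* left-hand side of the energy estimate *)
Definition energy (rho delta beta r eps : R) v eta (t : R) : \bar R :=
  let mu := @lebesgue_measure R in
  ((2^-1)%:E * L2sq_vec eta v t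
   + (eps ^- 2 / 2)%:E * \int[mu]_(s in `]0%R, t[) L2sq_grad eta v s
   + (rho * eps ^+ 5 / 2)%:E * L2sq_omega (pt eta) t
   + (delta * eps `^ (2 - r))%:E *
       \int[mu]_(s in `]0%R, t[) L2sq_omega (pt (px eta)) s
   + (beta * eps^-1 / 2)%:E * L2sq_omega (px (px eta)) t)%E.

End FSI.

(* Main.v *)
From HB Require Import structures.
Require Import Defs.
From mathcomp Require Import all_boot all_order all_algebra.
From mathcomp Require Import all_classical all_reals all_analysis ess_sup_inf.
From mathcomp Require Import ring lra measurable_realfun.

(** The estimate is the energy estimate of the coupled system, closed by
    Gronwall's lemma. The one delicate point is that all constants are uniform in
    $\varepsilon$ although the force is of order one.

    Testing the momentum equation with $v$ on the moving domain and the plate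
    equation with $\partial_t\eta$, the exchange of energy through the graph of
    $\eta$ cancels: there the velocity is $(0, \varepsilon^2\partial_t\eta)$, so
    the kinetic flux is carried away by the motion of the graph, and the stress
    reduces to the right-hand side of the plate equation, because
    $\partial_x v_1 + \eta_x \partial_z v_1 = 0$ and $\mathrm{div}\, v = 0$ on
    the graph ([top_tangential], [top_div], [stress_traceE]). After division by
    $\varepsilon^2$ this gives ([energy_balance], [structure_balance],
    [energy_ineq]) the weights of the statement. Incompressibility turns the
    divergence of the stress into the Laplacian ([momentum]), which is why the full
    gradient appears.

    The work of the force is controlled column by column: as $v$ vanishes at the
    bottom, $|v|\le \int_0^\eta |\partial_z v|\,dz$, and Young's inequality absorbs half
    of the dissipation, leaving $\varepsilon^{-2} C_f^2\int_\omega\eta^3$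
    ([source_bound]). Incompressibility also conserves the mass
    $\int_\omega\eta$, which is of order $\varepsilon$ initially
    ([mass_conserved]). For a periodic $\eta \ge 0$ the supremum is at most the mass
    plus $\int|\eta_{xx}|$, so $\int\eta^3$ is at most a constant times
    $\varepsilon^3 + \varepsilon\int\eta_{xx}^2$ ([cube_bound]), and the work of
    the force at most a constant times $\varepsilon$ plus the bending energy
    $\frac{\beta}{2\varepsilon}\int\eta_{xx}^2$ ([force_le]). At the initial time
    the energy is $\frac{\beta\varepsilon}{2}\int(\eta_0'')^2$, and Gronwall's
    lemma gives the bound ([growth], [energy_final]).

    A classical solution has derivatives only inside the domain and at positive
    times, with continuous extensions to the boundary. All integrations by parts are
    therefore done on the box obtained with the coordinates
    $(x, z/\eta(x,t), t)$, where they become a conservation law ([box_conservation],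
    [transport]) for functions that are continuous on the closed box and
    differentiable in the open one. The balance is established on time windows
    $[s, t]$ with $s > 0$, and $s$ tends to 0 at the end. Iterated integrals of
    continuous functions are used throughout; they are identified with the Lebesgue
    integrals of the statement by Tonelli's theorem ([Omega_integral]). *)

Import Order.TTheory GRing.Theory Num.Theory.
Import numFieldNormedType.Exports.
Local Open Scope ring_scope.

Set Implicit Arguments.
Unset Strict Implicit.
Unset Printing Implicit Defensive.

Local Open Scope classical_set_scope.

(** * Integrals of continuous functions over a segment *)

(** The integral is locked so that unification never unfolds the Lebesgue
    integral inside iterated integrals. *)
HB.lock Definition itg (R : realType) (a b : R) (f : R -> R) : R :=
  \int[@lebesgue_measure R]_(x in `[a, b]) f x.

Section Integral.
Variable R : realType.
Implicit Types (a b c d : R) (f g : R -> R).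

Lemma cont_integrable a b f : continuous f ->
  (@lebesgue_measure R).-integrable `[a, b] (EFin \o f).
Proof.
move=> cf; apply: continuous_compact_integrable; first exact: segment_compact.
exact: continuous_subspaceT.
Qed.

Lemma cont_measurable (D : set R) f : measurable D -> continuous f -> measurable_fun D f.
Proof. by move=> mD cf; apply: measurable_funTS; exact: continuous_measurable_fun. Qed.

(** The end points are not in the hypothesis: the equations of the problem hold
    only inside the domain. *)
Lemma itg_eq a b f g : continuous f -> continuous g ->
  (forall x, a < x < b -> f x = g x) -> itg a b f = itg a b g.
Proof.
move=> cf cg fg; rewrite !itg.unlock; congr fine.
apply: eq_integral_itv_bounded; [exact: cont_measurable..|].
by move=> x; rewrite in_itv/= => /fg.
Qed.

Lemma itg_ext a b f g : (forall x, a <= x <= b -> f x = g x) -> itg a b f = itg a b g.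
Proof. by move=> fg; rewrite !itg.unlock; apply: eq_Rintegral => x; rewrite inE/= in_itv/= => /fg. Qed.

Lemma le_itg a b f g : continuous f -> continuous g ->
  (forall x, a < x < b -> f x <= g x) -> itg a b f <= itg a b g.
Proof.
move=> cf cg fg.
have cm : continuous (fun x => Num.max (f x) (g x)).
  by move=> x; apply: continuous_max; [exact: cf|exact: cg].
rewrite [leRHS](_ : _ = itg a b (fun x => Num.max (f x) (g x))).
  rewrite !itg.unlock; apply: le_Rintegral => //; [exact: cont_integrable..|].
  by move=> x _; rewrite le_max lexx.
by apply: itg_eq => // x xab; rewrite max_r ?fg.
Qed.

Lemma itgD a b f g : continuous f -> continuous g ->
  itg a b (fun x => f x + g x) = itg a b f + itg a b g.
Proof. by move=> cf cg; rewrite !itg.unlock RintegralD//; exact: cont_integrable. Qed.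

Lemma itgB a b f g : continuous f -> continuous g ->
  itg a b (fun x => f x - g x) = itg a b f - itg a b g.
Proof. by move=> cf cg; rewrite !itg.unlock RintegralB//; exact: cont_integrable. Qed.

Lemma itgZ a b k f : continuous f ->
  itg a b (fun x => k * f x) = k * itg a b f.
Proof. by move=> cf; rewrite !itg.unlock RintegralZl//; exact: cont_integrable. Qed.

Lemma itgZr a b k f : continuous f ->
  itg a b (fun x => f x * k) = itg a b f * k.
Proof. by move=> cf; rewrite !itg.unlock RintegralZr//; exact: cont_integrable. Qed.

Lemma itg_cst a b k : a <= b -> itg a b (fun=> k) = k * (b - a).
Proof.
move=> ab; rewrite !itg.unlock Rintegral_cst//= lebesgue_measure_itv/= lte_fin.
case: ltP => //= ba; rewrite (_ : b = a) ?subrr//; exact: le_anti (introT andP (conj ba ab)).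
Qed.

Lemma itg0 a b : itg a b (fun=> 0) = 0.
Proof. by rewrite !itg.unlock Rintegral_cst// mul0r. Qed.

Lemma itg_ge0 a b f : (forall x, a <= x <= b -> 0 <= f x) -> 0 <= itg a b f.
Proof. by move=> f0; rewrite itg.unlock; apply: Rintegral_ge0 => x /=; rewrite in_itv/= => /f0. Qed.

Lemma itg_abs a b f : continuous f -> `|itg a b f| <= itg a b (fun x => `|f x|).
Proof. by move=> cf; rewrite !itg.unlock; apply: le_normr_Rintegral => //; exact: cont_integrable. Qed.

Lemma itgE a b f : continuous f ->
  (\int[@lebesgue_measure R]_(x in `[a, b]) (f x)%:E)%E = (itg a b f)%:E.
Proof.
by move=> cf; rewrite !itg.unlock /Rintegral fineK//; apply: integrable_fin_num => //; exact: cont_integrable.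
Qed.

Lemma itg_cat a b c f : a <= b -> b <= c -> continuous f ->
  itg a c f = itg a b f + itg b c f.
Proof.
move=> ab bc cf; have := @Rintegral_itvB R f (BLeft a) (BRight c) b (cont_integrable a c cf).
rewrite !bnd_simp => /(_ ab bc) H; rewrite !itg.unlock.
rewrite -(Rintegral_itv_obnd_cbnd (r := b)).
  by rewrite -H addrC subrK.
by apply: integrableS (cont_integrable b c cf) => //; exact: subset_itv_oc_cc.
Qed.

Lemma itg_FTC a b f F : a <= b -> continuous f -> continuous F ->
  (forall x, a < x < b -> is_derive x 1 F (f x)) -> itg a b f = F b - F a.
Proof.
rewrite le_eqVlt => /predU1P[<-|ab] cf cF dF.
  by rewrite !itg.unlock set_itv1 Rintegral_set1 subrr.
suff: (itg a b f)%:E = ((F b)%:E - (F a)%:E)%E by case.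
rewrite -itgE//; apply: continuous_FTC2 => //.
- exact: continuous_subspaceT.
- split.
  + by move=> x; rewrite in_itv/= => /dF [].
  + exact/cvg_at_right_filter/cF.
  + exact/cvg_at_left_filter/cF.
- by move=> x; rewrite in_itv/= => /dF [? ?]; rewrite derive1E.
Qed.

Lemma cont_pair (U V W : topologicalType) (f : U -> V) (g : U -> W) :
  continuous f -> continuous g -> continuous (fun u => (f u, g u)).
Proof. by move=> cf cg u; apply: cvg_pair; [exact: cf|exact: cg]. Qed.

Lemma cont_fst (U V : topologicalType) : continuous (@fst U V).
Proof. by move=> u; exact: cvg_fst. Qed.

Lemma cont_snd (U V : topologicalType) : continuous (@snd U V).
Proof. by move=> u; exact: cvg_snd. Qed.

Lemma cont_comp (U V W : topologicalType) (f : U -> V) (g : V -> W) :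
  continuous f -> continuous g -> continuous (fun u => g (f u)).
Proof. by move=> cf cg u; apply: (@continuous_comp _ _ _ f g); [exact: cf|exact: cg]. Qed.

Lemma continuous_slice (U V W : topologicalType) (g : U * V -> W) : continuous g ->
  (forall u, continuous (fun v => g (u, v))) /\ (forall v, continuous (fun u => g (u, v))).
Proof.
move=> cg; split=> [u v|v u].
- apply: (@continuous_comp _ _ _ (fun v => (u, v)) g); last exact: cg.
  by apply: cvg_pair; [exact: cvg_cst|exact: cvg_id].
- apply: (@continuous_comp _ _ _ (fun u => (u, v)) g); last exact: cg.
  by apply: cvg_pair; [exact: cvg_id|exact: cvg_cst].
Qed.

(** By compactness of the segment, continuity in the parameter is uniform in the
    variable of integration. *)
Lemma cvg_param (U : topologicalType) a b (g : U * R -> R) : continuous g ->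
  continuous (fun u => itg a b (fun y => g (u, y))).
Proof.
move=> cg u.
have cgu := (continuous_slice cg).1.
have [ab|ba] := leP a b; last first.
  rewrite (_ : (fun _ => _) = fun=> 0); first exact: cvg_cst.
  by apply/funext => v; rewrite !itg.unlock set_itv_ge ?Rintegral_set0// bnd_simp -ltNge.
apply/cvgrPdist_le => e e0.
set d := e / (b - a + 1).
have ba : 0 < b - a + 1 by rewrite ltr_wpDl// subr_ge0.
have d0 : 0 < d by rewrite divr_gt0.
have H : \forall v \near u, `[a, b] `<=` (fun y => `|g (u, y) - g (v, y)| <= d).
  have /compact_near_coveringP := @segment_compact R a b.
  apply=> y _.
  have /cvgrPdist_le/(_ (d / 2) (divr_gt0 d0 (ltr0Sn _ 1))) H : g p @[p --> (u, y)] --> g (u, y).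
    exact: cg.
  have [[A B] /= [uA yB] AB] := H.
  exists (B, A) => //= -[y' v] /= [By' Av].
  have h1 := AB (v, y') (conj Av By').
  have h2 := AB (u, y') (conj (nbhs_singleton uA) By').
  have -> : g (u, y') - g (v, y') = (g (u, y) - g (v, y')) - (g (u, y) - g (u, y')) by ring.
  by rewrite (splitr d) (le_trans (ler_normB _ _))// lerD.
near=> v.
rewrite -itgB//.
have cn : continuous (fun y => g (u, y) - g (v, y)).
  by move=> y; apply: cvgB; exact: cgu.
apply: (le_trans (itg_abs _ _ cn)).
apply: (@le_trans _ _ (itg a b (fun=> d))).
  apply: le_itg.
  - by move=> y; apply: cvg_norm; exact: cn.
  - by move=> y; exact: cvg_cst.
  - move=> y /andP[ay yb]; apply: (near H v) => //=.
    by rewrite in_itv/= !ltW.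
rewrite itg_cst// /d -mulrA ler_piMr ?(ltW e0)//.
by rewrite mulrC ler_pdivrMr// mul1r lerDl.
Unshelve. all: end_near. Qed.

(** The product sigma-algebra is generated by boxes, and an open set is the
    countable union of the rational boxes that it contains. *)
Lemma open_prod_measurable (U : set (R * R)) : open U -> measurable U.
Proof.
move=> oU.
pose B (i : rat * rat * rat * rat) : set (R * R) :=
  `](ratr i.1.1.1 : R), ratr i.1.1.2[ `*` `](ratr i.1.2 : R), ratr i.2[.
pose F i := if pselect (B i `<=` U) then B i else set0.
have -> : U = \bigcup_i F i.
  apply/seteqP; split=> [[x z] Uxz|x [i _]]; last first.
    by rewrite /F; case: pselect => //= + Bx; apply.
  have : nbhs (x, z) U by apply: open_nbhs_nbhs.
  case=> -[A C] /= [/nbhs_ballP[e1 /= e10 xA] /nbhs_ballP[e2 /= e20 zC]] AC.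
  have lo (w e : R) : 0 < e -> w - e < w by move=> e0; rewrite ltrBlDr ltrDl.
  have hi (w e : R) : 0 < e -> w < w + e by move=> e0; rewrite ltrDl.
  have [q1] := rat_in_itvoo (lo x e1 e10); rewrite in_itv/= => /andP[q1l q1r].
  have [q2] := rat_in_itvoo (hi x e1 e10); rewrite in_itv/= => /andP[q2l q2r].
  have [q3] := rat_in_itvoo (lo z e2 e20); rewrite in_itv/= => /andP[q3l q3r].
  have [q4] := rat_in_itvoo (hi z e2 e20); rewrite in_itv/= => /andP[q4l q4r].
  have inb (p q : rat) (w e y : R) : w - e < ratr p -> ratr q < w + e ->
      ratr p < y < ratr q -> ball w e y.
    by rewrite ball_itv/= in_itv/= => wp qw /andP[py yq]; rewrite (lt_trans wp)//= (lt_trans yq).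
  suff BU : B (q1, q2, q3, q4) `<=` U.
    exists (q1, q2, q3, q4) => //.
    have -> : F (q1, q2, q3, q4) = B (q1, q2, q3, q4).
      by rewrite /F; move: BU; case: pselect.
    by rewrite /B/= !in_itv/= q1r q2l q3r q4l.
  move=> [x' z'] /=; rewrite /B/= !in_itv/= => -[h1 h2].
  by apply: AC; split=> /=; [exact: (xA _ (inb _ _ _ _ _ q1l q2r h1))|exact: (zC _ (inb _ _ _ _ _ q3l q4r h2))].
apply: countable_bigcupT_measurable; first exact: countableP.
move=> i; rewrite /F; destruct (pselect _); [exact: (measurableX (measurable_itv _) (measurable_itv _))|exact: measurable0].
Qed.

Lemma cont2_measurable (g : R * R -> R) : continuous g -> measurable_fun setT g.
Proof.
move=> /continuousP cg; apply: (measurability _ (RGenOpens.measurableE R)).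
move=> _ [_ [a [b ->] <-]]; rewrite setTI; apply: open_prod_measurable.
exact/cg/interval_open.
Qed.

Lemma itg_swap_ge0 a b c d (g : R * R -> R) : continuous g -> (forall p, 0 <= g p) ->
  itg a b (fun x => itg c d (fun y => g (x, y))) = itg c d (fun y => itg a b (fun x => g (x, y))).
Proof.
move=> cg g0; have [c1 c2] := continuous_slice cg.
pose D := `[a, b] `*` `[c, d] : set (R * R).
have mD : measurable D by apply: measurableX.
pose f : R * R -> \bar R := (EFin \o g) \_ D.
have mf : measurable_fun setT f.
  apply/(measurable_restrictT _ _).1 => //.
  apply: measurable_funTS; apply/measurable_EFinP; exact: cont2_measurable.
have f0 z : (0 <= f z)%E by apply: erestrict_ge0 => ? _; rewrite lee_fin.
have := fubini_tonelli (m1 := @lebesgue_measure R) (m2 := @lebesgue_measure R) f mf f0.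
have -> : (fun x => \int[@lebesgue_measure R]_y f (x, y))%E =
   (fun x => (itg c d (fun y => g (x, y)))%:E) \_ `[a, b].
  apply/funext => x; rewrite patchE; case: ifPn => xab.
    rewrite -itgE// [RHS]integral_mkcond; apply: eq_integral => y _.
    by rewrite /f !patchE in_setX xab.
  by apply: integral0_eq => y _; rewrite /f patchE in_setX (negbTE xab).
have -> : (fun y => \int[@lebesgue_measure R]_x f (x, y))%E =
   (fun y => (itg a b (fun x => g (x, y)))%:E) \_ `[c, d].
  apply/funext => y; rewrite patchE; case: ifPn => ycd.
    rewrite -itgE// [RHS]integral_mkcond; apply: eq_integral => x _.
    by rewrite /f !patchE in_setX ycd andbT.
  by apply: integral0_eq => x _; rewrite /f patchE in_setX (negbTE ycd) andbF.
have ci1 : continuous (fun x => itg c d (fun y => g (x, y))) by exact: cvg_param.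
have ci2 : continuous (fun y => itg a b (fun x => g (x, y))).
  apply: (@cvg_param _ a b (fun p => g (p.2, p.1))); apply: cont_comp cg.
  by apply: cont_pair; [exact: cont_snd|exact: cont_fst].
by rewrite -!integral_mkcond !itgE// => -[].
Qed.

(** Tonelli applied to the positive part and to its difference with the function. *)
Lemma itg_swap a b c d (g : R * R -> R) : continuous g ->
  itg a b (fun x => itg c d (fun y => g (x, y))) = itg c d (fun y => itg a b (fun x => g (x, y))).
Proof.
move=> cg.
pose gp p := Num.max (g p) 0; pose gn p := Num.max (g p) 0 - g p.
have cp : continuous gp by move=> p; apply: continuous_max; [exact: cg|exact: cvg_cst].
have cn : continuous gn by move=> p; apply: cvgB; [exact: cp|exact: cg].
have p0 p : 0 <= gp p by rewrite /gp le_max lexx orbT.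
have n0 p : 0 <= gn p by rewrite /gn subr_ge0 le_max lexx.
have gE p : g p = gp p - gn p by rewrite /gn opprB addrC subrK.
have sw (h : R * R -> R) : continuous h -> continuous (fun p => h (p.2, p.1)).
  move=> ch; apply: cont_comp ch.
  by apply: cont_pair; [exact: cont_snd|exact: cont_fst].
have {gE} -> : g = fun p => gp p - gn p by apply/funext.
have [cp1 cp2] := continuous_slice cp.
have [cn1 cn2] := continuous_slice cn.
have q1 : continuous (fun x => itg c d (fun y => gp (x, y))) by exact: cvg_param.
have q2 : continuous (fun x => itg c d (fun y => gn (x, y))) by exact: cvg_param.
have q3 : continuous (fun y => itg a b (fun x => gp (x, y))).
  by apply: (@cvg_param _ a b (fun p => gp (p.2, p.1))); exact: sw.
have q4 : continuous (fun y => itg a b (fun x => gn (x, y))).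
  by apply: (@cvg_param _ a b (fun p => gn (p.2, p.1))); exact: sw.
transitivity (itg a b (fun x => itg c d (fun y => gp (x, y))) -
              itg a b (fun x => itg c d (fun y => gn (x, y)))).
  rewrite -(itgB a b q1 q2); apply: itg_ext => x _.
  exact: (itgB _ _ (cp1 x) (cn1 x)).
rewrite !itg_swap_ge0// -(itgB c d q3 q4); apply: itg_ext => y _.
by rewrite (itgB _ _ (cp2 y) (cn2 y)).
Qed.

End Integral.

(** * Differential calculus in two variables *)

Section Calculus.
Variable R : realType.
Implicit Types (a b : R).

Lemma is_derive_cvgP (f : R -> R) a l :
  is_derive a 1 f l <-> h^-1 * (f (a + h) - f a) @[h --> 0^'] --> l.
Proof.
have E : (fun h : R => h^-1 *: ((f \o shift a) (h *: 1) - f a)) = (fun h => h^-1 * (f (a + h) - f a)).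
  by apply/funext => h /=; rewrite /GRing.scale/= mulr1 [h + a]addrC.
split=> [[df <-]|H].
  by rewrite -E; exact: df.
have df : derivable f a 1 by rewrite /derivable E; apply/cvg_ex; exists l; exact: H.
by apply: DeriveDef => //; rewrite /derive E; exact: cvg_lim.
Qed.

Lemma dD (f g : R -> R) (x df dg : R) : is_derive x 1 f df -> is_derive x 1 g dg ->
  is_derive x 1 (fun x => f x + g x) (df + dg).
Proof. by move=> hf hg; exact: is_deriveD. Qed.

Lemma dB (f g : R -> R) (x df dg : R) : is_derive x 1 f df -> is_derive x 1 g dg ->
  is_derive x 1 (fun x => f x - g x) (df - dg).
Proof. by move=> hf hg; exact: is_deriveB. Qed.

Lemma dZ (f : R -> R) (k x df : R) : is_derive x 1 f df ->
  is_derive x 1 (fun x => k * f x) (k * df).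
Proof. by move=> hf; exact: is_deriveZ. Qed.

Lemma dM (f g : R -> R) (x df dg : R) : is_derive x 1 f df -> is_derive x 1 g dg ->
  is_derive x 1 (fun x => f x * g x) (df * g x + f x * dg).
Proof.
move=> hf hg; apply: is_derive_eq (is_deriveM hf hg) _.
by rewrite /GRing.scale/= addrC mulrC.
Qed.

Lemma dcst (k x : R) : is_derive x 1 (fun=> k) (0 : R).
Proof. exact: is_derive_cst. Qed.

Lemma did (x : R) : is_derive x 1 (fun x => x) (1 : R).
Proof. exact: is_derive_id. Qed.

Lemma deq (f : R -> R) (x l l' : R) : is_derive x 1 f l -> l = l' -> is_derive x 1 f l'.
Proof. by move=> h <-. Qed.

Lemma dnear (f g : R -> R) (x l : R) : (\forall y \near x, f y = g y) ->
  is_derive x 1 g l -> is_derive x 1 f l.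
Proof. by move=> h; apply: near_eq_is_derive; apply: filterS h. Qed.

Lemma MVT_abs (f df : R -> R) a b :
  (forall x, `|x - a| <= `|b - a| -> is_derive x 1 f (df x)) ->
  exists2 c, `|c - a| <= `|b - a| & f b - f a = df c * (b - a).
Proof.
move=> H.
have cf (x y : R) : (forall z, x <= z <= y -> `|z - a| <= `|b - a|) -> {within `[x, y], continuous f}.
  move=> xy; apply: derivable_within_continuous => z; rewrite in_itv/= => /xy /H.
  by case.
have [ab|ba] := leP a b.
  have [||c] := @MVT_segment R f df a b ab.
  - move=> x; rewrite in_itv/= => /andP[ax xb]; apply: H.
    by rewrite !ger0_norm ?subr_ge0 ?lerB// ltW.
  - by apply: cf => z /andP[az zb]; rewrite !ger0_norm ?subr_ge0 ?lerB.
  rewrite in_itv/= => /andP[ac cb] E; exists c => //.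
  by rewrite !ger0_norm ?subr_ge0 ?lerB.
have [||c] := @MVT_segment R f df b a (ltW ba).
- move=> x; rewrite in_itv/= => /andP[ax xb]; apply: H.
  by rewrite !ler0_norm ?subr_le0 ?(ltW xb) ?(ltW ba)// lerN2 lerB // ltW.
- by apply: cf => z /andP[az zb]; rewrite !ler0_norm ?subr_le0 ?(ltW ba)// lerN2 lerB.
rewrite in_itv/= => /andP[ac cb] E; exists c.
  by rewrite !ler0_norm ?subr_le0 ?(ltW ba)// lerN2 lerB.
by rewrite -[LHS]opprB E -mulrN opprB.
Qed.

Lemma near_prod (P : R * R -> Prop) (a b : R) : (\forall p \near (a, b), P p) ->
  exists2 d, 0 < d & forall x y, `|x - a| < d -> `|y - b| < d -> P (x, y).
Proof.
move=> [[A B] /= [/nbhs_ballP[e1 /= e10 xA] /nbhs_ballP[e2 /= e20 zC]] AC].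
exists (Num.min e1 e2); first by rewrite lt_min e10 e20.
move=> x y; rewrite !lt_min => /andP[x1 _] /andP[_ y2]; apply: AC; split => /=.
  by apply: xA; rewrite /ball/= distrC.
by apply: zC; rewrite /ball/= distrC.
Qed.

(** Only the first partial derivative has to exist nearby and be continuous: the
    increment in the first variable is treated by the mean value theorem at the
    moved second variable, the increment in the second by the one-variable chain
    rule. Solutions come with separate partial derivatives, not with a Frechet
    derivative, so this is the form in which changes of variables are available. *)
Lemma is_derive_chain2 (g gx : R -> R -> R) (phi : R -> R) (gz dphi a : R) :
  (\forall p \near (a, phi a), is_derive (p.1 : R) 1 (g ^~ p.2) (gx p.1 p.2)) ->
  {for (a, phi a), continuous (fun p : R * R => gx p.1 p.2)} ->
  is_derive (phi a) 1 (g a) gz -> is_derive a 1 phi dphi ->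
  is_derive a 1 (fun x => g x (phi x)) (gx a (phi a) + gz * dphi).
Proof.
move=> gd gc dg dp.
have cphi : phi x @[x --> a] --> phi a.
  by case: dp => dp _; apply/differentiable_continuous/derivable1_diffP.
have -> : (fun x => g x (phi x)) = (fun x => g x (phi x) - g a (phi x)) + (g a \o phi).
  by apply/funext => x /=; rewrite /GRing.add/= subrK.
have dgp := @is_derive1_comp R (g a) phi a gz dphi dg dp.
apply: is_deriveD.
apply/is_derive_cvgP; rewrite subrr.
apply/cvgrPdist_le => e e0.
have [d d0 H] := near_prod gd.
move/cvgrPdist_le : gc => /(_ _ e0) /near_prod[d' d'0 H'].
have dd : 0 < Num.min d d' by rewrite lt_min d0 d'0.
have cphi0 : phi (a + h) @[h --> 0^'] --> phi a.
  suff H0 : phi (a + h) @[h --> (0 : R)] --> phi a.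
    by apply: cvg_trans H0; apply: cvg_app; exact: cvg_within.
  apply: (@cvg_comp _ _ _ (fun h => a + h) phi _ (nbhs a)) => //.
  by rewrite -{2}[a]addr0; apply: (@cvgD _ _ _ (nbhs (0 : R))); [exact: cvg_cst|exact: cvg_id].
move/cvgrPdist_lt : cphi0 => /(_ _ dd) ph.
near=> h.
have hd : `|h| < Num.min d d'.
  by near: h; exact: dnbhs0_lt.
have pd : `|phi (a + h) - phi a| < Num.min d d' by rewrite distrC; near: h.
move: hd pd; rewrite !lt_min => /andP[hd hd'] /andP[pd pd'].
have h0 : h != 0 by near: h; exact: nbhs_dnbhs_neq.
have aha : a + h - a = h by rewrite addrAC subrr add0r.
have [|c] := @MVT_abs (g ^~ (phi (a + h))) (gx ^~ (phi (a + h))) a (a + h).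
  move=> x; rewrite aha => xh; apply: (H x (phi (a + h))) => //.
  exact: le_lt_trans hd.
rewrite aha => ch ->.
rewrite subr0 mulrCA mulVf// mulr1.
apply: (H' c (phi (a + h))) => //; exact: le_lt_trans hd'.
Unshelve. all: end_near. Qed.

(** Symmetry of mixed derivatives when only one of them is known to exist near the
    point and to be continuous; the existence of the other one is a conclusion. *)
Lemma schwarz (f fx fy fxy : R -> R -> R) a b :
  (\forall p \near (a, b), is_derive (p.1 : R) 1 (f ^~ p.2) (fx p.1 p.2)) ->
  (\forall p \near (a, b), is_derive (p.2 : R) 1 (f p.1) (fy p.1 p.2)) ->
  (\forall p \near (a, b), is_derive (p.2 : R) 1 (fx p.1) (fxy p.1 p.2)) ->
  {for (a, b), continuous (fun p : R * R => fxy p.1 p.2)} ->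
  is_derive a 1 (fy ^~ b) (fxy a b).
Proof.
move=> Hx Hy Hxy cxy; apply/is_derive_cvgP/cvgrPdist_le => e e0.
have [d1 d10 {}Hx] := near_prod Hx.
have [d2 d20 {}Hy] := near_prod Hy.
have [d3 d30 {}Hxy] := near_prod Hxy.
move/cvgrPdist_le : cxy => /(_ _ e0) /near_prod[d4 d40 H'].
near=> h.
have h1 : `|h| < d1 by near: h; exact: dnbhs0_lt.
have h2 : `|h| < d2 by near: h; exact: dnbhs0_lt.
have h3 : `|h| < d3 by near: h; exact: dnbhs0_lt.
have h4 : `|h| < d4 by near: h; exact: dnbhs0_lt.
have h0 : h != 0 by near: h; exact: nbhs_dnbhs_neq.
have aha' : a + h - a = h by rewrite addrAC subrr add0r.
have aha x : `|x - a| <= `|a + h - a| -> `|x - a| <= `|h| by rewrite aha'.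
have dy x : `|x - a| <= `|h| -> is_derive b 1 (f x) (fy x b).
  move=> xh; apply: (Hy x b); first exact: le_lt_trans h2.
  by rewrite subrr normr0.
(* limit in k of the double difference quotient *)
have L : h^-1 * (k^-1 * (f (a + h) (b + k) - f (a + h) b) - k^-1 * (f a (b + k) - f a b)) @[k --> 0^']
     --> h^-1 * (fy (a + h) b - fy a b).
  apply: cvgMr; apply: cvgB; apply/is_derive_cvgP; apply: dy.
    by rewrite aha'.
  by rewrite subrr normr0.
have L' : `|fxy a b - h^-1 * (k^-1 * (f (a + h) (b + k) - f (a + h) b) - k^-1 * (f a (b + k) - f a b))| @[k --> 0^']
     --> `|fxy a b - h^-1 * (fy (a + h) b - fy a b)|.
  by apply: cvg_norm; apply: cvgB; [exact: cvg_cst|exact: L].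
rewrite /=; apply: (cvgr_to_le L'); near=> k.
have k1 : `|k| < d1 by near: k; exact: dnbhs0_lt.
have k3 : `|k| < d3 by near: k; exact: dnbhs0_lt.
have k4 : `|k| < d4 by near: k; exact: dnbhs0_lt.
have k0 : k != 0 by near: k; exact: nbhs_dnbhs_neq.
have bkb : b + k - b = k by rewrite addrAC subrr add0r.
have [|c ch E1] := @MVT_abs (fun x => f x (b + k) - f x b) (fun x => fx x (b + k) - fx x b) a (a + h).
  move=> x /aha xh; apply: is_deriveB.
    apply: (Hx x (b + k)); first exact: le_lt_trans h1.
    by rewrite bkb.
  apply: (Hx x b); first exact: le_lt_trans h1.
  by rewrite subrr normr0.
move/aha : ch => ch.
have [|t tk E2] := @MVT_abs (fx c) (fxy c) b (b + k).
  move=> y; rewrite bkb => yk.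
  by apply: (Hxy c y); [exact: le_lt_trans h3|exact: le_lt_trans k3].
rewrite bkb in tk.
have -> : h^-1 * (k^-1 * (f (a + h) (b + k) - f (a + h) b) - k^-1 * (f a (b + k) - f a b))
   = fxy c t.
  transitivity (h^-1 * k^-1 * ((f (a + h) (b + k) - f (a + h) b) - (f a (b + k) - f a b))).
    by ring.
  by rewrite E1 E2 aha' bkb; field; rewrite h0 k0.
by apply: (H' c t); [exact: le_lt_trans h4|exact: le_lt_trans k4].
Unshelve. all: end_near. Qed.

End Calculus.

(** * Conservation laws on a box *)

Section Box.
Variable R : realType.
Implicit Types (a b : R).

Lemma cont_tuple3 (U : topologicalType) (f g h : U -> R) :
  continuous f -> continuous g -> continuous h ->
  continuous (fun u => (f u, g u, h u) : R * R * R).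
Proof. by move=> cf cg ch; apply: cont_pair ch; exact: cont_pair. Qed.

Lemma cont_tuple2 (U : topologicalType) (f g : U -> R) :
  continuous f -> continuous g -> continuous (fun u => (f u, g u) : R * R).
Proof. exact: cont_pair. Qed.

Lemma cont_pr1 : continuous (fun q : R * R * R => q.1.1).
Proof. by apply: cont_comp; exact: cont_fst. Qed.

Lemma cont_pr2 : continuous (fun q : R * R * R => q.1.2).
Proof. by apply: cont_comp; [exact: cont_fst|exact: cont_snd]. Qed.

Lemma contD (U : topologicalType) (f g : U -> R) :
  continuous f -> continuous g -> continuous (fun u => f u + g u).
Proof. by move=> cf cg u; apply: cvgD; [exact: cf|exact: cg]. Qed.

Lemma contB (U : topologicalType) (f g : U -> R) :
  continuous f -> continuous g -> continuous (fun u => f u - g u).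
Proof. by move=> cf cg u; apply: cvgB; [exact: cf|exact: cg]. Qed.

Lemma contM (U : topologicalType) (f g : U -> R) :
  continuous f -> continuous g -> continuous (fun u => f u * g u).
Proof. by move=> cf cg u; apply: cvgM; [exact: cf|exact: cg]. Qed.

Lemma cont_cst (U V : topologicalType) (k : V) : continuous (fun _ : U => k).
Proof. by move=> u; exact: cvg_cst. Qed.

Lemma cont_id (U : topologicalType) : continuous (fun x : U => x).
Proof. by move=> u; exact: cvg_id. Qed.

(** A conservation law with densities that are continuous on the closed box, but
    whose derivatives are related to them only in the open box; it uses nothing
    beyond the fundamental theorem of calculus and exchange of integrals. *)
Lemma box_conservation a b (M0 M1 M2 m0 m1 m2 : R * R * R -> R) : a <= b ->
  continuous M0 -> continuous M1 -> continuous M2 ->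
  continuous m0 -> continuous m1 -> continuous m2 ->
  (forall x y t : R, 0 < x < 1 -> 0 < y < 1 -> a < t < b ->
    is_derive t 1 (fun t => M0 (x, y, t)) (m0 (x, y, t))) ->
  (forall x y t : R, 0 < x < 1 -> 0 < y < 1 -> a < t < b ->
    is_derive x 1 (fun x => M1 (x, y, t)) (m1 (x, y, t))) ->
  (forall x y t : R, 0 < x < 1 -> 0 < y < 1 -> a < t < b ->
    is_derive y 1 (fun y => M2 (x, y, t)) (m2 (x, y, t))) ->
  (forall y t : R, 0 < y < 1 -> a < t < b -> M1 (1, y, t) = M1 (0, y, t)) ->
  itg a b (fun t => itg 0 1 (fun x => itg 0 1 (fun y =>
     m0 (x, y, t) + m1 (x, y, t) + m2 (x, y, t)))) =
  itg 0 1 (fun x => itg 0 1 (fun y => M0 (x, y, b))) -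
  itg 0 1 (fun x => itg 0 1 (fun y => M0 (x, y, a))) +
  itg a b (fun t => itg 0 1 (fun x => M2 (x, 1, t) - M2 (x, 0, t))).
Proof.
move=> ab cM0 cM1 cM2 cm0 cm1 cm2 d0 d1 d2 per.
have slices (m : R * R * R -> R) : continuous m ->
   [/\ forall x y, continuous (fun t => m (x, y, t)),
       forall x t, continuous (fun y => m (x, y, t)) &
       forall y t, continuous (fun x => m (x, y, t))].
  by move=> cm; split=> u w; apply: cont_comp cm; apply: cont_tuple3;
    (exact: cont_cst || exact: cont_id).
have iy (m : R * R * R -> R) : continuous m -> continuous (fun p : R * R => itg 0 1 (fun y => m (p.1, y, p.2))).
  move=> cm; apply: (@cvg_param _ _ 0 1 (fun p : R * R * R => m (p.1.1, p.2, p.1.2))).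
  apply: cont_comp cm; apply: cont_tuple3; [exact: cont_pr1|exact: cont_snd|exact: cont_pr2].
have it (m : R * R * R -> R) : continuous m -> continuous (fun p : R * R => itg a b (fun t => m (p.1, p.2, t))).
  move=> cm; apply: (@cvg_param _ _ a b (fun p : R * R * R => m (p.1.1, p.1.2, p.2))).
  apply: cont_comp cm; apply: cont_tuple3; [exact: cont_pr1|exact: cont_pr2|exact: cont_snd].
have ix (m : R * R * R -> R) : continuous m -> continuous (fun p : R * R => itg 0 1 (fun x => m (x, p.1, p.2))).
  move=> cm; apply: (@cvg_param _ _ 0 1 (fun p : R * R * R => m (p.2, p.1.1, p.1.2))).
  apply: cont_comp cm; apply: cont_tuple3; [exact: cont_snd|exact: cont_pr1|exact: cont_pr2].
have sl1 (m : R * R -> R) t : continuous m -> continuous (fun x => m (x, t)).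
  by move=> cm; exact: (continuous_slice cm).2.
have sl2 (m : R * R -> R) x : continuous m -> continuous (fun t => m (x, t)).
  by move=> cm; exact: (continuous_slice cm).1.
have flip (m : R * R -> R) : continuous m -> continuous (fun p : R * R => m (p.2, p.1)).
  by move=> cm; apply: cont_comp cm; apply: cont_tuple2; [exact: cont_snd|exact: cont_fst].
have ixy (m : R * R -> R) c d : continuous m -> continuous (fun t => itg c d (fun x => m (x, t))).
  by move=> cm; apply: (@cvg_param _ _ c d (fun p => m (p.2, p.1))); exact: flip.
have ixy' (m : R * R -> R) c d : continuous m -> continuous (fun x => itg c d (fun t => m (x, t))).
  by move=> cm; exact: cvg_param.
have E0 : itg a b (fun t => itg 0 1 (fun x => itg 0 1 (fun y => m0 (x, y, t)))) =
    itg 0 1 (fun x => itg 0 1 (fun y => M0 (x, y, b))) -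
    itg 0 1 (fun x => itg 0 1 (fun y => M0 (x, y, a))).
  have [M0t M0y _] := slices _ cM0; have [m0t m0y m0x] := slices _ cm0.
  have H := itg_swap a b 0 1 (flip _ (iy _ cm0)).
  rewrite /= in H; rewrite {}H.
  have cMt t : continuous (fun x => itg 0 1 (fun y => M0 (x, y, t))) by exact: (sl1 _ t (iy _ cM0)).
  rewrite -(itgB 0 1 (cMt b) (cMt a)); apply: itg_eq.
  - exact: (ixy' _ a b (iy _ cm0)).
  - exact: contB.
  move=> x x01; rewrite -itgB//.
  have H : continuous (fun p : R * R => m0 (x, p.2, p.1)).
    by apply: cont_comp cm0; apply: cont_tuple3; [exact: cont_cst|exact: cont_snd|exact: cont_fst].
  have {}H' := itg_swap a b 0 1 H; rewrite /= in H'; rewrite {}H'.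
  apply: itg_eq; [exact: (ixy _ a b H)|by apply: contB|].
  move=> y y01; apply: (itg_FTC ab (m0t x y) (M0t x y)) => t tab.
  exact: d0.
have E1 : itg a b (fun t => itg 0 1 (fun x => itg 0 1 (fun y => m1 (x, y, t)))) = 0.
  have [_ _ M1x] := slices _ cM1; have [_ _ m1x] := slices _ cm1.
  transitivity (itg a b (fun=> 0)); last exact: itg0.
  apply: itg_eq; [exact: (ixy _ 0 1 (iy _ cm1))|exact: cont_cst|].
  move=> t tab.
  have H : continuous (fun p : R * R => m1 (p.1, p.2, t)).
    by apply: cont_comp cm1; apply: cont_tuple3; [exact: cont_fst|exact: cont_snd|exact: cont_cst].
  have {}H' := itg_swap 0 1 0 1 H; rewrite /= in H'; rewrite {}H'.
  transitivity (itg 0 1 (fun=> 0 : R)); last exact: itg0.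
  apply: itg_eq; [exact: (ixy _ 0 1 H)|exact: cont_cst|].
  move=> y y01; have -> : itg 0 1 (fun x => m1 (x, y, t)) = M1 (1, y, t) - M1 (0, y, t).
    by apply: (itg_FTC ler01 (m1x y t) (M1x y t)) => x x01; exact: d1.
  by rewrite per// subrr.
have E2 : itg a b (fun t => itg 0 1 (fun x => itg 0 1 (fun y => m2 (x, y, t)))) =
   itg a b (fun t => itg 0 1 (fun x => M2 (x, 1, t) - M2 (x, 0, t))).
  have [_ M2y M2x] := slices _ cM2; have [_ m2y _] := slices _ cm2.
  have H y : continuous (fun p : R * R => M2 (p.1, y, p.2)).
    by apply: cont_comp cM2; apply: cont_tuple3; [exact: cont_fst|exact: cont_cst|exact: cont_snd].
  have HB : continuous (fun p : R * R => M2 (p.1, 1, p.2) - M2 (p.1, 0, p.2)) by exact: contB.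
  apply: itg_eq; [exact: (ixy _ 0 1 (iy _ cm2))|exact: (ixy _ 0 1 HB)|].
  move=> t tab; apply: itg_eq; [exact: (sl1 _ t (iy _ cm2))|by apply: contB|].
  move=> x x01; apply: (itg_FTC ler01 (m2y x t) (M2y x t)) => y y01.
  exact: d2.
rewrite -E0 -E2.
transitivity (itg a b (fun t => itg 0 1 (fun x => itg 0 1 (fun y => m0 (x, y, t)))) +
  itg a b (fun t => itg 0 1 (fun x => itg 0 1 (fun y => m1 (x, y, t)))) +
  itg a b (fun t => itg 0 1 (fun x => itg 0 1 (fun y => m2 (x, y, t))))); last by rewrite E1 addr0.
have c3 (m : R * R * R -> R) : continuous m -> continuous (fun t => itg 0 1 (fun x => itg 0 1 (fun y => m (x, y, t)))).
  by move=> cm; exact: (ixy _ 0 1 (iy _ cm)).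
have D1 := itgD a b (c3 _ cm0) (c3 _ cm1).
have D2 := itgD a b (contD (c3 _ cm0) (c3 _ cm1)) (c3 _ cm2).
rewrite -D1 -D2; apply: itg_ext => t _.
have c2 (m : R * R * R -> R) : continuous m -> continuous (fun x => itg 0 1 (fun y => m (x, y, t))).
  by move=> cm; exact: (sl1 _ t (iy _ cm)).
have {}D1 := itgD 0 1 (c2 _ cm0) (c2 _ cm1).
have {}D2 := itgD 0 1 (contD (c2 _ cm0) (c2 _ cm1)) (c2 _ cm2).
rewrite -D1 -D2; apply: itg_ext => x _.
have [_ s0 _] := slices _ cm0; have [_ s1 _] := slices _ cm1; have [_ s2 _] := slices _ cm2.
have {}D1 := itgD 0 1 (s0 x t) (s1 x t).
have {}D2 := itgD 0 1 (contD (s0 x t) (s1 x t)) (s2 x t).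
by rewrite -D1 -D2.
Qed.

Lemma rect_conservation a b (U B u w : R * R -> R) : a <= b ->
  continuous U -> continuous B -> continuous u -> continuous w ->
  (forall x t : R, 0 < x < 1 -> a < t < b -> is_derive t 1 (fun t => U (x, t)) (u (x, t))) ->
  (forall x t : R, 0 < x < 1 -> a < t < b -> is_derive x 1 (fun x => B (x, t)) (w (x, t))) ->
  (forall t, a < t < b -> B (1, t) = B (0, t)) ->
  itg a b (fun t => itg 0 1 (fun x => u (x, t) + w (x, t))) =
  itg 0 1 (fun x => U (x, b)) - itg 0 1 (fun x => U (x, a)).
Proof.
move=> ab cU cB cu cw dU dB per.
have pr (m : R * R -> R) : continuous m -> continuous (fun q : R * R * R => m (q.1.1, q.2)).
  by move=> cm; apply: cont_comp cm; apply: cont_tuple2; [exact: cont_pr1|exact: cont_snd].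
have i1 k : itg 0 1 (fun=> k) = k :> R by rewrite itg_cst ?ler01// subr0 mulr1.
have cz : continuous (fun _ : R * R * R => 0 : R) by exact: cont_cst.
have := @box_conservation a b (fun q => U (q.1.1, q.2)) (fun q => B (q.1.1, q.2)) (fun=> 0)
  (fun q => u (q.1.1, q.2)) (fun q => w (q.1.1, q.2)) (fun=> 0) ab
  (pr _ cU) (pr _ cB) cz (pr _ cu) (pr _ cw) cz.
rewrite [X in _ -> _ -> _ -> _ -> X = _](_ : _ =
    itg a b (fun t => itg 0 1 (fun x => u (x, t) + w (x, t)))); last first.
  by apply: itg_ext => t _; apply: itg_ext => x _; rewrite /= i1 addr0.
move=> H; apply: etrans; first apply: H.
- by move=> x y t x01 _ tab; exact: dU.
- by move=> x y t x01 _ tab; exact: dB.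
- by move=> y t _; exact: per.
rewrite [X in _ + X](_ : _ = 0) ?addr0; last first.
  rewrite (_ : (fun t => _) = fun=> 0) ?itg0//; apply/funext => t.
  by rewrite (_ : (fun x => _) = fun=> 0) ?itg0//; apply/funext => x; rewrite /= subr0.
by congr (_ - _); apply: itg_ext => x _; rewrite /= i1.
Qed.

End Box.

(** * Pull-back of the moving domain to a fixed box *)

Section Clamp.
Variable R : realType.
Implicit Types (a b t : R).

(** Clamping to a segment turns continuity on a closed slab into continuity on the
    whole space, where composition and parametric integrals need no side condition. *)
Definition clamp a b t : R := Num.max a (Num.min t b).

Lemma clamp_id a b t : a <= t <= b -> clamp a b t = t.
Proof. by move=> /andP[at_ tb]; rewrite /clamp min_l// max_r. Qed.

Lemma clamp_itv a b t : a <= b -> a <= clamp a b t <= b.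
Proof. by move=> ab; rewrite /clamp le_max lexx/= ge_max ab ge_min lexx orbT. Qed.

Lemma clamp_cont a b : continuous (clamp a b).
Proof.
move=> t.
apply: (@continuous_max _ _ (fun=> a) (fun t => Num.min t b)); first exact: cvg_cst.
by apply: (@continuous_min _ _ (fun t => t) (fun=> b)); [exact: cvg_id|exact: cvg_cst].
Qed.

Lemma near_clamp a b t : a < t < b -> \forall s \near t, clamp a b s = s.
Proof.
move=> tab; have tab' : t \in `]a, b[%R by rewrite in_itv.
apply: filterS (near_in_itvoo tab') => s; rewrite in_itv/= => /andP[as_ sb].
by rewrite clamp_id// !ltW.
Qed.

Lemma near_pos (U : topologicalType) (f : U -> R) u : {for u, continuous f} -> 0 < f u ->
  \forall v \near u, 0 < f v.
Proof. by move=> cf f0; exact: (cvgr_gt _ cf). Qed.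

Lemma within_comp (U V : topologicalType) (K : set V) (phi : U -> V) (g : V -> R) :
  {within K, continuous g} -> continuous phi -> (forall u, K (phi u)) ->
  continuous (fun u => g (phi u)).
Proof.
move=> /subspace_continuousP cg cp Kp u B /(cg _ (Kp u)) H.
have H' : nbhs u (fun v => K (phi v) -> B (g (phi v))) := cp u _ H.
by apply: filterS H' => v /=; exact.
Qed.

Lemma within_open (U : topologicalType) (K D : set U) (g : U -> R) u :
  {within K, continuous g} -> open D -> D `<=` K -> D u -> {for u, continuous g}.
Proof.
move=> /subspace_continuousP cg oD DK Du B /(cg _ (DK _ Du)) H.
have ND : nbhs u D by exact: open_nbhs_nbhs.
by apply: filterS2 ND H => v Dv; apply; exact: DK.
Qed.

Lemma is_derive1P (f : R -> R) (x : R) : derivable f x 1 -> is_derive x 1 f (derive1 f x).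
Proof. by move=> df; split => //; rewrite derive1E. Qed.

End Clamp.

Section Windows.
Variables (R : realType) (T : R) (eta : R * R -> R).
Hypothesis Hs : structure_regular T eta.

(** The boolean [s] tells whether the initial time is excluded. *)
Definition timewin (s : bool) (a b : R) : bool :=
  [&& (if s then 0 < a else 0 <= a), a <= b & b < T].

Definition lat (s : bool) : set (R * R) := if s then lateral T else lateral0 T.

Definition flu (s : bool) : set (R * R * R) :=
  if s then fluid_cl eta T else fluid_cl0 eta T.

(** Continuity in the strip for times in every compact window: the clamped function
    is continuous on the plane. *)
Definition lat_cont s (h : R * R -> R) :=
  forall a b, timewin s a b -> continuous (fun q => h (q.1, clamp a b q.2)).

(** The change of variables $(x, y, t) \mapsto (x, y\,\eta(x,t), t)$ from the unit
    height to the fluid domain, with the height and the time clamped so that its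
    values always lie in the closed fluid domain. *)
Definition Psi a b (q : R * R * R) : R * R * R :=
  (q.1.1, clamp 0 1 q.1.2 * eta (q.1.1, clamp a b q.2), clamp a b q.2).

Definition flu_cont s (g : R * R * R -> R) :=
  forall a b, timewin s a b -> continuous (fun q => g (Psi a b q)).

Lemma timewin_lat s a b x t : timewin s a b -> lat s (x, clamp a b t).
Proof.
case/and3P=> a0 ab bT; have /andP[h1 h2] := clamp_itv t ab.
case: s a0 => a0; rewrite /lat/=; first by rewrite /lateral/= (lt_le_trans a0)//= (le_lt_trans h2).
by rewrite /lateral0/= (le_trans a0)//= (le_lt_trans h2).
Qed.

Lemma timewinW s a b : timewin s a b -> timewin false a b.
Proof. by rewrite /timewin; case: s => // /and3P[a0 -> ->]; rewrite ltW. Qed.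

Lemma lat_cont_within s h : {within lat s, continuous h} -> lat_cont s h.
Proof.
move=> ch a b ab; apply: (within_comp ch); last by move=> [x t]; exact: timewin_lat.
apply: cont_pair; first exact: cont_fst.
by apply: cont_comp; [exact: cont_snd|exact: clamp_cont].
Qed.

Lemma lat_contW h : lat_cont false h -> lat_cont true h.
Proof. by move=> ch a b /timewinW; exact: ch. Qed.

Lemma lat_cont_eta : lat_cont false eta.
Proof. by apply: lat_cont_within; have := eta_cont Hs (isT : (0 <= 2)%N). Qed.

Lemma Psi_cont s a b : timewin s a b -> continuous (Psi a b).
Proof.
move=> ab; apply: cont_tuple3; first exact: cont_pr1.
  apply: contM; first by apply: cont_comp; [exact: cont_pr2|exact: clamp_cont].
  refine (cont_comp (f := fun q : R * R * R => (q.1.1, q.2)) _ (lat_cont_eta (timewinW ab))).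
  by apply: cont_tuple2; [exact: cont_pr1|exact: cont_snd].
by apply: cont_comp; [exact: cont_snd|exact: clamp_cont].
Qed.

Lemma Psi_flu s a b q : timewin s a b -> flu s (Psi a b q).
Proof.
move=> ab; have e0 : 0 < eta (q.1.1, clamp a b q.2).
  by apply: (eta_positive Hs); exact: (@timewin_lat false _ _ _ _ (timewinW ab)).
have H : lat s (q.1.1, clamp a b q.2) by exact: timewin_lat.
have /andP[y0 y1] : 0 <= clamp 0 1 q.1.2 <= 1 by apply: clamp_itv.
have H2 : 0 <= clamp 0 1 q.1.2 * eta (q.1.1, clamp a b q.2) <= eta (q.1.1, clamp a b q.2).
  by rewrite mulr_ge0 ?(ltW e0)//= ler_piMl// ltW.
by rewrite /flu; case: s ab H => ab H; split.
Qed.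

Lemma flu_cont_within s g : {within flu s, continuous g} -> flu_cont s g.
Proof.
move=> cg a b ab; apply: (within_comp cg); first exact: Psi_cont ab.
by move=> q; exact: Psi_flu.
Qed.

Lemma lat_cont_D s g h : lat_cont s g -> lat_cont s h -> lat_cont s (fun q => g q + h q).
Proof. by move=> cg ch a b ab; apply: contD; [exact: cg|exact: ch]. Qed.

Lemma lat_cont_B s g h : lat_cont s g -> lat_cont s h -> lat_cont s (fun q => g q - h q).
Proof. by move=> cg ch a b ab; apply: contB; [exact: cg|exact: ch]. Qed.

Lemma lat_cont_M s g h : lat_cont s g -> lat_cont s h -> lat_cont s (fun q => g q * h q).
Proof. by move=> cg ch a b ab; apply: contM; [exact: cg|exact: ch]. Qed.

Lemma lat_cont_cst s k : lat_cont s (fun=> k).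
Proof. by move=> a b ab; exact: cont_cst. Qed.

Lemma flu_cont_D s g h : flu_cont s g -> flu_cont s h -> flu_cont s (fun q => g q + h q).
Proof. by move=> cg ch a b ab; apply: contD; [exact: cg|exact: ch]. Qed.

Lemma flu_cont_M s g h : flu_cont s g -> flu_cont s h -> flu_cont s (fun q => g q * h q).
Proof. by move=> cg ch a b ab; apply: contM; [exact: cg|exact: ch]. Qed.

Lemma flu_cont_cst s k : flu_cont s (fun=> k).
Proof. by move=> a b ab; exact: cont_cst. Qed.

(** [column g (x, t)] is the integral of [g] over the fibre [0 < z < eta (x, t)],
    rescaled to the unit interval. *)
Definition column (g : R * R * R -> R) (q : R * R) : R :=
  itg 0 1 (fun y => eta q * g (q.1, y * eta q, q.2)).

Definition top (g : R * R * R -> R) (q : R * R) : R := g (q.1, eta q, q.2).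

Lemma column_Psi g a b x t : column g (x, clamp a b t) =
  itg 0 1 (fun y => eta (x, clamp a b t) * g (Psi a b (x, y, t))).
Proof. by apply: itg_ext => y y01; rewrite /Psi/= (clamp_id y01). Qed.

Lemma flu_cont_slice s g a b x t : flu_cont s g -> timewin s a b ->
  continuous (fun y => eta (x, clamp a b t) * g (Psi a b (x, y, t))).
Proof.
move=> cg ab; apply: contM; first exact: cont_cst.
refine (cont_comp (f := fun y : R => (x, y, t)) _ (cg a b ab)).
by apply: cont_tuple3; [exact: cont_cst|exact: cont_id|exact: cont_cst].
Qed.

Lemma lat_cont_column s g : flu_cont s g -> lat_cont s (column g).
Proof.
move=> cg a b ab.
rewrite (_ : (fun q => _) = fun q : R * R => itg 0 1 (fun y => eta (q.1, clamp a b q.2) * g (Psi a b (q.1, y, q.2)))).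
  apply: (@cvg_param _ _ 0 1 (fun p : R * R * R => eta (p.1.1, clamp a b p.1.2) * g (Psi a b (p.1.1, p.2, p.1.2)))).
  apply: contM.
    refine (cont_comp (f := fun p : R * R * R => p.1) _ (lat_cont_eta (timewinW ab))).
    exact: cont_fst.
  refine (cont_comp (f := fun p : R * R * R => (p.1.1, p.2, p.1.2)) _ (cg a b ab)).
  by apply: cont_tuple3; [exact: cont_pr1|exact: cont_snd|exact: cont_pr2].
by apply/funext => -[x t]; exact: column_Psi.
Qed.

Lemma lat_cont_top s g : flu_cont s g -> lat_cont s (top g).
Proof.
move=> cg a b ab.
rewrite (_ : (fun q => _) = fun q : R * R => g (Psi a b (q.1, 1, q.2))).
  refine (cont_comp (f := fun q : R * R => (q.1, 1 : R, q.2)) _ (cg a b ab)).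
  by apply: cont_tuple3; [exact: cont_fst|exact: cont_cst|exact: cont_snd].
by apply/funext => q; rewrite /top /Psi/= (@clamp_id _ 0 1 1) ?ler01 ?lexx// mul1r.
Qed.

Lemma fluid_open : open (fluid eta T).
Proof.
rewrite openE => -[[x z] t] /= [/= /andP[t0 tT] /andP[z0 ze]].
set a := t / 2; set b := (t + T) / 2.
have tb : a < t < b.
  by rewrite /a /b ltr_pdivrMr// ltr_pdivlMr// !mulr_natr !mulr2n ltrDl t0/= ltrD2l.
have ab : timewin true a b.
  apply/and3P; split; first by rewrite /a divr_gt0.
    by case/andP: tb => /ltW + /ltW; exact: le_trans.
  by rewrite /b ltr_pdivrMr// mulr_natr mulr2n ltrD2r.
have cf : continuous (fun q : R * R * R => eta (q.1.1, clamp a b q.2) - q.1.2).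
  apply: contB; last exact: cont_pr2.
  refine (cont_comp (f := fun q : R * R * R => (q.1.1, q.2)) _ (lat_cont_eta (timewinW ab))).
  by apply: cont_tuple2; [exact: cont_pr1|exact: cont_snd].
have cltq : clamp a b t = t by apply: clamp_id; case/andP: tb => /ltW -> /ltW ->.
have N1 : \forall q \near (x, z, t), 0 < eta (q.1.1, clamp a b q.2) - q.1.2.
  by apply: (near_pos (cf (x, z, t))); rewrite /= cltq subr_gt0.
have N2 : \forall q \near (x, z, t), 0 < q.1.2 by apply: (near_pos (@cont_pr2 R (x, z, t))).
have N3 : \forall q \near (x, z, t), 0 < q.2.
  by apply: (near_pos (@cont_snd (R * R)%type R (x, z, t))).
have N4 : \forall q \near (x, z, t), 0 < T - q.2.
  apply: (near_pos (f := fun q : R * R * R => T - q.2)); last by rewrite /= subr_gt0.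
  by apply: contB; [exact: cont_cst|exact: cont_snd].
have N5 : \forall q \near (x, z, t), clamp a b q.2 = q.2.
  exact: (@cont_snd (R * R)%type R (x, z, t) _ (near_clamp tb)).
near=> q; split.
  apply/andP; split; first by near: q.
  by rewrite -subr_gt0; near: q.
have <- : clamp a b q.2 = q.2 by near: q.
apply/andP; split; first by near: q.
by rewrite -subr_gt0; near: q.
Unshelve. all: end_near. Qed.

Lemma fluid_sub : fluid eta T `<=` fluid_cl eta T.
Proof. by move=> q [h1 /andP[h2 h3]]; split => //; rewrite !ltW. Qed.

Lemma fluid_cont (g : R * R * R -> R) (q : R * R * R) : {within fluid_cl eta T, continuous g} -> fluid eta T q ->
  {for q, continuous g}.
Proof. by move=> cg; apply: (within_open cg fluid_open fluid_sub). Qed.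

End Windows.

Section Transport.
Variables (R : realType) (T : R) (eta : R * R -> R).
Hypothesis Hs : structure_regular T eta.

Let Flu := fluid eta T.

Lemma near_fluid_tz x z t : Flu (x, z, t) -> \forall p \near (t, z), Flu (x, p.2, p.1).
Proof.
move=> H; have c : continuous (fun p : R * R => (x, p.2, p.1)).
  by apply: cont_tuple3; [exact: cont_cst|exact: cont_snd|exact: cont_fst].
have N : nbhs (x, z, t) Flu by apply: open_nbhs_nbhs; split => //; exact: fluid_open.
exact: (c (t, z) _ N).
Qed.

Lemma near_fluid_xz x z t : Flu (x, z, t) -> \forall p \near (x, z), Flu (p.1, p.2, t).
Proof.
move=> H; have c : continuous (fun p : R * R => (p.1, p.2, t)).
  by apply: cont_tuple3; [exact: cont_fst|exact: cont_snd|exact: cont_cst].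
have N : nbhs (x, z, t) Flu by apply: open_nbhs_nbhs; split => //; exact: fluid_open.
exact: (c (x, z) _ N).
Qed.

Lemma is_derive_eta_t (x t : R) : 0 < t < T -> is_derive t 1 (fun t => eta (x, t)) (pt eta (x, t)).
Proof. by move=> tT; apply: is_derive1P; exact: (@eta_pt _ _ _ Hs (x, t)). Qed.

Lemma is_derive_eta_x (x t : R) : 0 < t < T -> is_derive x 1 (fun x => eta (x, t)) (px eta (x, t)).
Proof. by move=> tT; apply: is_derive1P; exact: (@eta_px _ _ _ Hs 0%N (x, t)). Qed.

(** The vertical velocity of the moving coordinates is $y\,\partial_t\eta$. *)
Lemma is_derive_ale_t (A At Az : R * R * R -> R) (x y t : R) : 0 < y < 1 -> 0 < t < T ->
  {within fluid_cl eta T, continuous At} ->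
  (forall x z t : R, Flu (x, z, t) -> is_derive t 1 (fun t => A (x, z, t)) (At (x, z, t))) ->
  (forall x z t : R, Flu (x, z, t) -> is_derive z 1 (fun z => A (x, z, t)) (Az (x, z, t))) ->
  is_derive t 1 (fun t => A (x, y * eta (x, t), t))
    (At (x, y * eta (x, t), t) + Az (x, y * eta (x, t), t) * (y * pt eta (x, t))).
Proof.
move=> /andP[y0 y1] tT cAt dAt dAz.
have e0 : 0 < eta (x, t).
  by apply: (eta_positive Hs); case/andP: tT => t0 tT; rewrite /lateral0/= (ltW t0).
have F : Flu (x, y * eta (x, t), t).
  by split => //=; rewrite mulr_gt0// gtr_pMl.
apply: (@is_derive_chain2 R (fun t z => A (x, z, t)) (fun t z => At (x, z, t)) (fun t => y * eta (x, t))).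
- by apply: filterS (near_fluid_tz F) => p; exact: dAt.
- have c : continuous (fun p : R * R => (x, p.2, p.1)).
    by apply: cont_tuple3; [exact: cont_cst|exact: cont_snd|exact: cont_fst].
  have cA := fluid_cont Hs cAt F.
  exact: (@continuous_comp _ _ _ _ At _ (c (t, y * eta (x, t))) cA).
- exact: dAz.
- exact/dZ/is_derive_eta_t.
Qed.

Lemma is_derive_ale_x (A Ax Az : R * R * R -> R) (x y t : R) : 0 < y < 1 -> 0 < t < T ->
  {within fluid_cl eta T, continuous Ax} ->
  (forall x z t : R, Flu (x, z, t) -> is_derive x 1 (fun x => A (x, z, t)) (Ax (x, z, t))) ->
  (forall x z t : R, Flu (x, z, t) -> is_derive z 1 (fun z => A (x, z, t)) (Az (x, z, t))) ->
  is_derive x 1 (fun x => A (x, y * eta (x, t), t))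
    (Ax (x, y * eta (x, t), t) + Az (x, y * eta (x, t), t) * (y * px eta (x, t))).
Proof.
move=> /andP[y0 y1] tT cAt dAt dAz.
have e0 : 0 < eta (x, t).
  by apply: (eta_positive Hs); case/andP: tT => t0 tT; rewrite /lateral0/= (ltW t0).
have F : Flu (x, y * eta (x, t), t).
  by split => //=; rewrite mulr_gt0// gtr_pMl.
apply: (@is_derive_chain2 R (fun x z => A (x, z, t)) (fun x z => Ax (x, z, t)) (fun x => y * eta (x, t))).
- by apply: filterS (near_fluid_xz F) => p; exact: dAt.
- have c : continuous (fun p : R * R => (p.1, p.2, t)).
    by apply: cont_tuple3; [exact: cont_fst|exact: cont_snd|exact: cont_cst].
  have cA := fluid_cont Hs cAt F.
  exact: (@continuous_comp _ _ _ _ Ax _ (c (x, y * eta (x, t))) cA).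
- exact: dAz.
- exact/dZ/is_derive_eta_x.
Qed.

End Transport.

(** * Transport theorem on the moving domain *)

Section TransportTheorem.
Variables (R : realType) (T : R) (eta : R * R -> R).
Hypothesis Hs : structure_regular T eta.

Let Flu := fluid eta T.

Lemma extends_within (U : topologicalType) (Q K : set U) (u : U -> R) : Q `<=` K ->
  extends_cont Q K u -> {within Q, continuous u}.
Proof.
move=> QK [g [cg gu]]; apply/subspace_continuousP => x Qx.
have H : g @ within Q (nbhs x) --> g x.
  by have /subspace_continuousP := continuous_subspaceW QK cg; exact.
rewrite (gu x Qx) in H; apply: cvg_trans H; apply: near_eq_cvg.
by rewrite near_withinE; near=> y => Qy; rewrite gu.
Unshelve. all: end_near. Qed.

Lemma lat_cont_px k : (k <= 4)%N -> lat_cont T true (iter k (@px R) eta).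
Proof. by move=> k4; apply: lat_cont_within; exact: (eta_px_cont Hs). Qed.

Lemma lat_cont_pt : lat_cont T true (pt eta).
Proof.
apply: lat_cont_within; apply: (extends_within _ (eta_pt_cont Hs)).
by move=> q /andP[q0 qT]; rewrite /lateral0/= (ltW q0).
Qed.

(** Reynolds' transport theorem combined with the divergence theorem. In the
    coordinates $(x, y, t)$ the identity
    $\partial_t(\eta A) + \partial_x(\eta F_1) + \partial_y(F_2 - y\eta_x F_1 - y\eta_t A)
    = \eta (A_t + F_{1x} + F_{2z})$
    holds pointwise, so that the law on the box applies; the boundary term at
    $y = 1$ is the flux through the moving graph, including the transport of [A]. *)
Lemma transport a b (A At Az F1 F1x F1z F2 F2z : R * R * R -> R) : timewin T true a b ->
  {within fluid_cl eta T, continuous A} -> {within fluid_cl eta T, continuous At} ->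
  {within fluid_cl eta T, continuous Az} -> {within fluid_cl eta T, continuous F1} ->
  {within fluid_cl eta T, continuous F1x} -> {within fluid_cl eta T, continuous F1z} ->
  {within fluid_cl eta T, continuous F2} -> {within fluid_cl eta T, continuous F2z} ->
  (forall x z t : R, Flu (x, z, t) -> is_derive t 1 (fun t => A (x, z, t)) (At (x, z, t))) ->
  (forall x z t : R, Flu (x, z, t) -> is_derive z 1 (fun z => A (x, z, t)) (Az (x, z, t))) ->
  (forall x z t : R, Flu (x, z, t) -> is_derive x 1 (fun x => F1 (x, z, t)) (F1x (x, z, t))) ->
  (forall x z t : R, Flu (x, z, t) -> is_derive z 1 (fun z => F1 (x, z, t)) (F1z (x, z, t))) ->
  (forall x z t : R, Flu (x, z, t) -> is_derive z 1 (fun z => F2 (x, z, t)) (F2z (x, z, t))) ->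
  (forall z t, 0 < t < T -> 0 < z < eta (0, t) -> F1 (1, z, t) = F1 (0, z, t)) ->
  (forall x t, 0 < x < 1 -> 0 < t < T -> F2 (x, 0, t) = 0) ->
  itg 0 1 (fun x => column eta A (x, b)) - itg 0 1 (fun x => column eta A (x, a)) +
  itg a b (fun t => itg 0 1 (fun x => top eta F2 (x, t) - px eta (x, t) * top eta F1 (x, t)
      - pt eta (x, t) * top eta A (x, t))) =
  itg a b (fun t => itg 0 1 (fun x => column eta (fun q => At q + F1x q + F2z q) (x, t))).
Proof.
move=> ab wA wAt wAz wF1 wF1x wF1z wF2 wF2z dAt dAz dF1x dF1z dF2z per bot.
have /and3P[a0 ab' bT] := ab.
have cl_in t : 0 < clamp a b t < T.
  by have /andP[h1 h2] := clamp_itv t ab'; rewrite (lt_le_trans a0)//= (le_lt_trans h2).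
have in_T t : a < t < b -> 0 < t < T.
  by move=> /andP[h1 h2]; rewrite (lt_trans a0)//= (lt_trans h2).
have cf (g : R * R * R -> R) : {within fluid_cl eta T, continuous g} -> continuous (fun q => g (Psi eta a b q)).
  by move=> wg; exact: (flu_cont_within Hs (s := true) wg ab).
have cp (h : R * R -> R) : lat_cont T true h -> continuous (fun q : R * R * R => h (q.1.1, clamp a b q.2)).
  move=> ch; refine (cont_comp (f := fun q : R * R * R => (q.1.1, q.2)) _ (ch a b ab)).
  by apply: cont_tuple2; [exact: cont_pr1|exact: cont_snd].
pose e (q : R * R * R) := eta (q.1.1, clamp a b q.2).
pose X (q : R * R * R) := px eta (q.1.1, clamp a b q.2).
pose D (q : R * R * R) := pt eta (q.1.1, clamp a b q.2).
have ce : continuous e by exact: (cp _ (lat_cont_px (isT : (0 <= 4)%N))).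
have cX : continuous X by exact: (cp _ (lat_cont_px (isT : (1 <= 4)%N))).
have cD : continuous D by exact: (cp _ lat_cont_pt).
have e_gt0 q : 0 < e q.
  apply: (eta_positive Hs); have /andP[h1 h2] := cl_in q.2.
  by rewrite /lateral0/= ltW.
pose P := Psi eta a b.
have PE x y t : 0 < y < 1 -> P (x, y, t) = (x, y * e (x, y, t), clamp a b t).
  by case/andP=> y0 y1; rewrite /P /Psi/= (@clamp_id _ 0 1 y)// !ltW.
have PF x y t : 0 < y < 1 -> Flu (P (x, y, t)).
  move=> /[dup] y01 /andP[y0 y1]; rewrite PE//; split => //=.
  by rewrite mulr_gt0//= gtr_pMl.
pose M0 q := e q * A (P q).
pose m0 q := D q * A (P q) + e q * (At (P q) + Az (P q) * (q.1.2 * D q)).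
pose M1 q := e q * F1 (P q).
pose m1 q := X q * F1 (P q) + e q * (F1x (P q) + F1z (P q) * (q.1.2 * X q)).
pose M2 q := F2 (P q) - q.1.2 * (X q * F1 (P q)) - q.1.2 * (D q * A (P q)).
pose m2 q := F2z (P q) * e q - (X q * F1 (P q) + q.1.2 * (X q * (F1z (P q) * e q)))
   - (D q * A (P q) + q.1.2 * (D q * (Az (P q) * e q))).
have cy : continuous (fun q : R * R * R => q.1.2) by exact: cont_pr2.
have cA := cf _ wA; have cAt := cf _ wAt; have cAz := cf _ wAz.
have cF1 := cf _ wF1; have cF1x := cf _ wF1x; have cF1z := cf _ wF1z.
have cF2 := cf _ wF2; have cF2z := cf _ wF2z.
have cM0 : continuous M0 by exact: contM.
have cM1 : continuous M1 by exact: contM.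
have cM2 : continuous M2.
  exact: (contB (contB cF2 (contM cy (contM cX cF1))) (contM cy (contM cD cA))).
have cm0 : continuous m0.
  exact: (contD (contM cD cA) (contM ce (contD cAt (contM cAz (contM cy cD))))).
have cm1 : continuous m1.
  exact: (contD (contM cX cF1) (contM ce (contD cF1x (contM cF1z (contM cy cX))))).
have cm2 : continuous m2.
  exact: (contB (contB (contM cF2z ce)
    (contD (contM cX cF1) (contM cy (contM cX (contM cF1z ce)))))
    (contD (contM cD cA) (contM cy (contM cD (contM cAz ce))))).
have clE t : a < t < b -> clamp a b t = t by move=> /andP[h1 h2]; rewrite clamp_id// !ltW.
have H : itg a b (fun t => itg 0 1 (fun x => itg 0 1 (fun y =>
     m0 (x, y, t) + m1 (x, y, t) + m2 (x, y, t)))) =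
  itg 0 1 (fun x => itg 0 1 (fun y => M0 (x, y, b))) -
  itg 0 1 (fun x => itg 0 1 (fun y => M0 (x, y, a))) +
  itg a b (fun t => itg 0 1 (fun x => M2 (x, 1, t) - M2 (x, 0, t))).
  apply: (box_conservation ab' cM0 cM1 cM2 cm0 cm1 cm2).
  - move=> x y t x01 y01 tab; have tT := in_T t tab.
    apply: (@dnear _ _ (fun t => eta (x, t) * A (x, y * eta (x, t), t))).
      by apply: filterS (near_clamp tab) => s st; rewrite /M0 PE// /e/= st.
    rewrite /m0 PE// /e /D/= clE//; apply: dM; first exact: (is_derive_eta_t Hs x tT).
    exact: (is_derive_ale_t Hs x y01 tT wAt dAt dAz).
  - move=> x y t x01 y01 tab; have tT := in_T t tab.
    rewrite [X in is_derive _ _ X _](_ : _ = (fun x => eta (x, t) * F1 (x, y * eta (x, t), t))); last first.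
      by apply/funext => s; rewrite /M1 PE// /e/= clE.
    rewrite /m1 PE// /e /X/= clE//; apply: dM; first exact: (is_derive_eta_x Hs x tT).
    exact: (is_derive_ale_x Hs x y01 tT wF1x dF1x dF1z).
  - move=> x y t x01 y01 tab; have tT := in_T t tab.
    have dz (g gz : R * R * R -> R) :
        (forall x z t : R, Flu (x, z, t) -> is_derive z 1 (fun z => g (x, z, t)) (gz (x, z, t))) ->
        is_derive y 1 (fun y => g (P (x, y, t))) (gz (P (x, y, t)) * e (x, y, t)).
      move=> dg; apply: (@dnear _ _ (fun y => g (x, y * eta (x, t), t))).
        by apply: filterS (near_clamp y01) => s st; rewrite /P /Psi/= st clE.
      have s : is_derive y 1 (fun y : R => y * eta (x, t)) (eta (x, t)).
        by apply: deq (dM (did y) (dcst (eta (x, t)) y)) _; rewrite mul1r mulr0 addr0.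
      rewrite PE// /e/= clE//.
      have h : Flu (x, y * eta (x, t), t) by have := PF x y t y01; rewrite PE// /e/= clE.
      exact: (@is_derive1_comp R (fun z => g (x, z, t)) (fun y => y * eta (x, t)) y _ _ (dg _ _ _ h) s).
    rewrite /M2 /m2/=.
    refine (dB (dB (dz _ _ dF2z) _) _).
      apply: deq (dM (did y) (dM (dcst (X (x, y, t)) y) (dz _ _ dF1z))) _.
      by rewrite mul1r mul0r add0r.
    apply: deq (dM (did y) (dM (dcst (D (x, y, t)) y) (dz _ _ dAz))) _.
    by rewrite mul1r mul0r add0r.
  - move=> y t y01 tab; have tT := in_T t tab.
    have E : eta (1, t) = eta (0, t).
      have L : lateral0 T (0, t) by case/andP: tT => t0 ?; rewrite /lateral0/= (ltW t0).
      by have := eta_periodic Hs L; rewrite add0r.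
    rewrite /M1 !PE// /e/= clE// E per//.
    by case/andP: y01 => y0 y1; have := e_gt0 (0, y, t); rewrite /e/= clE// => e0; rewrite mulr_gt0//= gtr_pMl.
have colE (g : R * R * R -> R) x t : a <= t <= b -> column eta g (x, t) = itg 0 1 (fun y => e (x, y, t) * g (P (x, y, t))).
  by move=> tab; rewrite -{1}(clamp_id tab) (@column_Psi _ _ g a b x t).
have ablex : a <= b <= b by rewrite ab' lexx.
have aalex : a <= a <= b by rewrite ab' lexx.
transitivity (itg a b (fun t => itg 0 1 (fun x => itg 0 1 (fun y =>
     m0 (x, y, t) + m1 (x, y, t) + m2 (x, y, t))))); last first.
  apply: itg_ext => t tab; apply: itg_ext => x x01.
  rewrite colE//; apply: itg_ext => y y01.
  by rewrite /m0 /m1 /m2; ring.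
rewrite H; congr (_ - _ + _).
- by apply: itg_ext => x x01; rewrite colE.
- by apply: itg_ext => x x01; rewrite colE.
have c1 : continuous (fun p : R * R => M2 (p.1, 1, p.2)).
  by apply: cont_comp cM2; apply: cont_tuple3; [exact: cont_fst|exact: cont_cst|exact: cont_snd].
have c0 : continuous (fun p : R * R => M2 (p.1, 0, p.2)).
  by apply: cont_comp cM2; apply: cont_tuple3; [exact: cont_fst|exact: cont_cst|exact: cont_snd].
apply: itg_ext => t tab.
transitivity (itg 0 1 (fun x => M2 (x, 1, t))).
  apply: itg_ext => x x01; rewrite /M2 /P /Psi /X /D/= /top/= (@clamp_id _ 0 1 1) ?ler01 ?lexx//.
  by rewrite !mul1r clamp_id.
apply: itg_eq; [exact: (continuous_slice c1).2|exact: (continuous_slice (contB c1 c0)).2|].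
move=> x x01; rewrite [X in _ = _ - X](_ : _ = 0) ?subr0//.
by rewrite /M2 /P /Psi/= (@clamp_id _ 0 1 0) ?ler01 ?lexx// !mul0r bot// !subr0.
Qed.

End TransportTheorem.

(** * The equations in terms of the extended derivatives *)

Section Extension.
Variables (U : topologicalType) (R : realType).

(** The continuous extension of [u] from [Q] to [K], and [u] itself when there
    is none. *)
Definition ext (Q K : set U) (u : U -> R) : U -> R :=
  if pselect (extends_cont Q K u) is left h then sval (cid h) else u.

Lemma ext_cont Q K u : extends_cont Q K u -> {within K, continuous (ext Q K u)}.
Proof. by rewrite /ext; case: pselect => // h _; case: (cid h) => g /= []. Qed.

Lemma extE Q K u q : extends_cont Q K u -> Q q -> ext Q K u q = u q.
Proof. by rewrite /ext; case: pselect => // h _; case: (cid h) => g /= [_ H] /H. Qed.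

End Extension.

Section DirectionalDerivative.
Variable R : realType.

Definition isd (j : 'I_2) (g : R * R * R -> R) (q : R * R * R) (l : R) : Prop :=
  if j == 0 then is_derive q.1.1 1 (fun x => g (x, q.1.2, q.2)) l
  else is_derive q.1.2 1 (fun z => g (q.1.1, z, q.2)) l.

Lemma isd_dsp j g q l : isd j g q l -> dsp j g q = l.
Proof.
by rewrite /isd /dsp; case: ifP => _ [_ <-]; rewrite derive1E.
Qed.

Lemma isd_derivable j g q : derivable_dsp j g q -> isd j g q (dsp j g q).
Proof. by rewrite /isd /dsp /derivable_dsp; case: ifP => _; exact: is_derive1P. Qed.

Lemma isdD j f g q lf lg : isd j f q lf -> isd j g q lg ->
  isd j (fun q => f q + g q) q (lf + lg).
Proof. by rewrite /isd; case: ifP => _; exact: dD. Qed.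

Lemma isdB j f g q lf lg : isd j f q lf -> isd j g q lg ->
  isd j (fun q => f q - g q) q (lf - lg).
Proof. by rewrite /isd; case: ifP => _; exact: dB. Qed.

Lemma isdM j f g q lf lg : isd j f q lf -> isd j g q lg ->
  isd j (fun q => f q * g q) q (lf * g q + f q * lg).
Proof. by case: q => -[x z] t; rewrite /isd; case: ifP => _; exact: dM. Qed.

Lemma isd_cst j k q : isd j (fun=> k) q 0.
Proof. by rewrite /isd; case: ifP => _; exact: dcst. Qed.

Lemma isd_eq j g q l l' : isd j g q l -> l = l' -> isd j g q l'.
Proof. by move=> h <-. Qed.

Lemma isd_uniq j g q l l' : isd j g q l -> isd j g q l' -> l = l'.
Proof. by move=> /isd_dsp <- /isd_dsp <-. Qed.

Lemma isd_near (D : set (R * R * R)) j f g q l : open D -> D q ->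
  (forall q, D q -> f q = g q) -> isd j g q l -> isd j f q l.
Proof.
case: q => -[x z] t oD Dq fg; rewrite /isd/=; case: ifP => _; apply: dnear.
- have c : continuous (fun s : R => (s, z, t)).
    by apply: cont_tuple3; [exact: cont_id|exact: cont_cst|exact: cont_cst].
  have N : nbhs (x, z, t) D by apply: open_nbhs_nbhs.
  have N' : \forall s \near x, D (s, z, t) := c x _ N.
  by apply: filterS N' => s; exact: fg.
- have c : continuous (fun s : R => (x, s, t)).
    by apply: cont_tuple3; [exact: cont_cst|exact: cont_id|exact: cont_cst].
  have N : nbhs (x, z, t) D by apply: open_nbhs_nbhs.
  have N' : \forall s \near z, D (x, s, t) := c z _ N.
  by apply: filterS N' => s; exact: fg.
Qed.

Lemma sum2E (V : nmodType) (F : 'I_2 -> V) : \sum_i F i = F 0 + F 1.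
Proof. by rewrite big_ord_recl big_ord1; congr (_ + F _); apply/val_inj. Qed.

Lemma ord2P (i : 'I_2) : {i = 0} + {i = 1}.
Proof. by case: i => -[|[|//]] h; [left|right]; apply/val_inj. Qed.

End DirectionalDerivative.

Fact viscous_alg1 (R : realFieldType) (E a b s P Q : R) : a + s = 0 ->
  E - (a + b) + P = E - (a + a - P *+ true + (b + s - Q *+ false)).
Proof. by move=> h; rewrite mulr1n mulr0n; lra. Qed.

Fact viscous_alg2 (R : realFieldType) (E a b s P Q : R) : s + b = 0 ->
  E - (a + b) + P = E - (a + s - Q *+ false + (b + b - P *+ true)).
Proof. by move=> h; rewrite mulr1n mulr0n; lra. Qed.

Section Solution.
Variables (R : realType) (rho delta beta r : R) (eta0 : R -> R) (eps T : R).
Variables (f v : R * R * R -> 'rV[R]_2) (p : R * R * R -> R) (eta : R * R -> R).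
Hypothesis sol : classical_solution rho delta beta r eta0 eps T f v p eta.

Let Hs : structure_regular T eta := sol_structure_regular sol.
Let Hf : fluid_regular T eta v p := sol_fluid_regular sol.
Let Flu := fluid eta T.
Let Cl := fluid_cl eta T.

Local Notation w i := (vcomp v i).
(** The derivatives of the solution exist inside the fluid domain only; everything
    below uses their continuous extensions, which have traces on the boundary. *)
Definition vd i j := ext Flu Cl (dsp j (w i)).
Definition vd2 i j k := ext Flu Cl (dsp k (dsp j (w i))).
Definition vt i := ext Flu Cl (dtm (w i)).
Definition pr := ext Flu Cl p.
Definition prd j := ext Flu Cl (dsp j p).

Lemma flu_cl_sub : Cl `<=` fluid_cl0 eta T.
Proof. by move=> q [/andP[q0 qT] h]; split => //; rewrite ltW. Qed.

Lemma v_within i : {within Cl, continuous (w i)}.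
Proof. apply: continuous_subspaceW flu_cl_sub _; exact: (v_cont Hf). Qed.

Lemma vd_within i j : {within Cl, continuous (vd i j)}.
Proof. by apply: ext_cont; exact: (v_dsp_cont Hf). Qed.

Lemma vd2_within i j k : {within Cl, continuous (vd2 i j k)}.
Proof. by apply: ext_cont; exact: (v_dsp2_cont Hf). Qed.

Lemma vt_within i : {within Cl, continuous (vt i)}.
Proof. by apply: ext_cont; exact: (v_dtm_cont Hf). Qed.

Lemma pr_within : {within Cl, continuous pr}.
Proof. by apply: ext_cont; exact: (p_cont Hf). Qed.

Lemma prd_within j : {within Cl, continuous (prd j)}.
Proof. by apply: ext_cont; exact: (p_dsp_cont Hf). Qed.

Lemma vdE i j q : Flu q -> vd i j q = dsp j (w i) q.
Proof. by apply: extE; exact: (v_dsp_cont Hf). Qed.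

Lemma prE q : Flu q -> pr q = p q.
Proof. by apply: extE; exact: (p_cont Hf). Qed.

Lemma isd_v i j q : Flu q -> isd j (w i) q (vd i j q).
Proof. by move=> Fq; rewrite vdE//; apply: isd_derivable; exact: (v_dsp Hf). Qed.

Lemma isd_vd i j k q : Flu q -> isd k (vd i j) q (vd2 i j k q).
Proof.
move=> Fq; apply: (isd_near (fluid_open Hs) Fq (vdE i j)).
rewrite /vd2 (extE (v_dsp2_cont Hf i j k))//; apply: isd_derivable; exact: (v_dsp2 Hf).
Qed.

Lemma isd_pr k q : Flu q -> isd k pr q (prd k q).
Proof.
move=> Fq; apply: (isd_near (fluid_open Hs) Fq prE).
rewrite /prd (extE (p_dsp_cont Hf k))//; apply: isd_derivable; exact: (p_dsp Hf).
Qed.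

Lemma is_derive_vt i x z t : Flu (x, z, t) ->
  is_derive t 1 (fun t => w i (x, z, t)) (vt i (x, z, t)).
Proof.
move=> Fq; rewrite /vt (extE (v_dtm_cont Hf i))//; exact: (is_derive1P (@v_dtm _ _ _ _ _ Hf i _ Fq)).
Qed.

(** Needed because the divergence of the stress contains the mixed derivatives in
    both orders. *)
Lemma vd2_sym i q : Flu q -> vd2 i 0 1 q = vd2 i 1 0 q.
Proof.
case: q => -[x z] t Fq.
have N := near_fluid_xz Hs Fq.
have H : is_derive x 1 (fun x => vd i 1 (x, z, t)) (vd2 i 0 1 (x, z, t)).
  apply: (@schwarz R (fun x z => w i (x, z, t)) (fun x z => vd i 0 (x, z, t))
    (fun x z => vd i 1 (x, z, t)) (fun x z => vd2 i 0 1 (x, z, t))).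
  - by apply: filterS N => q; exact: (@isd_v i 0).
  - by apply: filterS N => q; exact: (@isd_v i 1).
  - by apply: filterS N => q; exact: (@isd_vd i 0 1).
  - have c : continuous (fun p : R * R => (p.1, p.2, t)).
      by apply: cont_tuple3; [exact: cont_fst|exact: cont_snd|exact: cont_cst].
    have cA := fluid_cont Hs (@vd2_within i 0 1) Fq.
    exact: (@continuous_comp _ _ _ _ (vd2 i 0 1) _ (c (x, z)) cA).
have H' : isd 0 (vd i 1) (x, z, t) (vd2 i 0 1 (x, z, t)) := H.
exact: isd_uniq H' (isd_vd i 1 0 Fq).
Qed.

Definition cell : set (R * R * R) := [set q | Flu q /\ 0 < q.1.1 < 1].

Lemma cell_open : open cell.
Proof.
have c : continuous (fun q : R * R * R => q.1.1) by exact: cont_pr1.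
have -> : cell = Flu `&` (fun q : R * R * R => q.1.1) @^-1` `]0, 1[.
  by apply/seteqP; split=> q [h1]; rewrite /= in_itv/= => h2; split => //; rewrite in_itv.
apply: openI; first exact: fluid_open.
by move/continuousP : c; apply; exact: interval_open.
Qed.

Lemma cell_omega x z t : cell (x, z, t) -> 0 < t < T /\ Omega eta t (x, z).
Proof. by move=> [[/= tT ze] x01]; split => //; split => //=; rewrite /omega/= in_itv. Qed.

Lemma div0 q : cell q -> vd 0 0 q + vd 1 1 q = 0.
Proof.
case: q => -[x z] t Cq; have [tT Oq] := cell_omega Cq.
have := sol_incompressible sol tT Oq.
by rewrite /divergence sum2E !vdE//; case: Cq.
Qed.

Lemma ddiv0 k q : cell q -> vd2 0 0 k q + vd2 1 1 k q = 0.
Proof.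
move=> Cq; have Fq := proj1 Cq.
apply: isd_uniq (isdD (isd_vd 0 0 k Fq) (isd_vd 1 1 k Fq)) _.
exact: (isd_near cell_open Cq div0 (isd_cst _ _ _)).
Qed.

Lemma stressE i j q : Flu q ->
  stress v p q i j = vd i j q + vd j i q - pr q *+ (i == j).
Proof.
move=> Fq; rewrite /stress /symgrad !mxE mulrA divff ?pnatr_eq0// mul1r.
by rewrite !vdE// prE.
Qed.

(** Differentiating the incompressibility condition cancels half of the divergence
    of twice the symmetric gradient and leaves the Laplacian, so that testing with
    the velocity produces the full gradient. *)
Lemma momentum i q : cell q ->
  eps ^+ 2 * vt i q + (w 0 q * vd i 0 q + w 1 q * vd i 1 q)
   - (vd2 i 0 0 q + vd2 i 1 1 q) + prd i q = f q 0 i.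
Proof.
case: q => -[x z] t Cq; have [tT Oq] := cell_omega Cq; have Fq := proj1 Cq.
rewrite -(sol_momentum sol tT Oq) !mxE !sum2E.
have dstress j : dsp j (fun q' => stress v p q' i j) (x, z, t) =
    vd2 i j j (x, z, t) + vd2 j i j (x, z, t) - prd j (x, z, t) *+ (i == j).
  apply: isd_dsp; apply: (isd_near (fluid_open Hs) Fq (fun q => stressE i j (q := q))).
  apply: isdB; first by apply: isdD; exact: isd_vd.
  by case: (i == j); [exact: isd_pr|exact: isd_cst].
rewrite !dstress -!vdE// -[dtm _ _](extE (v_dtm_cont Hf i) Fq) -/(vt i _).
have d0 := ddiv0 0 Cq; have d1 := ddiv0 1 Cq.
have s0 := vd2_sym 0 Fq; have s1 := vd2_sym 1 Fq.
rewrite -/(w 0 (x, z, t)) -/(w 1 (x, z, t)).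
case: (ord2P i) => ->.
  rewrite s1; exact: (@viscous_alg1 _ _ _ _ _ (prd 0 (x, z, t)) (prd 1 (x, z, t)) d0).
rewrite -s0; exact: (@viscous_alg2 _ _ _ _ _ (prd 1 (x, z, t)) (prd 0 (x, z, t)) d1).
Qed.

End Solution.

Arguments v_within {R rho delta beta r eta0 eps T f v p eta} sol i [x t] _.
Arguments vd_within {R rho delta beta r eta0 eps T f v p eta} sol i j [x t] _.
Arguments vd2_within {R rho delta beta r eta0 eps T f v p eta} sol i j k [x t] _.
Arguments vt_within {R rho delta beta r eta0 eps T f v p eta} sol i [x t] _.
Arguments prd_within {R rho delta beta r eta0 eps T f v p eta} sol j [x t] _.

(** * Column integrals, incompressibility and the fluid energy balance *)

Section OneVariable.
Variable R : realType.

Lemma eq_at1 (h k : R -> R) : continuous h -> continuous k ->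
  (forall y, 0 < y < 1 -> h y = k y) -> h 1 = k 1.
Proof.
move=> ch ck hk.
have H1 : h y @[y --> 1^'-] --> h 1 by apply: cvg_at_left_filter; exact: ch.
have H2 : h y @[y --> 1^'-] --> k 1.
  have : k y @[y --> 1^'-] --> k 1 by apply: cvg_at_left_filter; exact: ck.
  apply: cvg_trans; apply: near_eq_cvg; near=> y; apply/esym/hk; apply/andP; split.
    by near: y; exact: nbhs_left_gt.
  by near: y; exact: nbhs_left_lt.
exact: (cvg_unique _ H1 H2).
Unshelve. all: end_near. Qed.

Lemma itg_le0_le0 (k : R -> R) (x : R) : continuous k -> 0 < x < 1 ->
  (forall x0 x1, 0 < x0 -> x0 < x1 -> x1 < 1 -> itg x0 x1 k <= 0) -> k x <= 0.
Proof.
move=> ck /andP[x0 x1] H; rewrite leNgt; apply/negP => kx.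
have k2 : k x / 2 < k x by rewrite ltr_pdivrMr// mulr_natr mulr2n ltrDl.
have N1 : nbhs x [set y | k x / 2 < k y] by exact: (cvgr_gt _ (ck x)).
have [d1 /= d10 P1] := (nbhs_ballP _ _).1 N1.
pose d := Num.min d1 (Num.min x (1 - x)).
have d0 : 0 < d by rewrite !lt_min d10 x0 subr_gt0.
have dP : forall y, ball x d y -> k x / 2 < k y /\ 0 < y < 1.
  move=> y; rewrite /ball/= !lt_min => /and3P[y1 y2 y3]; split; first exact: P1.
  move: y2 y3; rewrite !ltr_norml => /andP[_ y2] /andP[y3 _].
  by apply/andP; split; lra.
have inb s : `|s| <= d / 2 -> ball x d (x + s).
  move=> sd; rewrite /ball/= opprD addrA subrr add0r normrN (le_lt_trans sd)//.
  by rewrite ltr_pdivrMr// mulr_natr mulr2n ltrDl.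
have d2 : 0 < d / 2 by rewrite divr_gt0.
have nd2 : `|- (d / 2)| <= d / 2 by rewrite normrN ger0_norm// ltW.
have pd2 : `|d / 2| <= d / 2 by rewrite ger0_norm// ltW.
have [_ /andP[l0 _]] := dP _ (inb (- (d / 2)) nd2).
have [_ /andP[_ l1]] := dP _ (inb (d / 2) pd2).
have lt01 : x + - (d / 2) < x + d / 2 by rewrite ltrD2l gtrN.
have := H _ _ l0 lt01 l1; apply/negP; rewrite -ltNge.
apply: (@lt_le_trans _ _ (itg (x + - (d / 2)) (x + d / 2) (fun=> k x / 2))).
  by rewrite itg_cst ?ltW// mulr_gt0 ?subr_gt0// divr_gt0.
apply: le_itg => //; first exact: cont_cst.
move=> y /andP[y1 y2]; have yx : `|y - x| <= d / 2.
  by rewrite ler_norml; apply/andP; split; lra.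
by have [/ltW] := dP _ (inb _ yx); rewrite addrC subrK.
Qed.

(** A continuous function whose integral over every subinterval vanishes is zero.
    This allows an identity to be differentiated on the boundary, where the solution
    itself need not be differentiable. *)
Lemma itg_eq0_eq0 (k : R -> R) (x : R) : continuous k -> 0 < x < 1 ->
  (forall x0 x1, 0 < x0 -> x0 < x1 -> x1 < 1 -> itg x0 x1 k = 0) -> k x = 0.
Proof.
move=> ck x01 H; apply/eqP; rewrite eq_le; apply/andP; split.
  by apply: itg_le0_le0 => // x0 x1 h0 h1 h2; rewrite H.
rewrite -oppr_le0; apply: (@itg_le0_le0 (fun x => - k x)) => //.
  by move=> y; apply: cvgN; exact: ck.
move=> x0 x1 h0 h1 h2.
rewrite (_ : (fun x => - k x) = fun x => -1 * k x); last by apply/funext => y; rewrite mulN1r.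
by rewrite itgZ// H// mulr0.
Qed.

End OneVariable.

Section Column.
Variables (R : realType) (T : R) (eta : R * R -> R).
Hypothesis Hs : structure_regular T eta.
Implicit Types (g h : R * R * R -> R) (x t : R).

Lemma eta_gt0 x t : 0 < t < T -> 0 < eta (x, t).
Proof.
by move=> /andP[t0 tT]; apply: (eta_positive Hs); rewrite /lateral0/= (ltW t0).
Qed.

Lemma in_fluid x y t : 0 < y < 1 -> 0 < t < T -> fluid eta T (x, y * eta (x, t), t).
Proof.
move=> /andP[y0 y1] tT; have e0 := eta_gt0 x tT.
by split => //=; rewrite mulr_gt0// gtr_pMl.
Qed.

Lemma column_slice s g x t : flu_cont T eta s g -> timewin T s t t ->
  column eta g (x, t) = itg 0 1 (fun y => eta (x, t) * g (x, clamp 0 1 y * eta (x, t), t)) /\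
  continuous (fun y => eta (x, t) * g (x, clamp 0 1 y * eta (x, t), t)).
Proof.
move=> cg tt; have := @flu_cont_slice _ _ _ s g t t x t cg tt; rewrite /Psi/= (clamp_id (t := t)) ?lexx// => c.
by split => //; apply: itg_ext => y y01; rewrite clamp_id.
Qed.

Lemma column_le s g h x t : flu_cont T eta s g -> flu_cont T eta s h -> timewin T s t t ->
  (forall y, 0 < y < 1 -> g (x, y * eta (x, t), t) <= h (x, y * eta (x, t), t)) ->
  column eta g (x, t) <= column eta h (x, t).
Proof.
move=> cg ch tt gh; have [-> c1] := column_slice x cg tt; have [-> c2] := column_slice x ch tt.
have e0 : 0 <= eta (x, t).
  case/and3P: tt => t0 _ tT; apply/ltW/(eta_positive Hs); rewrite /lateral0/= tT andbT.
  by case: s t0 {cg ch} => // /ltW.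
apply: le_itg => // y /[dup] y01 /andP[y0 y1].
have y01' : 0 <= y <= 1 by rewrite !ltW.
by rewrite (clamp_id y01'); apply: ler_wpM2l => //; exact: gh.
Qed.

Lemma column_eq s g h x t : flu_cont T eta s g -> flu_cont T eta s h -> timewin T s t t ->
  (forall y, 0 < y < 1 -> g (x, y * eta (x, t), t) = h (x, y * eta (x, t), t)) ->
  column eta g (x, t) = column eta h (x, t).
Proof.
move=> cg ch tt gh; apply/eqP; rewrite eq_le.
by apply/andP; split; apply: (column_le (s := s)) => // y y01; rewrite gh.
Qed.

Lemma column_cst k q : column eta (fun=> k) q = eta q * k.
Proof. by rewrite /column itg_cst ?ler01// subr0 mulr1. Qed.

Lemma columnD s g h x t : flu_cont T eta s g -> flu_cont T eta s h -> timewin T s t t ->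
  column eta (fun q => g q + h q) (x, t) = column eta g (x, t) + column eta h (x, t).
Proof.
move=> cg ch tt; have [-> c1] := column_slice x cg tt; have [-> c2] := column_slice x ch tt.
have [-> _] := column_slice x (flu_cont_D cg ch) tt.
by rewrite -(itgD _ _ c1 c2); apply: itg_ext => y _; rewrite mulrDr.
Qed.

Lemma columnZ s k g x t : flu_cont T eta s g -> timewin T s t t ->
  column eta (fun q => k * g q) (x, t) = k * column eta g (x, t).
Proof.
move=> cg tt; have [-> c1] := column_slice x cg tt.
have [-> _] := column_slice x (flu_cont_M (@flu_cont_cst R T eta s k) cg) tt.
by rewrite -(itgZ _ _ _ c1); apply: itg_ext => y _; rewrite mulrCA.
Qed.

End Column.

(** The velocity is $(a, b)$: the derivatives of the kinetic energy and of the two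
    components of its flux add up to the momentum equation tested with the velocity,
    up to the dissipation. *)
Fact energy_alg (R : realFieldType) (e2 a b ax az bx bz axx azz bxx bzz at_ bt P Px Pz : R) :
  ax + bz = 0 ->
  e2 * (a * at_ + b * bt)
  + (ax * (2^-1 * (a * a + b * b)) + a * (a * ax + b * bx)
     - (ax * ax + a * axx + (bx * bx + b * bxx)) + (Px * a + P * ax))
  + (bz * (2^-1 * (a * a + b * b)) + b * (a * az + b * bz)
     - (az * az + a * azz + (bz * bz + b * bzz)) + (Pz * b + P * bz)) =
  a * (e2 * at_ + (a * ax + b * az) - (axx + azz) + Px)
  + b * (e2 * bt + (a * bx + b * bz) - (bxx + bzz) + Pz)
  - (ax * ax + az * az + bx * bx + bz * bz).
Proof. by move=> /eqP; rewrite addr_eq0 => /eqP ->; field. Qed.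

(** On the graph the velocity is $(0, \varepsilon^2\partial_t\eta)$; the kinetic
    flux is then cancelled by the motion of the graph. *)
Fact flux_alg (R : realFieldType) (P az ax bz bx ex et e2 : R) :
  e2 * et * (2^-1 * (0 * 0 + e2 * et * (e2 * et))) - (0 * az + e2 * et * bz) + P * (e2 * et)
  - ex * (0 * (2^-1 * (0 * 0 + e2 * et * (e2 * et))) - (0 * ax + e2 * et * bx) + P * 0)
  - et * (e2 * (2^-1 * (0 * 0 + e2 * et * (e2 * et)))) = e2 * et * (P - bz + ex * bx).
Proof. by field. Qed.

Section Slab.
Variables (R : realType) (T : R).
Implicit Types (h k : R * R -> R) (a b t : R).

Lemma timewin1 s a b t : timewin T s a b -> a <= t <= b -> timewin T s t t.
Proof.
case/and3P=> a0 ab bT /andP[at_ tb]; apply/and3P; split=> //; last exact: le_lt_trans bT.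
by case: s a0 => a0; [exact: lt_le_trans at_|exact: le_trans at_].
Qed.

Lemma timewin_lt t : 0 < t < T -> timewin T true t t.
Proof. by case/andP=> t0 tT; apply/and3P. Qed.

Lemma lat_cont_slice s h t : lat_cont T s h -> timewin T s t t -> continuous (fun x => h (x, t)).
Proof.
move=> ch tt; have := (continuous_slice (ch t t tt)).2 t.
by rewrite /= (clamp_id (t := t))// lexx.
Qed.

Definition slab a b h : R := itg a b (fun t => itg 0 1 (fun x => h (x, t))).

Lemma lat_cont_mean s h a b : lat_cont T s h -> timewin T s a b ->
  continuous (fun t => itg 0 1 (fun x => h (x, clamp a b t))).
Proof.
move=> ch ab.
have H : continuous (fun p : R * R => h (p.2, clamp a b p.1)).
  refine (cont_comp (f := fun p : R * R => (p.2, p.1)) _ (ch a b ab)).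
  by apply: cont_tuple2; [exact: cont_snd|exact: cont_fst].
exact: (@cvg_param _ _ 0 1 (fun p : R * R => h (p.2, clamp a b p.1)) H).
Qed.

Lemma slab_clamp a b h : slab a b h = itg a b (fun t => itg 0 1 (fun x => h (x, clamp a b t))).
Proof. by apply: itg_ext => t tab; rewrite clamp_id. Qed.

Lemma slab_le s h k a b : lat_cont T s h -> lat_cont T s k -> timewin T s a b ->
  (forall x t, 0 < x < 1 -> a < t < b -> h (x, t) <= k (x, t)) ->
  slab a b h <= slab a b k.
Proof.
move=> ch ck ab hk; rewrite !slab_clamp; apply: le_itg; [exact: lat_cont_mean ab|exact: lat_cont_mean ab|].
move=> t tab; have tab' : a <= t <= b by case/andP: tab => /ltW -> /ltW ->.
have tt := timewin1 ab tab'.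
rewrite (clamp_id tab'); apply: le_itg; [exact: lat_cont_slice tt|exact: lat_cont_slice tt|].
by move=> x x01; exact: hk.
Qed.

Lemma slab_eq s h k a b : lat_cont T s h -> lat_cont T s k -> timewin T s a b ->
  (forall x t, 0 < x < 1 -> a < t < b -> h (x, t) = k (x, t)) ->
  slab a b h = slab a b k.
Proof.
move=> ch ck ab hk; apply/eqP; rewrite eq_le.
by apply/andP; split; apply: (slab_le (s := s)) => // x t x01 tab; rewrite hk.
Qed.

Lemma slabD s h k a b : lat_cont T s h -> lat_cont T s k -> timewin T s a b ->
  slab a b (fun q => h q + k q) = slab a b h + slab a b k.
Proof.
move=> ch ck ab; rewrite !slab_clamp -(itgD _ _ (lat_cont_mean ch ab) (lat_cont_mean ck ab)).
apply: itg_ext => t tab; have tt := timewin1 ab tab.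
by rewrite (clamp_id tab) -(itgD _ _ (lat_cont_slice ch tt) (lat_cont_slice ck tt)).
Qed.

Lemma slabZ s c h a b : lat_cont T s h -> timewin T s a b ->
  slab a b (fun q => c * h q) = c * slab a b h.
Proof.
move=> ch ab; rewrite !slab_clamp -(itgZ _ _ _ (lat_cont_mean ch ab)).
apply: itg_ext => t tab; have tt := timewin1 ab tab.
by rewrite (clamp_id tab) -(itgZ _ _ _ (lat_cont_slice ch tt)).
Qed.

Lemma slab0 a b : slab a b (fun=> 0) = 0.
Proof.
transitivity (itg a b (fun=> 0 : R)); last exact: itg0.
by apply: itg_ext => t _; exact: itg0.
Qed.

End Slab.

Section EnergyBalance.
Variables (R : realType) (T : R) (eta : R * R -> R) (e2 : R).
Hypothesis Hs : structure_regular T eta.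
Let Flu := fluid eta T.
Let W (g : R * R * R -> R) := {within fluid_cl eta T, continuous g}.

Variables a b ax az bx bz axx axz azz bxx bxz bzz at_ bt P Px Pz : R * R * R -> R.
Hypotheses (Wa : W a) (Wb : W b) (Wax : W ax) (Waz : W az) (Wbx : W bx) (Wbz : W bz)
  (Waxx : W axx) (Waxz : W axz) (Wazz : W azz) (Wbxx : W bxx) (Wbxz : W bxz)
  (Wbzz : W bzz) (Wat : W at_) (Wbt : W bt) (WP : W P) (WPx : W Px) (WPz : W Pz).
Hypotheses (dax : forall q, Flu q -> isd 0 a q (ax q)) (daz : forall q, Flu q -> isd 1 a q (az q))
  (dbx : forall q, Flu q -> isd 0 b q (bx q)) (dbz : forall q, Flu q -> isd 1 b q (bz q))
  (daxx : forall q, Flu q -> isd 0 ax q (axx q)) (daxz : forall q, Flu q -> isd 1 ax q (axz q))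
  (dazz : forall q, Flu q -> isd 1 az q (azz q))
  (dbxx : forall q, Flu q -> isd 0 bx q (bxx q)) (dbxz : forall q, Flu q -> isd 1 bx q (bxz q))
  (dbzz : forall q, Flu q -> isd 1 bz q (bzz q))
  (dPx : forall q, Flu q -> isd 0 P q (Px q)) (dPz : forall q, Flu q -> isd 1 P q (Pz q))
  (dat : forall x z t : R, Flu (x, z, t) -> is_derive t 1 (fun t => a (x, z, t)) (at_ (x, z, t)))
  (dbt : forall x z t : R, Flu (x, z, t) -> is_derive t 1 (fun t => b (x, z, t)) (bt (x, z, t))).
Hypothesis div : forall q, Flu q -> 0 < q.1.1 < 1 -> ax q + bz q = 0.
Hypotheses (bota : forall x t, 0 < x < 1 -> 0 < t < T -> a (x, 0, t) = 0)
  (botb : forall x t, 0 < x < 1 -> 0 < t < T -> b (x, 0, t) = 0)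
  (topa : forall x t, 0 < x < 1 -> 0 < t < T -> a (x, eta (x, t), t) = 0)
  (topb : forall x t, 0 < x < 1 -> 0 < t < T -> b (x, eta (x, t), t) = e2 * pt eta (x, t)).
Hypothesis per : forall z t, 0 < t < T -> 0 < z < eta (0, t) ->
  [/\ a (1, z, t) = a (0, z, t), b (1, z, t) = b (0, z, t), ax (1, z, t) = ax (0, z, t),
      bx (1, z, t) = bx (0, z, t) & P (1, z, t) = P (0, z, t)].

Let WD (g h : R * R * R -> R) : W g -> W h -> W (fun q => g q + h q).
Proof. exact: contD. Qed.
Let WB (g h : R * R * R -> R) : W g -> W h -> W (fun q => g q - h q).
Proof. exact: contB. Qed.
Let WM (g h : R * R * R -> R) : W g -> W h -> W (fun q => g q * h q).
Proof. exact: contM. Qed.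
Let WC (k : R) : W (fun=> k).
Proof. exact: cont_cst. Qed.

(** The velocity is $(a, b)$ and [e2] the coefficient of its time derivative; [P]
    is the pressure. The remaining variables are the derivatives, with the variables
    of differentiation appended to the name. *)
Definition kin q := e2 * (2^-1 * (a q * a q + b q * b q)).
Definition source q :=
  a q * (e2 * at_ q + (a q * ax q + b q * az q) - (axx q + azz q) + Px q)
  + b q * (e2 * bt q + (a q * bx q + b q * bz q) - (bxx q + bzz q) + Pz q)
  - (ax q * ax q + az q * az q + bx q * bx q + bz q * bz q).

(** The transport theorem for a constant density: the flux of a solenoidal velocity
    through the graph is the speed of the graph. *)
Lemma mass_conserved s t : timewin T true s t -> e2 != 0 ->
  itg 0 1 (fun x => eta (x, t)) = itg 0 1 (fun x => eta (x, s)).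
Proof.
move=> st e20.
have H := @transport R T eta Hs s t (fun=> e2) (fun=> 0) (fun=> 0) a ax az b bz st
  (@WC e2) (@WC 0) (@WC 0) Wa Wax Waz Wb Wbz
  (fun x z t _ => dcst e2 t) (fun x z t _ => dcst e2 z)
  (fun x z t => @dax (x, z, t)) (fun x z t => @daz (x, z, t)) (fun x z t => @dbz (x, z, t))
  _ botb.
have stt u : s <= u <= t -> timewin T true u u by exact: timewin1.
have colE u : s <= u <= t -> itg 0 1 (fun x => column eta (fun=> e2) (x, u)) = itg 0 1 (fun x => eta (x, u)) * e2.
  move=> su; rewrite -itgZr; last exact: (lat_cont_slice (lat_contW (lat_cont_eta Hs)) (stt u su)).
  by apply: itg_ext => x _; rewrite /column itg_cst ?ler01// subr0 mulr1.
have /and3P[s0 st' tT] := st.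
have CW g : W g -> flu_cont T eta true g by exact: (flu_cont_within Hs (s := true)).
have i1 : slab s t (fun q => top eta b q - px eta q * top eta a q - pt eta q * top eta (fun=> e2) q) = 0.
  rewrite (slab_eq (s := true) (T := T) (k := fun=> 0))//.
  - exact: slab0.
  - apply: lat_cont_B; first apply: lat_cont_B.
    + exact: (lat_cont_top (CW _ Wb)).
    + exact: (lat_cont_M (lat_cont_px Hs (isT : (1 <= 4)%N)) (lat_cont_top (CW _ Wa))).
    + apply: lat_cont_M; first exact: (lat_cont_pt Hs).
      exact: lat_cont_cst.
  - exact: lat_cont_cst.
  - move=> x u x01 /andP[su ut]; have uT : 0 < u < T.
      by rewrite (lt_trans s0)//= (lt_trans ut).
    by rewrite /top/= topa// topb// mulr0 subr0 mulrC subrr.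
have i2 : slab s t (fun q => column eta (fun q => 0 + ax q + bz q) q) = 0.
  rewrite (slab_eq (s := true) (T := T) (k := fun=> 0))//.
  - exact: slab0.
  - exact: (lat_cont_column Hs (CW _ (WD (WD (@WC 0) Wax) Wbz))).
  - exact: lat_cont_cst.
  - move=> x u x01 /andP[su ut]; have uT : 0 < u < T.
      by rewrite (lt_trans s0)//= (lt_trans ut).
    rewrite (column_eq Hs (s := true) (CW _ (WD (WD (@WC 0) Wax) Wbz)) (@flu_cont_cst R T eta true 0) (timewin_lt uT)).
      by rewrite column_cst mulr0.
    by move=> y y01; rewrite add0r div//; exact: in_fluid.
have ss : s <= s <= t by rewrite lexx.
have tt : s <= t <= t by rewrite lexx st'.
have pa z u : 0 < u < T -> 0 < z < eta (0, u) -> a (1, z, u) = a (0, z, u).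
  by move=> uT zu; have [] := per uT zu.
have {H} : itg 0 1 (fun x => column eta (fun=> e2) (x, t)) - itg 0 1 (fun x => column eta (fun=> e2) (x, s))
  + slab s t (fun q => top eta b q - px eta q * top eta a q - pt eta q * top eta (fun=> e2) q)
  = slab s t (fun q => column eta (fun q => 0 + ax q + bz q) q) := H pa.
rewrite i1 i2 addr0 !colE// => /eqP; rewrite subr_eq0 => /eqP; exact: mulIf.
Qed.

Lemma top_div x t : 0 < x < 1 -> 0 < t < T -> top eta ax (x, t) + top eta bz (x, t) = 0.
Proof.
move=> x01 tT; have tt := timewin_lt tT.
have W1 : flu_cont T eta true (fun q => ax q + bz q) by exact: (flu_cont_within Hs (s := true) (WD Wax Wbz)).
have c : continuous (fun y : R => ax (Psi eta t t (x, y, t)) + bz (Psi eta t t (x, y, t))).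
  refine (cont_comp (f := fun y : R => (x, y, t)) _ (W1 t t tt)).
  by apply: cont_tuple3; [exact: cont_cst|exact: cont_id|exact: cont_cst].
have PE y : 0 <= y <= 1 -> Psi eta t t (x, y, t) = (x, y * eta (x, t), t).
  by move=> y01; rewrite /Psi/= (clamp_id y01) (clamp_id (t := t))// lexx.
have := @eq_at1 R _ (fun=> 0) c (@cont_cst _ _ 0) _.
rewrite PE ?ler01 ?lexx// mul1r; apply => y y01.
rewrite PE; last by case/andP: y01 => /ltW -> /ltW ->.
by apply: div => //; exact: in_fluid.
Qed.

(** The horizontal velocity vanishes along the graph, hence so does its
    tangential derivative. As the velocity is not assumed differentiable on the
    graph itself, the identity is obtained in integrated form on the curves
    $z = y\,\eta(x,t)$ with $y < 1$, and then $y$ tends to 1. *)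
Lemma top_tangential x t : 0 < x < 1 -> 0 < t < T ->
  top eta ax (x, t) + px eta (x, t) * top eta az (x, t) = 0.
Proof.
move=> x01 tT; have tt := timewin_lt tT.
have CW g : W g -> continuous (fun p : R * R => g (Psi eta t t (p.1, p.2, t))).
  move=> Wg; refine (cont_comp (f := fun p : R * R => (p.1, p.2, t)) _ (flu_cont_within Hs (s := true) Wg tt)).
  by apply: cont_tuple3; [exact: cont_fst|exact: cont_snd|exact: cont_cst].
have PE x' y : 0 <= y <= 1 -> Psi eta t t (x', y, t) = (x', y * eta (x', t), t).
  by move=> y01; rewrite /Psi/= (clamp_id y01) (clamp_id (t := t))// lexx.
have P1 x' : Psi eta t t (x', 1, t) = (x', eta (x', t), t).
  by rewrite PE ?mul1r// ler01 lexx.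
have cex : continuous (fun x => px eta (x, t)) by exact: (lat_cont_slice (lat_cont_px Hs (isT : (1 <= 4)%N)) tt).
pose h (p : R * R) := ax (Psi eta t t (p.1, p.2, t)) + px eta (p.1, t) * az (Psi eta t t (p.1, p.2, t)) * p.2.
have ch : continuous h.
  apply: contD; first exact: CW.
  apply: contM; last exact: cont_snd.
  apply: contM; last exact: CW.
  exact: (cont_comp (f := fun p : R * R => p.1) (@cont_fst _ _) cex).
have [_ chx] := continuous_slice ch.
have [cay cax] := continuous_slice (CW _ Wa).
suff : h (x, 1) = 0 by rewrite /h /= P1 mulr1.
apply: (@itg_eq0_eq0 R (fun x => h (x, 1))) => // x0 x1 h0 h01 h1.
transitivity (a (Psi eta t t (x1, 1, t)) - a (Psi eta t t (x0, 1, t))); last first.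
  by rewrite !P1 !topa ?subrr// ?h0 ?h1 ?(lt_trans h0)// ?(lt_trans h01).
apply: (@eq_at1 R (fun y => itg x0 x1 (fun x => h (x, y)))
  (fun y => a (Psi eta t t (x1, y, t)) - a (Psi eta t t (x0, y, t)))).
- have H : continuous (fun p : R * R => h (p.2, p.1)).
    refine (cont_comp (f := fun p : R * R => (p.2, p.1)) _ ch).
    by apply: cont_tuple2; [exact: cont_snd|exact: cont_fst].
  exact: (@cvg_param _ _ x0 x1 (fun p : R * R => h (p.2, p.1)) H).
- by apply: contB; exact: cay.
move=> y y01; have y01' : 0 <= y <= 1 by case/andP: y01 => /ltW -> /ltW ->.
apply: (itg_FTC (F := fun x => a (Psi eta t t (x, y, t)))); [exact: ltW|exact: chx|exact: cax|].
move=> x' _; rewrite (_ : (fun x => _) = fun x => a (x, y * eta (x, t), t)); last first.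
  by apply/funext => s; rewrite PE.
apply: deq (is_derive_ale_x Hs x' y01 tT Wax (fun x z t => @dax (x, z, t)) (fun x z t => @daz (x, z, t))) _.
by rewrite /h/= PE//; ring.
Qed.

Definition kin1 (q : R * R * R) : R := 2^-1 * (a q * a q + b q * b q).

Lemma isd_kin1 k q (ak bk : R) : isd k a q ak -> isd k b q bk ->
  isd k kin1 q (a q * ak + b q * bk).
Proof.
move=> da db.
apply: isd_eq (isdM (isd_cst k 2^-1 q) (isdD (isdM da da) (isdM db db))) _.
by field.
Qed.

Lemma W_source : W source.
Proof.
apply: WB; last exact: (WD (WD (WD (WM Wax Wax) (WM Waz Waz)) (WM Wbx Wbx)) (WM Wbz Wbz)).
apply: WD.
  exact: (WM Wa (WD (WB (WD (WM (@WC e2) Wat) (WD (WM Wa Wax) (WM Wb Waz))) (WD Waxx Wazz)) WPx)).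
exact: (WM Wb (WD (WB (WD (WM (@WC e2) Wbt) (WD (WM Wa Wbx) (WM Wb Wbz))) (WD Wbxx Wbzz)) WPz)).
Qed.

(** The transport theorem for the kinetic energy. The work done on the graph
    involves the horizontal derivative of the vertical velocity and not the full
    normal stress; [top_stress_alg] below identifies the two. *)
Lemma energy_balance s t : timewin T true s t ->
  itg 0 1 (fun x => column eta kin (x, t)) - itg 0 1 (fun x => column eta kin (x, s))
  + slab s t (fun q => e2 * pt eta q * (top eta P q - top eta bz q + px eta q * top eta bx q))
  = slab s t (column eta source).
Proof.
move=> st; have /and3P[s0 st' tT] := st.
have in_T u : s < u < t -> 0 < u < T.
  by move=> /andP[su ut]; rewrite (lt_trans s0)//= (lt_trans ut).
have CW g : W g -> flu_cont T eta true g by exact: (flu_cont_within Hs (s := true)).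
pose At q := e2 * (a q * at_ q + b q * bt q).
pose Az q := e2 * (a q * az q + b q * bz q).
pose F1 q := a q * kin1 q - (a q * ax q + b q * bx q) + P q * a q.
pose F2 q := b q * kin1 q - (a q * az q + b q * bz q) + P q * b q.
pose F1x q := ax q * kin1 q + a q * (a q * ax q + b q * bx q)
  - (ax q * ax q + a q * axx q + (bx q * bx q + b q * bxx q)) + (Px q * a q + P q * ax q).
pose F1z q := az q * kin1 q + a q * (a q * az q + b q * bz q)
  - (az q * ax q + a q * axz q + (bz q * bx q + b q * bxz q)) + (Pz q * a q + P q * az q).
pose F2z q := bz q * kin1 q + b q * (a q * az q + b q * bz q)
  - (az q * az q + a q * azz q + (bz q * bz q + b q * bzz q)) + (Pz q * b q + P q * bz q).
have Wk1 : W kin1 := WM (@WC 2^-1) (WD (WM Wa Wa) (WM Wb Wb)).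
have Wk : W kin := WM (@WC e2) Wk1.
have WAt : W At := WM (@WC e2) (WD (WM Wa Wat) (WM Wb Wbt)).
have WAz : W Az := WM (@WC e2) (WD (WM Wa Waz) (WM Wb Wbz)).
have WF1 : W F1 := WD (WB (WM Wa Wk1) (WD (WM Wa Wax) (WM Wb Wbx))) (WM WP Wa).
have WF2 : W F2 := WD (WB (WM Wb Wk1) (WD (WM Wa Waz) (WM Wb Wbz))) (WM WP Wb).
have WF1x : W F1x := WD (WB (WD (WM Wax Wk1) (WM Wa (WD (WM Wa Wax) (WM Wb Wbx))))
  (WD (WD (WM Wax Wax) (WM Wa Waxx)) (WD (WM Wbx Wbx) (WM Wb Wbxx)))) (WD (WM WPx Wa) (WM WP Wax)).
have WF1z : W F1z := WD (WB (WD (WM Waz Wk1) (WM Wa (WD (WM Wa Waz) (WM Wb Wbz))))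
  (WD (WD (WM Waz Wax) (WM Wa Waxz)) (WD (WM Wbz Wbx) (WM Wb Wbxz)))) (WD (WM WPz Wa) (WM WP Waz)).
have WF2z : W F2z := WD (WB (WD (WM Wbz Wk1) (WM Wb (WD (WM Wa Waz) (WM Wb Wbz))))
  (WD (WD (WM Waz Waz) (WM Wa Wazz)) (WD (WM Wbz Wbz) (WM Wb Wbzz)))) (WD (WM WPz Wb) (WM WP Wbz)).
have dF1x q : Flu q -> isd 0 F1 q (F1x q).
  move=> Fq; have da := dax Fq; have db := dbx Fq.
  exact: (isdD (isdB (isdM da (isd_kin1 da db)) (isdD (isdM da (daxx Fq)) (isdM db (dbxx Fq))))
    (isdM (dPx Fq) da)).
have dF1z q : Flu q -> isd 1 F1 q (F1z q).
  move=> Fq; have da := daz Fq; have db := dbz Fq.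
  exact: (isdD (isdB (isdM da (isd_kin1 da db)) (isdD (isdM da (daxz Fq)) (isdM db (dbxz Fq))))
    (isdM (dPz Fq) da)).
have dF2z q : Flu q -> isd 1 F2 q (F2z q).
  move=> Fq; have da := daz Fq; have db := dbz Fq.
  exact: (isdD (isdB (isdM db (isd_kin1 da db)) (isdD (isdM da (dazz Fq)) (isdM db (dbzz Fq))))
    (isdM (dPz Fq) db)).
have dAz q : Flu q -> isd 1 kin q (Az q).
  move=> Fq; apply: isd_eq (isdM (isd_cst 1 e2 q) (isd_kin1 (daz Fq) (dbz Fq))) _.
  by rewrite mul0r add0r.
have dAt x z u : Flu (x, z, u) -> is_derive u 1 (fun u => kin (x, z, u)) (At (x, z, u)).
  move=> Fq; have da := dat Fq; have db := dbt Fq.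
  apply: deq (dZ e2 (dZ 2^-1 (dD (dM da da) (dM db db)))) _.
  by rewrite /At; field.
have perF z u : 0 < u < T -> 0 < z < eta (0, u) -> F1 (1, z, u) = F1 (0, z, u).
  by move=> uT zu; have [pa pb pax pbx pP] := per uT zu; rewrite /F1 /kin1 pa pb pax pbx pP.
have botF x u : 0 < x < 1 -> 0 < u < T -> F2 (x, 0, u) = 0.
  by move=> x01 uT; rewrite /F2 bota// botb// !mul0r mulr0 !addr0 subr0.
have H := @transport R T eta Hs s t kin At Az F1 F1x F1z F2 F2z st Wk WAt WAz WF1 WF1x WF1z WF2 WF2z
  dAt (fun x z u => @dAz (x, z, u)) (fun x z u => @dF1x (x, z, u))
  (fun x z u => @dF1z (x, z, u)) (fun x z u => @dF2z (x, z, u)) perF botF.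
have {H} H : itg 0 1 (fun x => column eta kin (x, t)) - itg 0 1 (fun x => column eta kin (x, s))
  + slab s t (fun q => top eta F2 q - px eta q * top eta F1 q - pt eta q * top eta kin q)
  = slab s t (column eta (fun q => At q + F1x q + F2z q)) := H.
have Cex := lat_cont_px Hs (isT : (1 <= 4)%N).
have Cet := lat_cont_pt Hs.
rewrite (slab_eq (s := true) (T := T) (k :=
  (fun q => e2 * pt eta q * (top eta P q - top eta bz q + px eta q * top eta bx q)))) in H => //.
- rewrite H; apply: (slab_eq (s := true) (T := T)) => //.
  + exact: (lat_cont_column Hs (CW _ (WD (WD WAt WF1x) WF2z))).
  + exact: (lat_cont_column Hs (CW _ W_source)).
  move=> x u x01 su; have uT := in_T _ su.
  apply: (column_eq Hs (s := true) (CW _ (WD (WD WAt WF1x) WF2z)) (CW _ W_source) (timewin_lt uT)).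
  by move=> y y01; apply: energy_alg; apply: div => //; exact: in_fluid.
- exact: (lat_cont_B (lat_cont_B (lat_cont_top (CW _ WF2)) (lat_cont_M Cex (lat_cont_top (CW _ WF1))))
    (lat_cont_M Cet (lat_cont_top (CW _ Wk)))).
- exact: (lat_cont_M (lat_cont_M (@lat_cont_cst _ T true e2) Cet) (lat_cont_D (lat_cont_B (lat_cont_top (CW _ WP)) (lat_cont_top (CW _ Wbz)))
    (lat_cont_M Cex (lat_cont_top (CW _ Wbx))))).
move=> x u x01 su; have uT := in_T _ su.
rewrite /top/= /F1 /F2 /kin /kin1 topa// topb//.
exact: flux_alg.
Qed.

End EnergyBalance.

(** * Energy balance of the structure *)

Fact structure_alg (R : realFieldType) (k1 k2 k3 et ett etx etxx exx exxx exxxx exxt : R) :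
  exxt = etxx ->
  k1 * (ett * et) + k3 * (exxt * exx)
  + (- k2 * (etx * etx + et * etxx)
     + k3 * ((etx * exxx + et * exxxx) - (etxx * exx + etx * exxx)))
  + k2 * (etx * etx)
  = et * (k1 * ett - k2 * etxx + k3 * exxxx).
Proof. by move=> ->; ring. Qed.

Fact half_square_alg (R : realFieldType) (k1 k3 a a' b b' : R) :
  k1 * (2^-1 * (a' * a + a * a')) + k3 * (2^-1 * (b' * b + b * b')) = k1 * (a' * a) + k3 * (b' * b).
Proof. by field. Qed.

Section Structure.
Variables (R : realType) (T : R) (eta : R * R -> R).
Hypothesis Hs : structure_regular T eta.

Local Notation et := (pt eta).
Local Notation etx := (px (pt eta)).
Local Notation etxx := (px (px (pt eta))).
Local Notation exx := (px (px eta)).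
Local Notation exxx := (px (px (px eta))).
Local Notation exxxx := (px (px (px (px eta)))).

Lemma lateral_open : open (lateral T).
Proof.
have c : continuous (fun q : R * R => q.2) by exact: cont_snd.
have -> : lateral T = (fun q : R * R => q.2) @^-1` `]0, T[.
  by apply/seteqP; split=> q; rewrite /lateral/= in_itv.
by move/continuousP : c; apply; exact: interval_open.
Qed.

Lemma lateral_cont (g : R * R -> R) q : {within lateral T, continuous g} ->
  lateral T q -> {for q, continuous g}.
Proof. by move=> cg; apply: (within_open cg lateral_open). Qed.

Lemma lateral_cont_flip (g : R * R -> R) (x t : R) : {within lateral T, continuous g} ->
  0 < t < T -> {for (t, x), continuous (fun p : R * R => g (p.2, p.1))}.
Proof.
move=> cg tT; have c : continuous (fun p : R * R => (p.2, p.1)).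
  by apply: cont_tuple2; [exact: cont_snd|exact: cont_fst].
have cA := lateral_cont cg (tT : lateral T (x, t)).
exact: (@continuous_comp _ _ _ _ g _ (c (t, x)) cA).
Qed.

Lemma near_lateral (x t : R) : 0 < t < T -> \forall p \near (t, x), 0 < p.1 < T.
Proof.
move=> tT; have tT' : t \in `]0, T[%R by rewrite in_itv.
have c : continuous (fun p : R * R => p.1) by exact: cont_fst.
have N := near_in_itvoo tT'.
have N' : \forall p \near (t, x), p.1 \in `]0, T[%R := c (t, x) _ N.
by apply: filterS N' => p; rewrite in_itv.
Qed.

Lemma d_px k (x t : R) : (k < 4)%N -> 0 < t < T ->
  is_derive x 1 (fun x => iter k (@px R) eta (x, t)) (iter k.+1 (@px R) eta (x, t)).
Proof. by move=> k4 tT; apply: is_derive1P; exact: (@eta_px _ _ _ Hs k (x, t)). Qed.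

Lemma d_pxt k (x t : R) : (k < 2)%N -> 0 < t < T ->
  is_derive x 1 (fun x => iter k (@px R) et (x, t)) (iter k.+1 (@px R) et (x, t)).
Proof. by move=> k4 tT; apply: is_derive1P; exact: (@eta_pxt _ _ _ Hs k (x, t)). Qed.

Lemma d_ptt (x t : R) : 0 < t < T -> is_derive t 1 (fun t => et (x, t)) (pt et (x, t)).
Proof. by move=> tT; apply: is_derive1P; exact: (@eta_ptt _ _ _ Hs (x, t)). Qed.

Lemma dt_px (x t : R) : 0 < t < T -> is_derive t 1 (fun t => px eta (x, t)) (etx (x, t)).
Proof.
move=> tT; apply: (@schwarz R (fun t x => eta (x, t)) (fun t x => et (x, t))
  (fun t x => px eta (x, t)) (fun t x => etx (x, t))).
- by apply: filterS (near_lateral x tT) => p pT; exact: (is_derive_eta_t Hs).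
- by apply: filterS (near_lateral x tT) => p pT; exact: (is_derive_eta_x Hs).
- by apply: filterS (near_lateral x tT) => p pT; exact: (d_pxt (k := 0)).
- apply: (@lateral_cont_flip etx) tT; exact: (eta_pxt_cont Hs (isT : (1 <= 2)%N)).
Qed.

Lemma dt_pxx (x t : R) : 0 < t < T -> is_derive t 1 (fun t => exx (x, t)) (etxx (x, t)).
Proof.
move=> tT; apply: (@schwarz R (fun t x => px eta (x, t)) (fun t x => etx (x, t))
  (fun t x => exx (x, t)) (fun t x => etxx (x, t))).
- by apply: filterS (near_lateral x tT) => p pT; exact: dt_px.
- by apply: filterS (near_lateral x tT) => p pT; exact: (d_px (k := 1)).
- by apply: filterS (near_lateral x tT) => p pT; exact: (d_pxt (k := 1)).
- apply: (@lateral_cont_flip etxx) tT; exact: (eta_pxt_cont Hs (isT : (2 <= 2)%N)).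
Qed.

Lemma derive_period (g dg : R -> R) : (forall x, g (x + 1) = g x) ->
  (forall x : R, is_derive x 1 g (dg x)) -> forall x, dg (x + 1) = dg x.
Proof.
move=> pg dgE x; have s : is_derive x 1 (fun x : R => x + 1) (1 : R).
  by apply: deq (dD (did x) (dcst 1 x)) _; rewrite addr0.
have := @is_derive1_comp R g (fun x => x + 1) x _ _ (dgE (x + 1)) s.
rewrite (_ : g \o _ = g); last by apply/funext => y /=.
by rewrite mulr1 => -[_ <-]; case: (dgE x) => _ ->.
Qed.

Lemma px_periodic k t : (k <= 4)%N -> 0 < t < T -> forall x,
  iter k (@px R) eta (x + 1, t) = iter k (@px R) eta (x, t).
Proof.
move=> k4 tT; elim: k k4 => [_ x|k IH k4 x].
  by apply: (eta_periodic Hs); case/andP: tT => t0 ?; rewrite /lateral0/= (ltW t0).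
apply: (@derive_period (fun x => iter k (@px R) eta (x, t)) (fun x => iter k.+1 (@px R) eta (x, t))).
  by apply: IH; exact: ltnW.
by move=> y; exact: d_px.
Qed.

Lemma pt_periodic x t : 0 < t < T -> et (x + 1, t) = et (x, t).
Proof.
move=> tT; have tT' : t \in `]0, T[%R by rewrite in_itv.
have d : is_derive t 1 (fun t => eta (x + 1, t)) (et (x, t)).
  apply: (dnear _ (is_derive_eta_t Hs x tT)); apply: filterS (near_in_itvoo tT') => s.
  by rewrite in_itv/= => /andP[s0 sT]; apply: (eta_periodic Hs); rewrite /lateral0/= (ltW s0).
by case: (is_derive_eta_t Hs (x + 1) tT) => _ <-; case: d.
Qed.

Lemma pxt_periodic k t : (k <= 2)%N -> 0 < t < T -> forall x,
  iter k (@px R) et (x + 1, t) = iter k (@px R) et (x, t).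
Proof.
move=> k4 tT; elim: k k4 => [_ x|k IH k4 x]; first exact: pt_periodic.
apply: (@derive_period (fun x => iter k (@px R) et (x, t)) (fun x => iter k.+1 (@px R) et (x, t))).
  by apply: IH; exact: ltnW.
by move=> y; exact: d_pxt.
Qed.

Lemma lat_cont_pxt k : (k <= 2)%N -> lat_cont T true (iter k (@px R) et).
Proof. by move=> k4; apply: lat_cont_within; exact: (eta_pxt_cont Hs). Qed.

Lemma lat_cont_ptt : lat_cont T true (pt et).
Proof. by apply: lat_cont_within; exact: (eta_ptt_cont Hs). Qed.

(** Testing the plate equation with $\partial_t\eta$: all terms except the
    viscoelastic one are the time derivative of the density plus the $x$-derivative
    of a periodic flux. *)
Lemma structure_balance (k1 k2 k3 s t : R) : timewin T true s t ->
  slab s t (fun q => et q * (k1 * pt et q - k2 * etxx q + k3 * exxxx q)) =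
  itg 0 1 (fun x => k1 * (2^-1 * (et (x, t) * et (x, t))) + k3 * (2^-1 * (exx (x, t) * exx (x, t)))) -
  itg 0 1 (fun x => k1 * (2^-1 * (et (x, s) * et (x, s))) + k3 * (2^-1 * (exx (x, s) * exx (x, s)))) +
  k2 * slab s t (fun q => etx q * etx q).
Proof.
move=> st; have /and3P[s0 st' tT] := st.
have in_T u : s < u < t -> 0 < u < T.
  by move=> /andP[su ut]; rewrite (lt_trans s0)//= (lt_trans ut).
have cl_in u : 0 < clamp s t u < T.
  by have /andP[h1 h2] := clamp_itv u st'; rewrite (lt_le_trans s0)//= (le_lt_trans h2).
have Cet : lat_cont T true et := lat_cont_pxt (isT : (0 <= 2)%N).
have Cetx : lat_cont T true etx := lat_cont_pxt (isT : (1 <= 2)%N).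
have Cetxx : lat_cont T true etxx := lat_cont_pxt (isT : (2 <= 2)%N).
have Cexx : lat_cont T true exx := lat_cont_px Hs (isT : (2 <= 4)%N).
have Cexxx : lat_cont T true exxx := lat_cont_px Hs (isT : (3 <= 4)%N).
have Cexxxx : lat_cont T true exxxx := lat_cont_px Hs (isT : (4 <= 4)%N).
have CC k : lat_cont T true (fun=> k) := @lat_cont_cst _ T true k.
pose U q := k1 * (2^-1 * (et q * et q)) + k3 * (2^-1 * (exx q * exx q)).
pose u q := k1 * (pt et q * et q) + k3 * (etxx q * exx q).
pose B q := - k2 * (et q * etx q) + k3 * (et q * exxx q - etx q * exx q).
pose w q := - k2 * (etx q * etx q + et q * etxx q)
  + k3 * ((etx q * exxx q + et q * exxxx q) - (etxx q * exx q + etx q * exxx q)).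
have CU : lat_cont T true U := lat_cont_D (lat_cont_M (CC k1) (lat_cont_M (CC 2^-1) (lat_cont_M Cet Cet)))
  (lat_cont_M (CC k3) (lat_cont_M (CC 2^-1) (lat_cont_M Cexx Cexx))).
have Cu : lat_cont T true u := lat_cont_D (lat_cont_M (CC k1) (lat_cont_M lat_cont_ptt Cet)) (lat_cont_M (CC k3) (lat_cont_M Cetxx Cexx)).
have CB : lat_cont T true B := lat_cont_D (lat_cont_M (CC (- k2)) (lat_cont_M Cet Cetx))
  (lat_cont_M (CC k3) (lat_cont_B (lat_cont_M Cet Cexxx) (lat_cont_M Cetx Cexx))).
have Cw : lat_cont T true w := lat_cont_D (lat_cont_M (CC (- k2)) (lat_cont_D (lat_cont_M Cetx Cetx) (lat_cont_M Cet Cetxx)))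
  (lat_cont_M (CC k3) (lat_cont_B (lat_cont_D (lat_cont_M Cetx Cexxx) (lat_cont_M Cet Cexxxx))
    (lat_cont_D (lat_cont_M Cetxx Cexx) (lat_cont_M Cetx Cexxx)))).
pose N (g : R * R -> R) (q : R * R) := g (q.1, clamp s t q.2).
have dU (x y : R) : 0 < x < 1 -> s < y < t -> is_derive y 1 (fun y => N U (x, y)) (N u (x, y)).
  move=> _ sy; have yT := in_T y sy.
  have yE : clamp s t y = y by apply: clamp_id; case/andP: sy => /ltW -> /ltW ->.
  apply: (@dnear _ _ (fun y => U (x, y))).
    by apply: filterS (near_clamp sy) => y' h; rewrite /N/= h.
  rewrite /N/= yE; have d1 := d_ptt x yT; have d2 := dt_pxx x yT.
  apply: deq (dD (dZ k1 (dZ 2^-1 (dM d1 d1))) (dZ k3 (dZ 2^-1 (dM d2 d2)))) _.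
  exact: half_square_alg.
have dB (x y : R) : 0 < x < 1 -> s < y < t -> is_derive x 1 (fun x => N B (x, y)) (N w (x, y)).
  move=> _ sy; rewrite /N/=; have yT := cl_in y; set y' := clamp s t y.
  have d1 := d_pxt (k := 0) x isT yT; have d2 := d_pxt (k := 1) x isT yT.
  have d3 := d_px (k := 2) x isT yT; have d4 := d_px (k := 3) x isT yT.
  exact: (dD (dZ (- k2) (dM d1 d2)) (dZ k3 (dB (dM d1 d4) (dM d2 d3)))).
have perB y : s < y < t -> N B (1, y) = N B (0, y).
  move=> sy; have yT := cl_in y; rewrite /N/= /B.
  have p1 := pxt_periodic (k := 0) isT yT 0; have p2 := pxt_periodic (k := 1) isT yT 0.
  have p3 := px_periodic (k := 2) isT yT 0; have p4 := px_periodic (k := 3) isT yT 0.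
  by move: p1 p2 p3 p4; rewrite /= !add0r => -> -> -> ->.
have H := rect_conservation st' (CU _ _ st) (CB _ _ st) (Cu _ _ st) (Cw _ _ st) dU dB perB.
have sE : clamp s t s = s by rewrite clamp_id// lexx.
have tE : clamp s t t = t by rewrite clamp_id// lexx andbT.
have {}H : slab s t (fun q => u q + w q) = itg 0 1 (fun x => U (x, t)) - itg 0 1 (fun x => U (x, s)).
  by rewrite slab_clamp; move: H; rewrite /N/= sE tE.
rewrite -[X in X + _]H -(slabZ k2 (lat_cont_M Cetx Cetx) st).
rewrite -(slabD (lat_cont_D Cu Cw) (lat_cont_M (CC k2) (lat_cont_M Cetx Cetx)) st).
rewrite /slab; apply: itg_ext => y _; apply: itg_ext => x _.
exact/esym/structure_alg.
Qed.

End Structure.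

(** * Absorbing the work of the force *)

Section SourceBound.
Variable R : realType.

Lemma abs_le_itg (h k : R -> R) (c y : R) : 0 <= c -> continuous h -> continuous k ->
  (forall y : R, 0 < y < 1 -> is_derive y 1 h (c * k y)) -> h 0 = 0 -> 0 < y < 1 ->
  `|h y| <= c * itg 0 1 (fun y => `|k y|).
Proof.
move=> c0 ch ck dh h0 /andP[y0 y1].
have cck : continuous (fun y => c * k y) by exact: (contM (@cont_cst _ _ c) ck).
have cn : continuous (fun y => `|k y|) by move=> z; apply: cvg_norm; exact: ck.
have E : itg 0 y (fun y => c * k y) = h y - h 0.
  apply: (itg_FTC (ltW y0) cck ch) => z /andP[z0 zy]; apply: dh.
  by rewrite z0 (lt_trans zy).
rewrite h0 subr0 in E; rewrite -E -(itgZ _ _ _ cn).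
have cccn : continuous (fun y => c * `|k y|) by exact: (contM (@cont_cst _ _ c) cn).
apply: (le_trans (itg_abs _ _ cck)).
have -> : itg 0 y (fun y => `|c * k y|) = itg 0 y (fun y => c * `|k y|).
  by apply: itg_ext => z _; rewrite normrM ger0_norm.
have := itg_cat (ltW y0) (ltW y1) cccn => ->.
by rewrite lerDl; apply: itg_ge0 => z _; rewrite mulr_ge0.
Qed.

(** Pointwise Young inequality under the integral; no square root is taken, which
    spares a Cauchy-Schwarz inequality. *)
Lemma young_itg (k : R -> R) (c e : R) : 0 <= e -> continuous k ->
  e * (c * (e * itg 0 1 (fun y => `|k y|))) <=
  2^-1 * itg 0 1 (fun y => e * (k y * k y)) + 2^-1 * (c ^+ 2 * e ^+ 3).
Proof.
move=> e0 ck.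
have cn : continuous (fun y => `|k y|) by move=> z; apply: cvg_norm; exact: ck.
have cc (d : R) : continuous (fun _ : R => d) by exact: cont_cst.
have ckk := contM (cc e) (contM ck ck).
have -> : e * (c * (e * itg 0 1 (fun y => `|k y|))) = itg 0 1 (fun y => e * c * e * `|k y|).
  by rewrite itgZ// !mulrA.
have -> : 2^-1 * itg 0 1 (fun y => e * (k y * k y)) + 2^-1 * (c ^+ 2 * e ^+ 3) =
    itg 0 1 (fun y => 2^-1 * (e * (k y * k y)) + 2^-1 * (c ^+ 2 * e ^+ 3)).
  rewrite (itgD 0 1 (contM (cc 2^-1) ckk) (cc (2^-1 * (c ^+ 2 * e ^+ 3)))).
  by rewrite (itgZ 0 1 2^-1 ckk) itg_cst ?ler01// subr0 mulr1.
apply: le_itg => [||y _].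
- exact: (contM (cc (e * c * e)) cn).
- exact: (contD (contM (cc 2^-1) ckk) (cc (2^-1 * (c ^+ 2 * e ^+ 3)))).
have -> : k y * k y = `|k y| * `|k y| by rewrite -normrM ger0_norm// -expr2 sqr_ge0.
have H : 0 <= e * (c * e - `|k y|) ^+ 2 by rewrite mulr_ge0// sqr_ge0.
rewrite -subr_ge0 (_ : _ - _ = 2^-1 * (e * (c * e - `|k y|) ^+ 2)); last by field.
by rewrite mulr_ge0// invr_ge0.
Qed.

Variables (T : R) (eta : R * R -> R).
Hypothesis Hs : structure_regular T eta.
Let Flu := fluid eta T.
Let W (g : R * R * R -> R) := {within fluid_cl eta T, continuous g}.

(** No-slip at the bottom: the velocity is the integral of its vertical derivative. *)
Lemma vertical_bound (a az : R * R * R -> R) (x y t : R) : W a -> W az ->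
  (forall q, Flu q -> isd 1 a q (az q)) -> 0 < t < T -> a (x, 0, t) = 0 -> 0 < y < 1 ->
  `|a (x, y * eta (x, t), t)| <= eta (x, t) * itg 0 1 (fun y => `|az (Psi eta t t (x, y, t))|).
Proof.
move=> Wa Waz daz tT a0 y01; have tt := timewin_lt tT.
have CW g : W g -> continuous (fun y : R => g (Psi eta t t (x, y, t))).
  move=> Wg; refine (cont_comp (f := fun y : R => (x, y, t)) _ (flu_cont_within Hs (s := true) Wg tt)).
  by apply: cont_tuple3; [exact: cont_cst|exact: cont_id|exact: cont_cst].
have clt s : clamp t t s = t by have := @clamp_itv _ t t s (lexx t); rewrite -eq_le => /eqP <-.
have PE z : 0 <= z <= 1 -> Psi eta t t (x, z, t) = (x, z * eta (x, t), t).
  by move=> z01; rewrite /Psi/= (clamp_id z01) clt.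
have y01' : 0 <= y <= 1 by case/andP: y01 => /ltW -> /ltW ->.
rewrite -(PE y y01').
apply: (@abs_le_itg (fun y => a (Psi eta t t (x, y, t))) (fun y => az (Psi eta t t (x, y, t)))) => //.
- exact/ltW/(eta_gt0 Hs).
- exact: CW.
- exact: CW.
- move=> z z01; apply: (@dnear _ _ (fun z => a (x, z * eta (x, t), t))).
    by apply: filterS (near_clamp z01) => s st; rewrite /Psi/= st clt.
  have s : is_derive z 1 (fun z : R => z * eta (x, t)) (eta (x, t)).
    by apply: deq (dM (did z) (dcst (eta (x, t)) z)) _; rewrite mul1r mulr0 addr0.
  have d : is_derive (z * eta (x, t)) 1 (fun z => a (x, z, t)) (az (x, z * eta (x, t), t)).
    exact: (daz (x, z * eta (x, t), t) (in_fluid Hs x z01 tT)).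
  rewrite PE; last by case/andP: z01 => /ltW -> /ltW ->.
  rewrite mulrC.
  exact: (@is_derive1_comp R (fun z => a (x, z, t)) (fun y => y * eta (x, t)) z _ _ d s).
- by rewrite PE ?lexx ?ler01// mul0r.
Qed.

(** The Poincare estimate in vertical direction costs a factor [eta], and Young's
    inequality puts half of the vertical dissipation on the left. What is left of
    the force is $c^2\eta^3$, one power of the height from the integration over the
    column and two from the Poincare estimate. *)
Lemma source_bound (a b ax az bx bz S : R * R * R -> R) (c x t : R) :
  W a -> W b -> W ax -> W az -> W bx -> W bz -> W S -> 0 <= c ->
  (forall q, Flu q -> isd 1 a q (az q)) -> (forall q, Flu q -> isd 1 b q (bz q)) ->
  0 < t < T -> a (x, 0, t) = 0 -> b (x, 0, t) = 0 ->
  (forall z, 0 < z < eta (x, t) -> S (x, z, t) <= c * (`|a (x, z, t)| + `|b (x, z, t)|)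
     - (ax (x, z, t) * ax (x, z, t) + az (x, z, t) * az (x, z, t)
        + bx (x, z, t) * bx (x, z, t) + bz (x, z, t) * bz (x, z, t))) ->
  column eta S (x, t) <=
  - (2^-1 * column eta (fun q => ax q * ax q + az q * az q + bx q * bx q + bz q * bz q) (x, t))
    + c ^+ 2 * eta (x, t) ^+ 3.
Proof.
move=> Wa Wb Wax Waz Wbx Wbz WS c0 daz dbz tT a0 b0 HS.
have tt := timewin_lt tT; have e0 := eta_gt0 Hs x tT.
have CW g : W g -> continuous (fun y : R => g (Psi eta t t (x, y, t))).
  move=> Wg; refine (cont_comp (f := fun y : R => (x, y, t)) _ (flu_cont_within Hs (s := true) Wg tt)).
  by apply: cont_tuple3; [exact: cont_cst|exact: cont_id|exact: cont_cst].
have WF g : W g -> flu_cont T eta true g by exact: (flu_cont_within Hs (s := true)).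
set e := eta (x, t) in e0 *.
set A := itg 0 1 (fun y => `|az (Psi eta t t (x, y, t))|).
set B := itg 0 1 (fun y => `|bz (Psi eta t t (x, y, t))|).
pose V q := az q * az q + bz q * bz q.
pose G q := ax q * ax q + az q * az q + bx q * bx q + bz q * bz q.
have WM g h : W g -> W h -> W (fun q => g q * h q) by exact: contM.
have WD g h : W g -> W h -> W (fun q => g q + h q) by exact: contD.
have WC k : W (fun=> k) by exact: cont_cst.
have WG : W G := WD _ _ (WD _ _ (WD _ _ (WM _ _ Wax Wax) (WM _ _ Waz Waz)) (WM _ _ Wbx Wbx)) (WM _ _ Wbz Wbz).
have WV : W V := WD _ _ (WM _ _ Waz Waz) (WM _ _ Wbz Wbz).
have H1 : column eta S (x, t) <= column eta (fun q => c * (e * (A + B)) + (-1) * G q) (x, t).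
  apply: (column_le Hs (WF _ WS) (WF _ (WD _ _ (WC (c * (e * (A + B)))) (WM _ _ (WC (-1)) WG))) tt).
  move=> y /[dup] y01 /andP[y0 y1].
  apply: (le_trans (HS _ _)); first by rewrite mulr_gt0//= gtr_pMl.
  rewrite mulN1r lerD2r ler_wpM2l// mulrDr lerD//; exact: vertical_bound.
apply: (le_trans H1).
rewrite (columnD x (WF _ (WC _)) (WF _ (WM _ _ (WC (-1)) WG)) tt) (columnZ _ x (WF _ WG) tt) column_cst -/e.
have colV : column eta V (x, t) = itg 0 1 (fun y => e * (az (Psi eta t t (x, y, t)) * az (Psi eta t t (x, y, t))))
   + itg 0 1 (fun y => e * (bz (Psi eta t t (x, y, t)) * bz (Psi eta t t (x, y, t)))).
  have clt s : clamp t t s = t by have := @clamp_itv _ t t s (lexx t); rewrite -eq_le => /eqP <-.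
  have ce : continuous (fun _ : R => e) by exact: cont_cst.
  rewrite -(itgD 0 1 (contM ce (contM (CW _ Waz) (CW _ Waz))) (contM ce (contM (CW _ Wbz) (CW _ Wbz)))).
  have := @column_Psi _ eta V t t x t; rewrite clt => ->.
  by apply: itg_ext => y _; rewrite -mulrDr.
have VG : column eta V (x, t) <= column eta G (x, t).
  apply: (column_le Hs (WF _ WV) (WF _ WG) tt) => y y01; rewrite /V /G.
  set q := (x, _, t).
  have h1 : 0 <= ax q * ax q by rewrite -expr2 sqr_ge0.
  have h2 : 0 <= bx q * bx q by rewrite -expr2 sqr_ge0.
  by rewrite -addrA lerD// ?lerDl ?lerDr// -[leLHS]add0r lerD.
have YA := young_itg c (ltW e0) (CW _ Waz); have YB := young_itg c (ltW e0) (CW _ Wbz).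
rewrite -/A in YA; rewrite -/B in YB.
have E : e * (c * (e * (A + B))) = e * (c * (e * A)) + e * (c * (e * B)) by ring.
rewrite E -/G.
move: YA YB colV VG; set I1 := itg _ _ _; set I2 := itg _ _ _.
set cv := column eta V _; set cg := column eta G _.
set X1 := e * _; set X2 := e * _; set X3 := c ^+ 2 * _ => YA YB colV VG.
lra.
Qed.

End SourceBound.

(** * Energy inequality of the coupled system *)

(** With a vanishing tangential derivative of the horizontal velocity and zero
    divergence, the vertical component of the normal stress is the work density found
    in the fluid balance. *)
Fact top_stress_alg (R : realFieldType) (J ex ax az bx bz P : R) :
  J != 0 -> ax + ex * az = 0 -> ax + bz = 0 ->
  - J * (((ax + ax - P *+ 1) * (J^-1 * - ex) + (az + bx - P *+ 0) * (J^-1 * 1)) * 0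
    + ((bx + az - P *+ 0) * (J^-1 * - ex) + (bz + bz - P *+ 1) * (J^-1 * 1)) * 1) =
  P - bz + ex * bx.
Proof.
rewrite mulr1n mulr0n => J0 h1 h2; have h3 : ex * az - bz = 0.
  have -> : ex * az - bz = (ax + ex * az) - (ax + bz) by ring.
  by rewrite h1 h2 subrr.
by transitivity (P - bz + ex * bx + (ex * az - bz)); [field|rewrite h3 addr0].
Qed.

Fact source_alg (R : realDomainType) (c a b A B f0 f1 g : R) :
  A = f0 -> B = f1 -> `|f0| <= c -> `|f1| <= c ->
  a * A + b * B - g <= c * (`|a| + `|b|) - g.
Proof.
move=> -> -> h0 h1; rewrite lerD2r mulrDr lerD//.
  by rewrite mulrC (le_trans (ler_norm _))// normrM ler_wpM2r.
by rewrite mulrC (le_trans (ler_norm _))// normrM ler_wpM2r.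
Qed.

Fact energy_close_alg (R : realFieldType) (e2 Vt Vs Ut Us X G H : R) : 0 < e2 ->
  e2 * Vt - e2 * Vs + e2 * (Ut - Us + X) <= - G + H ->
  Vt + Ut + (e2^-1 * G + X) <= Vs + Us + e2^-1 * H.
Proof.
move=> e0 L; rewrite -subr_ge0.
have -> : Vs + Us + e2^-1 * H - (Vt + Ut + (e2^-1 * G + X)) =
   e2^-1 * (- G + H - (e2 * Vt - e2 * Vs + e2 * (Ut - Us + X))).
  by field; rewrite gt_eqF.
by rewrite mulr_ge0 ?invr_ge0 ?subr_ge0// ltW.
Qed.

Section SolutionEnergy.
Variables (R : realType) (rho delta beta r : R) (eta0 : R -> R) (eps T : R).
Variables (f v : R * R * R -> 'rV[R]_2) (p : R * R * R -> R) (eta : R * R -> R).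
Hypothesis sol : classical_solution rho delta beta r eta0 eps T f v p eta.

Let Hs : structure_regular T eta := sol_structure_regular sol.
Let Hf : fluid_regular T eta v p := sol_fluid_regular sol.
Let Flu := fluid eta T.
Let Cl := fluid_cl eta T.
Local Notation w i := (vcomp v i).
Local Notation vd := (vd T v eta).
Local Notation vd2 := (vd2 T v eta).
Local Notation vt := (vt T v eta).
Local Notation pr := (pr T p eta).
Local Notation prd := (prd T p eta).
Local Notation etx := (px (pt eta)).
Local Notation exx := (px (px eta)).

Lemma fluid_shift x z t : Flu (x, z, t) -> Flu (x + 1, z, t).
Proof.
move=> [/= tT ze]; split => //=; rewrite (eta_periodic Hs)//.
by case/andP: tT => t0 tT; rewrite /lateral0/= (ltW t0).
Qed.

Lemma v_shift i x z t : Flu (x, z, t) -> w i (x + 1, z, t) = w i (x, z, t).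
Proof.
move=> [/= /andP[t0 tT] /andP[z0 ze]]; rewrite /vcomp (v_periodic Hf)//.
by split; rewrite /= ?(ltW t0)// (ltW z0) ltW.
Qed.

Lemma pr_shift x z t : Flu (x, z, t) -> pr (x + 1, z, t) = pr (x, z, t).
Proof.
move=> F; rewrite !(prE sol)//; last exact: fluid_shift.
exact: (p_periodic Hf).
Qed.

Lemma vd_shift i x z t : Flu (x, z, t) -> vd i 0 (x + 1, z, t) = vd i 0 (x, z, t).
Proof.
move=> F; have d := isd_v sol i 0 (fluid_shift F); have d0 := isd_v sol i 0 F.
rewrite /isd/= in d d0.
have s : is_derive x 1 (fun x : R => x + 1) (1 : R).
  by apply: deq (dD (did x) (dcst 1 x)) _; rewrite addr0.
have ds := @is_derive1_comp R (fun x => w i (x, z, t)) (fun x => x + 1) x _ _ d s.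
rewrite mulr1 in ds.
have N : \forall y \near x, Flu (y, z, t).
  have c : continuous (fun y : R => (y, z, t)).
    by apply: cont_tuple3; [exact: cont_id|exact: cont_cst|exact: cont_cst].
  have N : nbhs (x, z, t) Flu by apply: open_nbhs_nbhs; split => //; exact: fluid_open.
  exact: (c x _ N).
have d1 : is_derive x 1 (fun x => w i (x, z, t)) (vd i 0 (x + 1, z, t)).
  by apply: (dnear _ ds); apply: filterS N => y Fy /=; rewrite v_shift.
by case: d1 => _ <-; case: d0.
Qed.

Lemma noslip_bottom i x t : 0 < x < 1 -> 0 < t < T -> w i (x, 0, t) = 0.
Proof.
by move=> x01 tT; rewrite /vcomp (sol_noslip sol)// ?mxE// /omega/= in_itv.
Qed.

Lemma top_horizontal x t : 0 < x < 1 -> 0 < t < T -> w 0 (x, eta (x, t), t) = 0.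
Proof.
by move=> x01 tT; rewrite /vcomp (sol_kinematic sol)// ?mxE// /omega/= in_itv.
Qed.

Lemma top_vertical x t : 0 < x < 1 -> 0 < t < T ->
  w 1 (x, eta (x, t), t) = eps ^+ 2 * pt eta (x, t).
Proof.
by move=> x01 tT; rewrite /vcomp (sol_kinematic sol)// ?mxE// /omega/= in_itv.
Qed.

Lemma div_cell q : Flu q -> 0 < q.1.1 < 1 -> vd 0 0 q + vd 1 1 q = 0.
Proof. by move=> Fq q01; apply: (div0 sol). Qed.

Lemma periodic_ends z t : 0 < t < T -> 0 < z < eta (0, t) ->
  [/\ w 0 (1, z, t) = w 0 (0, z, t), w 1 (1, z, t) = w 1 (0, z, t),
      vd 0 0 (1, z, t) = vd 0 0 (0, z, t), vd 1 0 (1, z, t) = vd 1 0 (0, z, t) &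
      pr (1, z, t) = pr (0, z, t)].
Proof.
move=> tT zt; have F : Flu (0, z, t) by split.
by split; [have := v_shift 0 F|have := v_shift 1 F|have := vd_shift 0 F
  |have := vd_shift 1 F|have := pr_shift F]; rewrite add0r.
Qed.

Definition kinE := kin (eps ^+ 2) (w 0) (w 1).
Definition srcE := source (eps ^+ 2) (w 0) (w 1) (vd 0 0) (vd 0 1) (vd 1 0) (vd 1 1)
  (vd2 0 0 0) (vd2 0 1 1) (vd2 1 0 0) (vd2 1 1 1) (vt 0) (vt 1) (prd 0) (prd 1).

Let energy_balance_sol s t : timewin T true s t ->
  itg 0 1 (fun x => column eta kinE (x, t)) - itg 0 1 (fun x => column eta kinE (x, s))
  + slab s t (fun q => eps ^+ 2 * pt eta q * (top eta pr q - top eta (vd 1 1) q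
       + px eta q * top eta (vd 1 0) q))
  = slab s t (column eta srcE).
Proof.
move=> st; exact: (@energy_balance R T eta (eps ^+ 2) Hs (w 0) (w 1) (vd 0 0) (vd 0 1) (vd 1 0) (vd 1 1)
  (vd2 0 0 0) (vd2 0 0 1) (vd2 0 1 1) (vd2 1 0 0) (vd2 1 0 1) (vd2 1 1 1) (vt 0) (vt 1)
  pr (prd 0) (prd 1)
  (v_within sol 0) (v_within sol 1) (vd_within sol 0 0) (vd_within sol 0 1)
  (vd_within sol 1 0) (vd_within sol 1 1)
  (vd2_within sol 0 0 0) (vd2_within sol 0 0 1) (vd2_within sol 0 1 1)
  (vd2_within sol 1 0 0) (vd2_within sol 1 0 1) (vd2_within sol 1 1 1)
  (vt_within sol 0) (vt_within sol 1) (pr_within sol) (prd_within sol 0) (prd_within sol 1)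
  (isd_v sol 0 0) (isd_v sol 0 1) (isd_v sol 1 0) (isd_v sol 1 1)
  (isd_vd sol 0 0 0) (isd_vd sol 0 0 1) (isd_vd sol 0 1 1)
  (isd_vd sol 1 0 0) (isd_vd sol 1 0 1) (isd_vd sol 1 1 1)
  (isd_pr sol 0) (isd_pr sol 1)
  (is_derive_vt sol 0) (is_derive_vt sol 1)
  div_cell (noslip_bottom 0) (noslip_bottom 1) top_horizontal top_vertical periodic_ends s t st).
Qed.

Lemma mass_sol s t : eps != 0 -> timewin T true s t ->
  itg 0 1 (fun x => eta (x, t)) = itg 0 1 (fun x => eta (x, s)).
Proof.
move=> e0 st; apply: (@mass_conserved R T eta (eps ^+ 2) Hs (w 0) (w 1) (vd 0 0) (vd 0 1)
  (vd 1 0) (vd 1 1) pr (v_within sol 0) (v_within sol 1) (vd_within sol 0 0)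
  (vd_within sol 0 1) (vd_within sol 1 1) (isd_v sol 0 0) (isd_v sol 0 1) (isd_v sol 1 1)
  div_cell (noslip_bottom 1) top_horizontal top_vertical periodic_ends s t st).
by rewrite expf_neq0.
Qed.

(** The trace of the stress from inside the fluid is the value on the graph of
    the continuous extension. *)
Lemma stress_traceE i j x t : 0 < t < T ->
  stress_trace v p eta (x, t) i j =
  top eta (vd i j) (x, t) + top eta (vd j i) (x, t) - top eta pr (x, t) *+ (i == j).
Proof.
move=> tT; have tt := timewin_lt tT; have e0 := eta_gt0 Hs x tT.
rewrite /stress_trace mxE; apply: cvg_lim; first exact: Rhausdorff.
have CW (g : R * R * R -> R) : {within Cl, continuous g} -> continuous (fun y : R => g (Psi eta t t (x, y / eta (x, t), t))).
  move=> Wg; refine (cont_comp (f := fun y : R => (x, y / eta (x, t), t)) _ (flu_cont_within Hs (s := true) Wg tt)).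
  apply: cont_tuple3; [exact: cont_cst| |exact: cont_cst].
  by apply: contM; [exact: cont_id|exact: cont_cst].
have clt s : clamp t t s = t by have := @clamp_itv _ t t s (lexx t); rewrite -eq_le => /eqP <-.
have PE z : 0 <= z <= eta (x, t) -> Psi eta t t (x, z / eta (x, t), t) = (x, z, t).
  move=> /andP[z0 ze]; rewrite /Psi/= clt clamp_id ?divfK ?gt_eqF//.
  by rewrite divr_ge0 ?(ltW e0)//= ler_pdivrMr// mul1r.
pose g q := vd i j q + vd j i q - pr q *+ (i == j).
have Wg : {within Cl, continuous g}.
  have W1 : {within Cl, continuous (fun q => vd i j q + vd j i q)}.
    by apply: contD; exact: (vd_within sol).
  rewrite /g; case: (i == j).
    exact: (contB W1 (pr_within sol)).
  rewrite (_ : (fun q => _) = fun q => vd i j q + vd j i q)//.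
  by apply/funext => q; rewrite mulr0n subr0.
have -> : top eta (vd i j) (x, t) + top eta (vd j i) (x, t) - top eta pr (x, t) *+ (i == j)
   = g (Psi eta t t (x, eta (x, t) / eta (x, t), t)).
  by rewrite PE// (ltW e0) lexx.
have H : g (Psi eta t t (x, z / eta (x, t), t)) @[z --> (eta (x, t))^'-] -->
    g (Psi eta t t (x, eta (x, t) / eta (x, t), t)).
  by apply: cvg_at_left_filter; exact: (CW g Wg).
apply: cvg_trans H; apply: near_eq_cvg; near=> z.
have zt : 0 < z < eta (x, t).
  by apply/andP; split; near: z; [exact: nbhs_left_gt|exact: nbhs_left_lt].
rewrite PE; last by case/andP: zt => /ltW -> /ltW ->.
by rewrite (stressE sol)//; split.
Unshelve. all: end_near. Qed.

Lemma structure_top x t : 0 < x < 1 -> 0 < t < T ->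
  rho * eps ^+ 5 * pt (pt eta) (x, t)
    - delta * eps `^ (2 - r) * px etx (x, t)
    + beta * eps^-1 * px (px exx) (x, t) =
  top eta pr (x, t) - top eta (vd 1 1) (x, t) + px eta (x, t) * top eta (vd 1 0) (x, t).
Proof.
move=> x01 tT; have Ox : omega R x by rewrite /omega/= in_itv.
rewrite (sol_structure sol)//.
have J0 : jac eta (x, t) != 0.
  by rewrite /jac gt_eqF// sqrtr_gt0 ltr_wpDr// sqr_ge0.
rewrite /dot sum2E !mxE !sum2E !stress_traceE// !mxE/=.
have h1 := top_tangential Hs (v_within sol 0) (vd_within sol 0 0) (vd_within sol 0 1)
  (isd_v sol 0 0) (isd_v sol 0 1) top_horizontal x01 tT.
have h2 := top_div Hs (vd_within sol 0 0) (vd_within sol 1 1) div_cell x01 tT.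
exact: top_stress_alg.
Qed.

(** The energies are those of the estimate, with the coefficients of the plate
    equation; the kinetic part is an integral over columns. *)
Definition velocity_sq q := w 0 q * w 0 q + w 1 q * w 1 q.
Definition gradient_sq q := vd 0 0 q * vd 0 0 q + vd 0 1 q * vd 0 1 q
  + vd 1 0 q * vd 1 0 q + vd 1 1 q * vd 1 1 q.
Definition plate_density q := rho * eps ^+ 5 * (2^-1 * (pt eta q * pt eta q))
  + beta * eps^-1 * (2^-1 * (exx q * exx q)).
Definition energy_density q := 2^-1 * column eta velocity_sq q + plate_density q.
Definition total_energy t := itg 0 1 (fun x => energy_density (x, t)).
Definition diss_density q := eps ^- 2 * (2^-1 * column eta gradient_sq q)
  + delta * eps `^ (2 - r) * (etx q * etx q).

Let WF g : {within Cl, continuous g} -> flu_cont T eta true g := flu_cont_within Hs (s := true) (g := g).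

Lemma velocity_sq_within : {within Cl, continuous velocity_sq}.
Proof. exact: (contD (contM (v_within sol 0) (v_within sol 0)) (contM (v_within sol 1) (v_within sol 1))). Qed.

Lemma gradient_sq_within : {within Cl, continuous gradient_sq}.
Proof.
have W i j := contM (vd_within sol i j) (vd_within sol i j).
exact: (contD (contD (contD (W 0 0) (W 0 1)) (W 1 0)) (W 1 1)).
Qed.

Lemma srcE_within : {within Cl, continuous srcE}.
Proof.
exact: (@W_source R T eta (eps ^+ 2) (w 0) (w 1) (vd 0 0) (vd 0 1) (vd 1 0) (vd 1 1)
  (vd2 0 0 0) (vd2 0 1 1) (vd2 1 0 0) (vd2 1 1 1) (vt 0) (vt 1) (prd 0) (prd 1)
  (v_within sol 0) (v_within sol 1) (vd_within sol 0 0) (vd_within sol 0 1)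
  (vd_within sol 1 0) (vd_within sol 1 1)
  (vd2_within sol 0 0 0) (vd2_within sol 0 1 1)
  (vd2_within sol 1 0 0) (vd2_within sol 1 1 1)
  (vt_within sol 0) (vt_within sol 1) (prd_within sol 0) (prd_within sol 1)).
Qed.

Lemma lat_cont_plate_density : lat_cont T true plate_density.
Proof.
have Cet := lat_cont_pxt Hs (isT : (0 <= 2)%N).
have Cexx := lat_cont_px Hs (isT : (2 <= 4)%N).
exact: (lat_cont_D (lat_cont_M (@lat_cont_cst _ T true _) (lat_cont_M (@lat_cont_cst _ T true _) (lat_cont_M Cet Cet)))
  (lat_cont_M (@lat_cont_cst _ T true _) (lat_cont_M (@lat_cont_cst _ T true _) (lat_cont_M Cexx Cexx)))).
Qed.

Lemma lat_cont_energy_density : lat_cont T true energy_density.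
Proof. exact: (lat_cont_D (lat_cont_M (@lat_cont_cst _ T true _) (lat_cont_column Hs (WF velocity_sq_within))) lat_cont_plate_density). Qed.

Lemma lat_cont_etx2 : lat_cont T true (fun q => etx q * etx q).
Proof. by apply: lat_cont_M; exact: (lat_cont_pxt Hs (isT : (1 <= 2)%N)). Qed.

Lemma lat_cont_diss_density : lat_cont T true diss_density.
Proof.
exact: (lat_cont_D (lat_cont_M (@lat_cont_cst _ T true _) (lat_cont_M (@lat_cont_cst _ T true _) (lat_cont_column Hs (WF gradient_sq_within))))
  (lat_cont_M (@lat_cont_cst _ T true _) lat_cont_etx2)).
Qed.

Lemma lat_cont_eta3 k : lat_cont T true (fun q => k * eta q ^+ 3).
Proof.
have Ce := lat_contW (lat_cont_eta Hs).
exact: (lat_cont_M (@lat_cont_cst _ T true k) (lat_cont_M Ce (lat_cont_M Ce Ce))).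
Qed.

(** The dissipation appears with a factor $1/2$: the other half absorbs the force. *)
Lemma source_le c x t : 0 <= c -> (forall q i, cell T eta q -> `|f q 0 i| <= c) ->
  0 < x < 1 -> 0 < t < T ->
  column eta srcE (x, t) <= - (2^-1 * column eta gradient_sq (x, t)) + c ^+ 2 * eta (x, t) ^+ 3.
Proof.
move=> c0 fc x01 tT.
apply: (source_bound Hs (v_within sol 0) (v_within sol 1) (vd_within sol 0 0)
  (vd_within sol 0 1) (vd_within sol 1 0) (vd_within sol 1 1) srcE_within c0
  (isd_v sol 0 1) (isd_v sol 1 1) tT (noslip_bottom 0 x01 tT) (noslip_bottom 1 x01 tT)).
move=> z zt; have Cq : cell T eta (x, z, t) by split.
exact: (source_alg _ _ _ (momentum sol 0 Cq) (momentum sol 1 Cq) (fc _ 0 Cq) (fc _ 1 Cq)).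
Qed.

(** The exchange of energy through the graph cancels between the fluid and the
    plate. The fluid balance carries a factor $\varepsilon^2$ because the velocity
    of the graph does; dividing by it yields the weights of the estimate. *)
Lemma energy_ineq c s t : 0 < eps -> 0 <= c ->
  (forall q i, cell T eta q -> `|f q 0 i| <= c) -> timewin T true s t ->
  total_energy t + slab s t diss_density <= total_energy s + slab s t (fun q => eps ^- 2 * (c ^+ 2 * eta q ^+ 3)).
Proof.
move=> eps0 c0 fc st; have /and3P[s0 st' tT] := st.
have in_T u : s < u < t -> 0 < u < T.
  by move=> /andP[su ut]; rewrite (lt_trans s0)//= (lt_trans ut).
have ss : timewin T true s s by apply: (timewin1 st); rewrite lexx.
have tt : timewin T true t t by apply: (timewin1 st); rewrite lexx andbT.
have CV := lat_cont_column Hs (WF velocity_sq_within); have CG := lat_cont_column Hs (WF gradient_sq_within).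
have CC k : lat_cont T true (fun=> k) := @lat_cont_cst _ T true k.
have e20 : 0 < eps ^+ 2 by rewrite exprn_gt0.
have kinI u : timewin T true u u -> itg 0 1 (fun x => column eta kinE (x, u)) =
    eps ^+ 2 * itg 0 1 (fun x => 2^-1 * column eta velocity_sq (x, u)).
  move=> uu; rewrite -(itgZ _ _ _ (lat_cont_slice (lat_cont_M (CC 2^-1) CV) uu)).
  apply: itg_ext => x _.
  have Wh : {within Cl, continuous (fun q => 2^-1 * velocity_sq q)}.
    by apply: contM; [exact: cont_cst|exact: velocity_sq_within].
  by rewrite -(columnZ _ x (WF velocity_sq_within) uu) -(columnZ _ x (WF Wh) uu).
have EnI u : timewin T true u u -> total_energy u = itg 0 1 (fun x => 2^-1 * column eta velocity_sq (x, u))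
    + itg 0 1 (fun x => plate_density (x, u)).
  by move=> uu; rewrite -(itgD _ _ (lat_cont_slice (lat_cont_M (CC 2^-1) CV) uu) (lat_cont_slice lat_cont_plate_density uu)).
have B := energy_balance_sol st.
have Cet := lat_cont_pxt Hs (isT : (0 <= 2)%N).
have Cst : lat_cont T true (fun q => pt eta q * (rho * eps ^+ 5 * pt (pt eta) q
    - delta * eps `^ (2 - r) * px etx q + beta * eps^-1 * px (px exx) q)).
  apply: (lat_cont_M Cet (lat_cont_D (lat_cont_B (lat_cont_M (CC _) (lat_cont_ptt Hs)) (lat_cont_M (CC _) (lat_cont_pxt Hs (isT : (2 <= 2)%N))))
    (lat_cont_M (CC _) (lat_cont_px Hs (isT : (4 <= 4)%N))))).
have topE : slab s t (fun q => eps ^+ 2 * pt eta q * (top eta pr q - top eta (vd 1 1) q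
       + px eta q * top eta (vd 1 0) q)) =
   eps ^+ 2 * slab s t (fun q => pt eta q * (rho * eps ^+ 5 * pt (pt eta) q
    - delta * eps `^ (2 - r) * px etx q + beta * eps^-1 * px (px exx) q)).
  rewrite -(slabZ _ Cst st); apply: (slab_eq (s := true) (T := T)) => //.
  - exact: (lat_cont_M (lat_cont_M (CC (eps ^+ 2)) Cet) (lat_cont_D (lat_cont_B (lat_cont_top (WF (pr_within sol)))
      (lat_cont_top (WF (vd_within sol 1 1)))) (lat_cont_M (lat_cont_px Hs (isT : (1 <= 4)%N)) (lat_cont_top (WF (vd_within sol 1 0)))))).
  - exact: (lat_cont_M (CC (eps ^+ 2)) Cst).
  - by move=> x u x01 su; rewrite (structure_top x01 (in_T u su)) mulrA.
have SB := structure_balance Hs (rho * eps ^+ 5) (delta * eps `^ (2 - r)) (beta * eps^-1) st.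
rewrite topE {}SB !kinI// in B.
have Cs := lat_cont_column Hs (WF srcE_within).
have L : slab s t (column eta srcE) <=
    - slab s t (fun q => 2^-1 * column eta gradient_sq q) + slab s t (fun q => c ^+ 2 * eta q ^+ 3).
  have Cg : lat_cont T true (fun q => 2^-1 * column eta gradient_sq q) := lat_cont_M (CC 2^-1) CG.
  have -> : - slab s t (fun q => 2^-1 * column eta gradient_sq q) = slab s t (fun q => (-1) * (2^-1 * column eta gradient_sq q)).
    by rewrite (slabZ _ Cg st) mulN1r.
  rewrite -(slabD (lat_cont_M (CC (-1)) Cg) (@lat_cont_eta3 (c ^+ 2)) st).
  apply: (slab_le Cs (lat_cont_D (lat_cont_M (CC (-1)) Cg) (@lat_cont_eta3 (c ^+ 2))) st) => x u x01 su.
  by rewrite mulN1r; apply: source_le => //; exact: in_T.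
rewrite (slabZ _ (@lat_cont_eta3 (c ^+ 2)) st).
have -> : slab s t diss_density = eps ^- 2 * slab s t (fun q => 2^-1 * column eta gradient_sq q)
    + delta * eps `^ (2 - r) * slab s t (fun q => etx q * etx q).
  rewrite -(slabZ _ (lat_cont_M (CC 2^-1) CG) st) -(slabZ _ lat_cont_etx2 st).
  by rewrite -(slabD (lat_cont_M (CC _) (lat_cont_M (CC 2^-1) CG)) (lat_cont_M (CC _) lat_cont_etx2) st).
rewrite !EnI//.
rewrite -{}B in L; exact: (energy_close_alg e20 L).
Qed.

End SolutionEnergy.

(** * One-variable inequalities *)

Section RealVariable.
Variable R : realType.
Implicit Types (a b s t x y : R) (h k : R -> R).

Lemma is_derive_itg h a x : continuous h -> a < x ->
  is_derive x 1 (fun u => itg a u h) (h x).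
Proof.
move=> ch ax.
have xu : x < x + 1 by rewrite ltrDl.
have := @continuous_FTC1_closed R h a x (x + 1) xu (cont_integrable a (x + 1) ch) ax (ch x).
move=> [d E]; rewrite (_ : (fun u => _) = fun u => \int[@lebesgue_measure R]_(t in `[a, u]) h t)%R; last first.
  by apply/funext => u; rewrite itg.unlock.
by rewrite -[X in is_derive _ _ _ X]E; exact: is_derive1P.
Qed.

(** Integral form of Gronwall's inequality, keeping the dissipation [D]. *)
Lemma gronwall (E : R -> R) (D : R -> R) s t (k c : R) : s <= t -> 0 <= k -> 0 < c ->
  continuous (fun u => E (clamp s t u)) -> 0 <= E s ->
  (forall u, s <= u <= t -> 0 <= D u) ->
  (forall u, s <= u <= t -> E u + D u <= E s + itg s u (fun y => k + c * E y)) ->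
  E t + D t <= (E s + k / c) * expR (c * (t - s)).
Proof.
move=> st k0 c0 cE Es D0 H.
pose h u := k + c * E (clamp s t u).
have ch : continuous h.
  exact: (contD (@cont_cst _ _ k) (contM (@cont_cst _ _ c) cE)).
(* starting the primitive to the left of s makes it differentiable at s *)
pose Y u := itg (s - 1) u h - itg (s - 1) s h.
have YE u : s <= u <= t -> Y u = itg s u (fun y => k + c * E y).
  move=> /andP[su ut]; rewrite /Y (itg_cat (b := s))//; last by rewrite gerBl.
  rewrite addrAC subrr add0r; apply: itg_ext => y /andP[sy yu].
  by rewrite /h clamp_id// sy (le_trans yu).
pose q := E s + k / c.
pose Z u := (Y u + q) * expR (- c * u).
have dZ' u : s <= u -> is_derive u 1 Z ((h u - c * (Y u + q)) * expR (- c * u)).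
  move=> su; have sm : s - 1 < u by apply: lt_le_trans su; rewrite gtrBl.
  have dY : is_derive u 1 Y (h u).
    apply: deq (dB (is_derive_itg ch sm) (dcst (itg (s - 1) s h) u)) _.
    by rewrite subr0.
  have de : is_derive u 1 (fun u => expR (- c * u)) (expR (- c * u) * - c).
    apply: (@is_derive1_comp R expR (fun u => - c * u)).
    by apply: deq (dZ (- c) (did u)) _; rewrite mulr1.
  apply: deq (dM (dD dY (dcst q u)) de) _.
  by rewrite addr0; ring.
have Zts : Z t <= Z s.
  apply: (@ler0_derive1_nincr R Z s t) => //.
  - move=> u; rewrite in_itv/= => /andP[su ut]; by case: (dZ' u (ltW su)).
  - move=> u; rewrite in_itv/= => /andP[su ut].
    have su' : s <= u <= t by rewrite !ltW.
    rewrite derive1E.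
    have -> : 'D_1 Z u = (h u - c * (Y u + q)) * expR (- c * u) by case: (dZ' u (ltW su)).
    rewrite pmulr_lle0 ?expR_gt0// subr_le0 /h clamp_id// /q.
    have := H u su'; rewrite -(YE u su') => Hu.
    have Eu : E u <= E s + Y u by apply: le_trans Hu; rewrite lerDl; exact: D0.
    have -> : c * (Y u + (E s + k / c)) = k + c * (E s + Y u) by field; rewrite gt_eqF.
    by rewrite lerD2l ler_wpM2l// ltW.
  - apply: derivable_within_continuous => u; rewrite in_itv/= => /andP[su ut].
    by case: (dZ' u su).
have stt : s <= t <= t by rewrite st lexx.
have sst : s <= s <= t by rewrite st lexx.
have Yt : Y t + q <= q * expR (c * (t - s)).
  move: Zts; rewrite /Z (_ : Y s = 0) ?add0r; last by rewrite /Y subrr.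
  rewrite -ler_pdivlMr ?expR_gt0// -mulrA -expRN -expRD.
  by rewrite (_ : - c * s + - (- c * t) = c * (t - s)) //; ring.
apply: (le_trans (H t stt)); rewrite -(YE t stt).
apply: le_trans Yt; rewrite (addrC (E s)) lerD2l lerDl.
by rewrite divr_ge0// ltW.
Qed.

Lemma dev_le h k : continuous h -> continuous k ->
  (forall x : R, is_derive x 1 h (k x)) -> forall x y, 0 <= x <= 1 -> 0 <= y <= 1 ->
  h x - h y <= itg 0 1 (fun x => `|k x|).
Proof.
move=> ch ck dh.
have cn : continuous (fun y => `|k y|) by move=> z; apply: cvg_norm; exact: ck.
have bound x y : 0 <= x -> x <= y -> y <= 1 -> `|h y - h x| <= itg 0 1 (fun x => `|k x|).
  move=> x0 xy y1; rewrite -(itg_FTC xy ck ch)//; apply: (le_trans (itg_abs _ _ ck)).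
  have y0 := le_trans x0 xy.
  rewrite (itg_cat y0 y1 cn) (itg_cat x0 xy cn) -addrA addrCA lerDl.
  by apply: addr_ge0; apply: itg_ge0.
move=> x y /andP[x0 x1] /andP[y0 y1]; have [xy|yx] := leP x y.
  by apply: le_trans (bound x y x0 xy y1); rewrite distrC ler_norm.
by apply: le_trans (bound y x y0 (ltW yx) x1); rewrite ler_norm.
Qed.

Lemma le_mean_dev h k : continuous h -> continuous k ->
  (forall x : R, is_derive x 1 h (k x)) -> forall x, 0 <= x <= 1 ->
  h x <= itg 0 1 h + itg 0 1 (fun x => `|k x|).
Proof.
move=> ch ck dh x x01.
have -> : h x = itg 0 1 (fun=> h x) by rewrite itg_cst ?ler01// subr0 mulr1.
have cc (d : R) : continuous (fun _ : R => d) by exact: cont_cst.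
set B := itg 0 1 (fun x => `|k x|).
have -> : itg 0 1 h + B = itg 0 1 (fun y => h y + B).
  by rewrite (itgD 0 1 ch (cc B)) itg_cst ?ler01// subr0 mulr1.
apply: le_itg => //; first exact: contD.
move=> y /andP[y0 y1]; rewrite -lerBlDl; apply: (dev_le ch ck dh) => //.
by rewrite !ltW.
Qed.

(** The derivative of a periodic function has mean zero, so it is bounded by the
    integral of the second derivative; the function differs from its mean by at most
    the integral of the first. *)
Lemma periodic_sup h h1 h2 : continuous h -> continuous h1 -> continuous h2 ->
  (forall x : R, is_derive x 1 h (h1 x)) -> (forall x : R, is_derive x 1 h1 (h2 x)) ->
  h 1 = h 0 -> forall x, 0 <= x <= 1 ->
  h x <= itg 0 1 h + itg 0 1 (fun x => `|h2 x|).
Proof.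
move=> ch ch1 ch2 d1 d2 per x x01.
have n1 : continuous (fun y => `|h1 y|) by move=> z; apply: cvg_norm; exact: ch1.
apply: (le_trans (le_mean_dev ch ch1 d1 x01)); rewrite lerD2l.
set N := itg 0 1 (fun x => `|h2 x|).
have I0 : itg 0 1 h1 = 0 by rewrite (itg_FTC ler01 ch1 ch)// per subrr.
have -> : N = itg 0 1 (fun=> N) by rewrite itg_cst ?ler01// subr0 mulr1.
apply: le_itg => //; first exact: cont_cst.
move=> y /andP[y0 y1]; have y01 : 0 <= y <= 1 by rewrite !ltW.
rewrite ler_norml; apply/andP; split; last first.
  by have := le_mean_dev ch1 ch2 d2 y01; rewrite I0 add0r.
have cN : continuous (fun x => - h1 x) by move=> z; apply: cvgN; exact: ch1.
have cN2 : continuous (fun x => - h2 x) by move=> z; apply: cvgN; exact: ch2.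
have dN (z : R) : is_derive z 1 (fun x => - h1 x) (- h2 z) by exact: is_deriveN.
have := le_mean_dev cN cN2 dN y01.
have -> : itg 0 1 (fun x => - h1 x) = 0.
  rewrite (_ : (fun x => - h1 x) = fun x => -1 * h1 x); last by apply/funext => z; rewrite mulN1r.
  by rewrite itgZ// I0 mulr0.
rewrite add0r (_ : (fun x => `|- h2 x|) = fun x => `|h2 x|); last by apply/funext => z; rewrite normrN.
by rewrite -/N lerNl.
Qed.

(** Nonnegativity of the variance of $|k|$. *)
Lemma jensen_abs k : continuous k ->
  itg 0 1 (fun x => `|k x|) ^+ 2 <= itg 0 1 (fun x => k x * k x).
Proof.
move=> ck; set N := itg 0 1 _.
have cn : continuous (fun y => `|k y|) by move=> z; apply: cvg_norm; exact: ck.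
have cc (d : R) : continuous (fun _ : R => d) by exact: cont_cst.
have : 0 <= itg 0 1 (fun x => (k x * k x + (- (2 * N)) * `|k x|) + N ^+ 2).
  apply: itg_ge0 => x _.
  have -> : k x * k x = `|k x| ^+ 2 by rewrite expr2 -normrM ger0_norm// -expr2 sqr_ge0.
  by rewrite (_ : _ + _ = (`|k x| - N) ^+ 2) ?sqr_ge0//; ring.
have ckk := contM ck ck; have cnn := contM (cc (- (2 * N))) cn.
rewrite (itgD 0 1 (contD ckk cnn) (cc (N ^+ 2))) (itgD 0 1 ckk cnn) (itgZ _ _ _ cn).
rewrite itg_cst ?ler01// subr0 mulr1 -/N => H; rewrite -subr_ge0; move: H.
set J := itg 0 1 (fun x => k x * k x).
have -> : J + - (2 * N) * N + N ^+ 2 = J - N ^+ 2 by ring.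
by [].
Qed.

(** Cubic moments grow only linearly in the bending energy because the mass of
    [h] is fixed: one factor is integrated and the two others are bounded by
    the supremum. *)
Lemma cube_bound h h1 h2 (m : R) : continuous h -> continuous h1 -> continuous h2 ->
  (forall x : R, is_derive x 1 h (h1 x)) -> (forall x : R, is_derive x 1 h1 (h2 x)) ->
  h 1 = h 0 -> (forall x, 0 <= h x) -> itg 0 1 h <= m ->
  itg 0 1 (fun x => h x ^+ 3) <= m * (2 * m ^+ 2 + 2 * itg 0 1 (fun x => h2 x * h2 x)).
Proof.
move=> ch ch1 ch2 d1 d2 per h0 hm.
set N := itg 0 1 (fun x => `|h2 x|); set J := itg 0 1 (fun x => h2 x * h2 x).
have m0 : 0 <= m by apply: le_trans hm; apply: itg_ge0.
have N0 : 0 <= N by apply: itg_ge0.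
have S x : 0 <= x <= 1 -> h x <= m + N.
  by move=> x01; apply: (le_trans (periodic_sup ch ch1 ch2 d1 d2 per x01)); rewrite lerD2r.
have mN0 : 0 <= m + N by exact: addr_ge0.
apply: (@le_trans _ _ (itg 0 1 (fun x => (m + N) ^+ 2 * h x))).
  apply: le_itg.
  - exact: (contM ch (contM ch ch)).
  - exact: (contM (@cont_cst _ _ ((m + N) ^+ 2)) ch).
  move=> x /andP[x0 x1]; have x01 : 0 <= x <= 1 by rewrite !ltW.
  rewrite exprS mulrC ler_wpM2r// lerXn2r ?nnegrE//; exact: S.
rewrite (itgZ _ _ _ ch); apply: (@le_trans _ _ ((m + N) ^+ 2 * m)).
  by rewrite ler_wpM2l// sqr_ge0.
rewrite mulrC ler_wpM2l//; have := jensen_abs ch2; rewrite -/N -/J => NJ.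
have : 0 <= (m - N) ^+ 2 by rewrite sqr_ge0.
rewrite !expr2 in NJ *; nra.
Qed.

End RealVariable.

(** * The energy estimate for iterated integrals *)

Section FinalEstimate.
Variables (R : realType) (rho delta beta r : R) (eta0 : R -> R) (eps T : R).
Variables (f v : R * R * R -> 'rV[R]_2) (p : R * R * R -> R) (eta : R * R -> R).
Hypothesis sol : classical_solution rho delta beta r eta0 eps T f v p eta.
Hypotheses (rho0 : 0 < rho) (delta0 : 0 < delta) (beta0 : 0 < beta) (eps0 : 0 < eps).
Variable M : R.
Hypothesis eta0M : forall x, 0 <= x <= 1 -> eta0 x <= M.
Hypothesis eta02M : forall x, 0 <= x <= 1 -> `|derive1 (derive1 eta0) x| <= M.

Let Hs : structure_regular T eta := sol_structure_regular sol.
Let Hf : fluid_regular T eta v p := sol_fluid_regular sol.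
Local Notation exx := (px (px eta)).
Local Notation total_energy := (total_energy rho beta eps v eta).
Local Notation energy_density := (energy_density rho beta eps v eta).
Local Notation diss_density := (diss_density delta r eps T v eta).
Local Notation velocity_sq := (velocity_sq v).
Local Notation gradient_sq := (gradient_sq T v eta).

(** Passage to the initial time: solutions are differentiable at positive times only. *)
Lemma le_at0 (F : R -> R) (t c : R) : continuous F -> 0 < t ->
  (forall s, 0 < s < t -> c <= F s) -> c <= F 0.
Proof.
move=> cF t0 H.
have L : F s @[s --> 0^'+] --> F 0 by apply: cvg_at_right_filter; exact: cF.
apply: (cvgr_to_ge L); near=> s; apply: H; apply/andP; split; near: s.
  exact: nbhs_right_gt.
exact: nbhs_right_lt.
Unshelve. all: end_near. Qed.

Lemma half_sq_ge0 (k y : R) : 0 <= k -> 0 <= k * (2^-1 * (y * y)).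
Proof.
by move=> k0; apply: mulr_ge0 => //; apply: mulr_ge0; rewrite ?invr_ge0// -expr2 sqr_ge0.
Qed.

Lemma timewin0 t : 0 < t < T -> timewin T false 0 t.
Proof. by move=> /andP[t0 tT]; apply/and3P; split => //; exact: ltW. Qed.

Lemma mass_le t : 0 < t < T -> itg 0 1 (fun x => eta (x, t)) <= eps * M.
Proof.
move=> tT; have /andP[t0 tT'] := tT; have win := timewin0 tT.
have cF := lat_cont_mean (lat_cont_eta Hs) win.
apply: (@le_trans _ _ (itg 0 1 (fun x => eta (x, 0)))).
  have := @le_at0 _ t (itg 0 1 (fun x => eta (x, t))) cF t0.
  have c0 : clamp 0 t 0 = 0 by apply: clamp_id; rewrite lexx (ltW t0).
  rewrite c0; apply => s /andP[s0 st].
  have cs : clamp 0 t s = s by apply: clamp_id; rewrite (ltW s0) (ltW st).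
  rewrite cs (mass_sol sol (s := s) (t := t)) ?gt_eqF//.
  by apply/and3P; split => //; exact: ltW.
have T00 : timewin T false 0 0 by apply: (timewin1 win); rewrite lexx ltW.
have -> : eps * M = itg 0 1 (fun=> eps * M) by rewrite itg_cst ?ler01// subr0 mulr1.
apply: le_itg; [exact: (lat_cont_slice (lat_cont_eta Hs) T00)|exact: cont_cst|].
move=> x /andP[x0 x1]; rewrite (sol_init_eta sol) ler_wpM2l ?(ltW eps0)// eta0M//.
by rewrite (ltW x0) (ltW x1).
Qed.

Lemma velocity_sq_ge0 q : 0 <= velocity_sq q.
Proof. by rewrite /velocity_sq addr_ge0// -expr2 sqr_ge0. Qed.

Lemma gradient_sq_ge0 q : 0 <= gradient_sq q.
Proof. by rewrite /gradient_sq !addr_ge0// -expr2 sqr_ge0. Qed.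

Lemma column_ge0 g x t : 0 < t < T -> (forall q, 0 <= g q) -> 0 <= column eta g (x, t).
Proof.
move=> tT g0; apply: itg_ge0 => y _; rewrite mulr_ge0//.
exact/ltW/(eta_gt0 Hs).
Qed.

Lemma bending_le t x : 0 < t < T -> beta * eps^-1 * (2^-1 * (exx (x, t) * exx (x, t))) <= energy_density (x, t).
Proof.
move=> tT; rewrite /energy_density /plate_density addrA lerDr addr_ge0//.
  by rewrite mulr_ge0 ?invr_ge0//; apply: column_ge0 => //; exact: velocity_sq_ge0.
by apply: half_sq_ge0; rewrite mulr_ge0 ?exprn_ge0 ?(ltW rho0) ?(ltW eps0).
Qed.

Lemma total_energy_ge0 t : 0 < t < T -> 0 <= total_energy t.
Proof.
move=> tT; apply: itg_ge0 => x _; apply: le_trans (bending_le x tT).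
by apply: half_sq_ge0; rewrite mulr_ge0 ?invr_ge0 ?(ltW beta0) ?(ltW eps0).
Qed.

Lemma diss_density_ge0 x t : 0 < t < T -> 0 <= diss_density (x, t).
Proof.
move=> tT; have g0 := column_ge0 x tT gradient_sq_ge0.
rewrite /diss_density addr_ge0//.
  by rewrite mulr_ge0 ?invr_ge0 ?exprn_ge0 ?(ltW eps0)// mulr_ge0 ?invr_ge0.
apply: mulr_ge0; first by rewrite mulr_ge0 ?powR_ge0 ?(ltW delta0).
by rewrite -expr2 sqr_ge0.
Qed.

Lemma rate_ge0 c : 0 <= M -> 0 <= 4 * c ^+ 2 * M / beta.
Proof.
move=> M0; apply: divr_ge0 (ltW beta0); apply: mulr_ge0 => //.
by apply: mulr_ge0; rewrite ?sqr_ge0.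
Qed.

(** The mass is of order $\varepsilon$, so the cubic moment is bounded by
    $\varepsilon M$ times $2(\varepsilon M)^2 + 2\int\eta_{xx}^2$; with the weight
    $\varepsilon^{-2}$ of the work this is the $\varepsilon^{-1}$ of the bending energy.
    This is what makes the growth rate independent of $\varepsilon$. *)
Lemma force_le c t : 0 < t < T ->
  itg 0 1 (fun x => eps ^- 2 * (c ^+ 2 * eta (x, t) ^+ 3)) <=
  2 * c ^+ 2 * M ^+ 3 * eps + (4 * c ^+ 2 * M / beta + 1) * total_energy t.
Proof.
move=> tT; have tt := timewin_lt tT.
have Ceta := lat_cont_slice (lat_contW (lat_cont_eta Hs)) tt.
have Cexx := lat_cont_slice (lat_cont_px Hs (isT : (2 <= 4)%N)) tt.
have Cex := lat_cont_slice (lat_cont_px Hs (isT : (1 <= 4)%N)) tt.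
set J := itg 0 1 (fun x => exx (x, t) * exx (x, t)).
have per : eta (1, t) = eta (0, t).
  have L : lateral0 T (0, t) by case/andP: tT => t0 ?; rewrite /lateral0/= (ltW t0).
  by have := eta_periodic Hs L; rewrite add0r.
have e0 x : 0 <= eta (x, t) by exact/ltW/(eta_gt0 Hs).
have CB := cube_bound Ceta Cex Cexx (fun x => is_derive_eta_x Hs x tT)
  (fun x => d_px Hs (k := 1) x isT tT) per e0 (mass_le tT).
have M0 : 0 <= M.
  have := le_trans (itg_ge0 (a := 0) (b := 1) (fun x _ => e0 x)) (mass_le tT).
  by rewrite pmulr_rge0.
have cub := contM Ceta (contM Ceta Ceta).
have -> : itg 0 1 (fun x => eps ^- 2 * (c ^+ 2 * eta (x, t) ^+ 3)) =
    eps ^- 2 * (c ^+ 2 * itg 0 1 (fun x => eta (x, t) ^+ 3)).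
  have -> : (fun x => eps ^- 2 * (c ^+ 2 * eta (x, t) ^+ 3)) =
     (fun x => (eps ^- 2 * c ^+ 2) * (eta (x, t) * (eta (x, t) * eta (x, t)))).
    by apply/funext => x; ring.
  have -> : (fun x => eta (x, t) ^+ 3) = (fun x => eta (x, t) * (eta (x, t) * eta (x, t))).
    by apply/funext => x; ring.
  by rewrite (itgZ _ _ _ cub) -mulrA.
have EJ : beta * eps^-1 * (2^-1 * J) <= total_energy t.
  have c1 := contM Cexx Cexx.
  have c2 : continuous (fun x => 2^-1 * (exx (x, t) * exx (x, t))).
    exact: (contM (@cont_cst _ _ (2^-1 : R)) c1).
  rewrite /J -(itgZ 0 1 2^-1 c1) -(itgZ 0 1 (beta * eps^-1) c2).
  apply: le_itg.
  - exact: (contM (@cont_cst _ _ (beta * eps^-1)) c2).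
  - exact: (lat_cont_slice (lat_cont_energy_density sol) tt).
  - by move=> x _; exact: bending_le.
have En0 := total_energy_ge0 tT.
have J0 : 0 <= J by apply: itg_ge0 => x _; rewrite -expr2 sqr_ge0.
apply: (@le_trans _ _ (eps ^- 2 * (c ^+ 2 * (eps * M * (2 * (eps * M) ^+ 2 + 2 * J))))).
  by rewrite ler_wpM2l ?invr_ge0 ?sqr_ge0// ler_wpM2l ?sqr_ge0.
have -> : eps ^- 2 * (c ^+ 2 * (eps * M * (2 * (eps * M) ^+ 2 + 2 * J))) =
   2 * c ^+ 2 * M ^+ 3 * eps + (4 * c ^+ 2 * M / beta) * (beta * eps^-1 * (2^-1 * J)).
  by field; rewrite !gt_eqF.
rewrite lerD2l; apply: (@le_trans _ _ (4 * c ^+ 2 * M / beta * total_energy t)).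
  by rewrite ler_wpM2l//; exact: rate_ge0.
by rewrite ler_wpM2r// lerDl.
Qed.

Definition grow_src c := 2 * c ^+ 2 * M ^+ 3 * eps.
Definition grow_rate c := 4 * c ^+ 2 * M / beta + 1.

(** The added 1 in the rate keeps it positive when the force vanishes. *)
Lemma growth c s t (k := grow_src c) (C := grow_rate c) : 0 <= c -> (forall q i, cell T eta q -> `|f q 0 i| <= c) ->
  timewin T true s t ->
  total_energy t + slab s t diss_density <= (total_energy s + k / C) * expR (C * (t - s)).
Proof.
move=> c0 fc st; have /and3P[s0 st' tT] := st.
have in_T u : s <= u <= t -> 0 < u < T.
  by move=> /andP[su ut]; rewrite (lt_le_trans s0)//= (le_lt_trans ut).
have sT : 0 < s < T by apply: in_T; rewrite lexx.
have M0 : 0 <= M.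
  have e0 x : 0 <= eta (x, s) by exact/ltW/(eta_gt0 Hs).
  have := le_trans (itg_ge0 (a := 0) (b := 1) (fun x _ => e0 x)) (mass_le sT).
  by rewrite pmulr_rge0.
have k0 : 0 <= k.
  by apply: mulr_ge0 (ltW eps0); apply: mulr_ge0 (exprn_ge0 3 M0); apply: mulr_ge0; rewrite ?sqr_ge0.
have C0 : 0 < C by rewrite ltr_wpDl//; exact: rate_ge0.
apply: (@gronwall R total_energy (fun u => slab s u diss_density) s t k C) => //.
- exact: (lat_cont_mean (lat_cont_energy_density sol) st).
- exact: total_energy_ge0.
- move=> u su; apply: itg_ge0 => y /andP[sy yu]; apply: itg_ge0 => x _.
  by apply: diss_density_ge0; apply: in_T; rewrite sy (le_trans yu)//; case/andP: su.
- move=> u /[dup] su /andP[su1 ut].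
  have win : timewin T true s u by apply/and3P; split => //; exact: le_lt_trans tT.
  apply: (le_trans (energy_ineq sol eps0 c0 fc win)); rewrite lerD2l slab_clamp.
  have CE := lat_cont_mean (lat_cont_energy_density sol) win.
  have -> : itg s u (fun y => k + C * total_energy y) = itg s u (fun y => k + C * total_energy (clamp s u y)).
    by apply: itg_ext => y yy; rewrite clamp_id.
  apply: le_itg.
  + have C3 : lat_cont T true (fun q => eps ^- 2 * (c ^+ 2 * eta q ^+ 3)).
      exact: (lat_cont_M (@lat_cont_cst _ T true _) (@lat_cont_eta3 _ _ _ _ _ _ _ _ _ _ _ _ sol (c ^+ 2))).
    exact: (lat_cont_mean C3 win).
  + exact: (contD (@cont_cst _ _ k) (contM (@cont_cst _ _ C) CE)).
  move=> y /andP[sy yu]; rewrite clamp_id; last by rewrite !ltW.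
  apply: force_le; apply: in_T; rewrite (ltW sy) (le_trans (ltW yu))//.
Qed.

(** The time derivative at time 0 is the limit from positive times, which is where the
    initial condition prescribes it. *)
Let etg := ext (lateral T) (lateral0 T) (pt eta).
Let eden0 q := 2^-1 * column eta velocity_sq q + (rho * eps ^+ 5 * (2^-1 * (etg q * etg q))
  + beta * eps^-1 * (2^-1 * (exx q * exx q))).

Let lat_cont_etg : lat_cont T false etg.
Proof. by apply: lat_cont_within; exact: (ext_cont (eta_pt_cont Hs)). Qed.

Let flu_cont_vsq : flu_cont T eta false velocity_sq.
Proof.
have W0 : {within fluid_cl0 eta T, continuous (vcomp v 0)} by exact: (v_cont Hf).
have W1 : {within fluid_cl0 eta T, continuous (vcomp v 1)} by exact: (v_cont Hf).
have W : {within fluid_cl0 eta T, continuous velocity_sq}.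
  exact: (contD (contM W0 W0) (contM W1 W1)).
exact: (flu_cont_within Hs (s := false) W).
Qed.

Let lat_cont_eden0 : lat_cont T false eden0.
Proof.
have Cexx : lat_cont T false exx by apply: lat_cont_within; exact: (eta_cont Hs (isT : (2 <= 2)%N)).
have CC k : lat_cont T false (fun=> k) := @lat_cont_cst _ T false k.
exact: (lat_cont_D (lat_cont_M (CC _) (lat_cont_column Hs flu_cont_vsq)) (lat_cont_D (lat_cont_M (CC _) (lat_cont_M (CC _) (lat_cont_M lat_cont_etg lat_cont_etg)))
  (lat_cont_M (CC _) (lat_cont_M (CC _) (lat_cont_M Cexx Cexx))))).
Qed.

Let etgE x t : 0 < t < T -> etg (x, t) = pt eta (x, t).
Proof. by move=> tT; apply: extE => //; exact: (eta_pt_cont Hs). Qed.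

Lemma T_gt0 t : 0 < t < T -> 0 < T.
Proof. by case/andP; exact: lt_trans. Qed.

Let etg0 x t : 0 < t < T -> 0 < x < 1 -> etg (x, 0) = 0.
Proof.
move=> tT x01; have /andP[t0 tT'] := tT; have win := timewin0 tT.
have c := (continuous_slice (lat_cont_etg win)).1 x.
have c0 : clamp 0 t 0 = 0 by apply: clamp_id; rewrite lexx (ltW t0).
have L1 : etg (x, clamp 0 t s) @[s --> 0^'+] --> etg (x, 0).
  by have := cvg_at_right_filter (c 0); rewrite /= c0; apply.
have Ox : omega R x by rewrite /omega/= in_itv.
have L2 : etg (x, clamp 0 t s) @[s --> 0^'+] --> (0 : R).
  apply: cvg_trans (sol_init_pt_eta sol Ox); apply: near_eq_cvg; near=> s.
  have s0 : 0 < s by near: s; exact: nbhs_right_gt.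
  have st : s < t by near: s; exact: nbhs_right_lt.
  by rewrite clamp_id ?(ltW s0) ?(ltW st)// etgE// s0 (lt_trans st).
exact: (cvg_unique _ L1 L2).
Unshelve. all: end_near. Qed.

(** The initial profile is the trace of a solution, hence inherits two derivatives. *)
Lemma init_second x : 0 < T -> exx (x, 0) = eps * derive1 (derive1 eta0) x.
Proof.
move=> T0; have L y : lateral0 T (y, 0) by rewrite /lateral0/= lexx.
have e0E : eta0 = fun y => eps^-1 * eta (y, 0).
  by apply/funext => y; rewrite (sol_init_eta sol) mulKf// gt_eqF.
have d1 (y : R) : is_derive y 1 (fun y => eta (y, 0)) (px eta (y, 0)).
  by apply: is_derive1P; exact: (@eta_px0 _ _ _ Hs 0%N (y, 0)).
have d2 (y : R) : is_derive y 1 (fun y => px eta (y, 0)) (exx (y, 0)).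
  by apply: is_derive1P; exact: (@eta_px0 _ _ _ Hs 1%N (y, 0)).
have D1 : derive1 eta0 = fun y => eps^-1 * px eta (y, 0).
  by apply/funext => y; rewrite e0E derive1E; case: (dZ eps^-1 (d1 y)).
rewrite D1 derive1E; case: (dZ eps^-1 (d2 x)) => _ ->.
by rewrite mulVKf// gt_eqF.
Qed.

Let init_energy t : 0 < t < T -> itg 0 1 (fun x => eden0 (x, 0)) <= beta * M ^+ 2 / 2 * eps.
Proof.
move=> tT; have T0 := T_gt0 tT; have win := timewin0 tT.
have T00 : timewin T false 0 0 by apply/and3P; split.
have -> : beta * M ^+ 2 / 2 * eps = itg 0 1 (fun=> beta * M ^+ 2 / 2 * eps).
  by rewrite itg_cst ?ler01// subr0 mulr1.
apply: le_itg; [exact: (lat_cont_slice lat_cont_eden0 T00)|exact: cont_cst|].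
move=> x x01; have /andP[x0 x1] := x01.
have e0 : 0 < eta (x, 0) by apply: (eta_positive Hs); rewrite /lateral0/= lexx.
have -> : eden0 (x, 0) = beta * eps^-1 * (2^-1 * (exx (x, 0) * exx (x, 0))).
  rewrite /eden0 (etg0 tT x01) !mul0r !mulr0 add0r.
  rewrite (column_eq Hs (s := false) flu_cont_vsq (@flu_cont_cst R T eta false 0) T00).
    by rewrite column_cst !mulr0 add0r.
  move=> y /andP[y0 y1]; have O : Omega eta 0 (x, y * eta (x, 0)).
    by split; rewrite /omega/= ?in_itv//= mulr_gt0//= gtr_pMl.
  by rewrite /velocity_sq /vcomp (sol_init_v sol O) !mxE mul0r addr0.
have x01' : 0 <= x <= 1 by rewrite (ltW x0) (ltW x1).
rewrite (init_second x T0); have := eta02M x01'.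
set d := derive1 _ x => dM'.
have sq : d * d <= M ^+ 2.
  rewrite -expr2 -[leLHS]real_normK ?num_real// lerXn2r ?nnegrE//.
  exact: le_trans dM'.
have -> : beta / eps * (2^-1 * (eps * d * (eps * d))) = (d * d) * (beta / 2 * eps).
  by field; rewrite gt_eqF.
have -> : beta * M ^+ 2 / 2 * eps = M ^+ 2 * (beta / 2 * eps) by ring.
by rewrite ler_wpM2r// mulr_ge0 ?(ltW eps0)// divr_ge0// ltW.
Qed.

Lemma slab_diss_mono s' s t : 0 < s' -> s' <= s -> timewin T true s t ->
  slab s t diss_density <= slab s' t diss_density.
Proof.
move=> s'0 s's st; have /and3P[s0 st' tT] := st.
have win : timewin T true s' t by apply/and3P; split=> //; exact: le_trans st'.
have c := lat_cont_mean (lat_cont_diss_density sol) win.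
rewrite [leRHS]slab_clamp (itg_cat s's st' c).
have -> : slab s t diss_density = itg s t (fun u => itg 0 1 (fun x => diss_density (x, clamp s' t u))).
  apply: itg_ext => u /andP[su ut]; rewrite clamp_id// ut andbT; exact: le_trans su.
rewrite lerDr; apply: itg_ge0 => u /andP[s'u us]; apply: itg_ge0 => x _.
have ut : u <= t by exact: le_trans st'.
rewrite clamp_id ?s'u//; apply: diss_density_ge0.
by rewrite (lt_le_trans s'0)//= (le_lt_trans ut).
Qed.

Definition final_const c := (beta * M ^+ 2 / 2 + 2 * c ^+ 2 * M ^+ 3 / grow_rate c)
   * expR (grow_rate c * T).

(** The inequality on the window from a time $s' > 0$, with $s'$ tending to 0; at the
    initial time only the bending energy is present, and it is of order
    $\varepsilon$ because $\eta(0) = \varepsilon\eta_0$. *)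
Lemma energy_final c s t : 0 <= c -> (forall q i, cell T eta q -> `|f q 0 i| <= c) ->
  timewin T true s t -> total_energy t + slab s t diss_density <= final_const c * eps.
Proof.
move=> c0 fc st; have /and3P[s0 st' tT] := st.
have t0 := lt_le_trans s0 st'.
have tTT : 0 < t < T by rewrite t0.
have win := timewin0 tTT.
have M0 : 0 <= M.
  have e0 x : 0 <= eta (x, t) by exact/ltW/(eta_gt0 Hs).
  have := le_trans (itg_ge0 (a := 0) (b := 1) (fun x _ => e0 x)) (mass_le tTT).
  by rewrite pmulr_rge0.
set C := grow_rate c; set k := grow_src c.
have C0 : 0 < C by rewrite /C /grow_rate ltr_wpDl//; exact: rate_ge0.
have k0 : 0 <= k.
  by apply: mulr_ge0 (ltW eps0); apply: mulr_ge0 (exprn_ge0 3 M0); apply: mulr_ge0; rewrite ?sqr_ge0.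
(* an upper bound that is continuous down to the initial time, where the
   energy is replaced by its extension *)
pose F s := (itg 0 1 (fun x => eden0 (x, clamp 0 t s)) + k / C) * expR (C * T).
have cF : continuous F.
  exact: (contM (contD (lat_cont_mean lat_cont_eden0 win) (@cont_cst _ _ (k / C))) (@cont_cst _ _ (expR (C * T)))).
have H : total_energy t + slab s t diss_density <= F 0.
  apply: (le_at0 cF s0) => s' /andP[s'0 s's].
  have win' : timewin T true s' t by apply/and3P; split=> //; exact: ltW (lt_le_trans s's st').
  have s'T : 0 < s' < T by rewrite s'0 (lt_trans s's)// (le_lt_trans st').
  have s't : clamp 0 t s' = s'.
    by apply: clamp_id; rewrite (ltW s'0) (le_trans (ltW s's) st').
  have FE : itg 0 1 (fun x => eden0 (x, clamp 0 t s')) = total_energy s'.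
    by rewrite s't; apply: itg_ext => x _; rewrite /eden0 (etgE x s'T).
  rewrite /F FE.
  apply: (@le_trans _ _ (total_energy t + slab s' t diss_density)).
    exact: (lerD (lexx (total_energy t)) (slab_diss_mono s'0 (ltW s's) st)).
  apply: (le_trans (growth c0 fc win')).
  have q0 : 0 <= total_energy s' + k / C by apply: addr_ge0 (total_energy_ge0 s'T) (divr_ge0 k0 (ltW C0)).
  apply: (ler_wpM2l q0); rewrite ler_expR; apply: (ler_wpM2l (ltW C0)).
  by rewrite lerBlDr; apply: (le_trans (ltW tT)); rewrite lerDl; exact: ltW.
apply: (le_trans H); rewrite /F (clamp_id (t := 0)); last by rewrite lexx (ltW t0).
have -> : final_const c * eps = (beta * M ^+ 2 / 2 * eps + k / C) * expR (C * T).
  by rewrite /final_const -/C /k /grow_src; field; rewrite gt_eqF.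
by rewrite ler_wpM2r ?expR_ge0// lerD2r; exact: (init_energy tTT).
Qed.

End FinalEstimate.

(** * From iterated integrals to Lebesgue integrals *)

Section IntervalIntegrals.
Variable R : realType.
Local Notation mu := (@lebesgue_measure R).

Lemma itg_oo (a b : R) (f : R -> R) : continuous f ->
  (\int[mu]_(x in `]a, b[) (f x)%:E)%E = (itg a b f)%:E.
Proof.
move=> cf; rewrite -itgE//; apply/esym.
apply: (@integral_itv_bndoo R a b (EFin \o f) true false).
by apply/measurable_EFinP; exact: cont_measurable.
Qed.

Lemma itg_scale (G : R -> R) (e : R) : 0 < e -> continuous G ->
  itg 0 e (fun z => G (z / e)) = itg 0 1 (fun y => e * G y).
Proof.
move=> e0 cG.
have ck : continuous (fun z : R => G (z / e)).
  refine (cont_comp (f := fun z : R => z / e) _ cG).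
  exact: (contM (@cont_id R) (@cont_cst _ _ (e^-1 : R))).
pose Phi u := itg (-1) u (fun z => G (z / e)).
have dPhi (u : R) : -1 < u -> is_derive u 1 Phi (G (u / e)) by exact: is_derive_itg.
have ec y : -1 < e * clamp 0 1 y.
  have /andP[c0 _] := @clamp_itv R 0 1 y ler01.
  by apply: (@lt_le_trans _ _ 0); [rewrite ltrN10|rewrite mulr_ge0 ?(ltW e0)].
pose F y := Phi (e * clamp 0 1 y).
have cF : continuous F.
  move=> y; apply: (@continuous_comp _ _ _ (fun y => e * clamp 0 1 y) Phi).
    by apply: contM; [exact: cont_cst|exact: clamp_cont].
  case: (dPhi _ (ec y)) => d _; exact/differentiable_continuous/derivable1_diffP.
have E : itg 0 1 (fun y => e * G y) = F 1 - F 0.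
  apply: (itg_FTC ler01 _ cF); first exact: (contM (@cont_cst _ _ e) cG).
  move=> y y01; apply: (@dnear _ _ (fun y => Phi (e * y))).
    by apply: filterS (near_clamp y01) => s; rewrite /F => ->.
  have y1 : -1 < e * y.
    by have := ec y; rewrite (clamp_id (t := y))//; case/andP: y01 => /ltW -> /ltW ->.
  have d := @is_derive1_comp R Phi (fun y => e * y) y _ _ (dPhi _ y1) (dZ e (did y)).
  apply: deq d _; rewrite mulr1 mulrC; congr (_ * G _).
  by rewrite mulrAC divff ?gt_eqF// mul1r.
rewrite E /F !clamp_id ?lexx ?ler01// mulr1 mulr0 /Phi.
have N1 : -1 <= 0 :> R by rewrite lerN10.
by rewrite (itg_cat N1 (ltW e0) ck) addrAC subrr add0r.
Qed.

Section Improper.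
Variables (h : R -> R) (t : R).
Hypothesis t0 : 0 < t.
Hypothesis ch : forall s, 0 < s <= t -> continuous (fun u => h (clamp s t u)).

Let F (n : nat) : set R := `[t / n.+2%:R, t].

Let s_in n : 0 < t / n.+2%:R <= t.
Proof. by rewrite divr_gt0//= ler_pdivrMr// ler_peMr ?(ltW t0)// ler1n. Qed.

Let mF n : measurable (F n).
Proof. exact: measurable_itv. Qed.

Let FE n u : F n u -> clamp (t / n.+2%:R) t u = u.
Proof. by rewrite /F/= in_itv/= => ?; rewrite clamp_id. Qed.

Let F_cover : `]0, t[ `<=` \bigcup_n F n.
Proof.
move=> u; rewrite /= in_itv/= => /andP[u0 ut].
have tu : 0 <= t / u by rewrite divr_ge0 ?(ltW t0) ?(ltW u0).
exists (Num.truncn (t / u)) => //; rewrite /F/= in_itv/= (ltW ut) andbT.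
have /andP[_ H] := truncn_itv tu; rewrite ler_pdivrMr// mulrC -ler_pdivrMr//.
by apply: (le_trans (ltW H)); rewrite ler_nat.
Qed.

Let mhF n : measurable_fun (F n) (EFin \o h).
Proof.
apply/measurable_EFinP.
apply: (@eq_measurable_fun _ _ _ _ _ (fun u => h (clamp (t / n.+2%:R) t u))).
  by move=> u; rewrite inE => /FE ->.
apply: cont_measurable => //; exact: (ch (s_in n)).
Qed.

Let mhU : measurable_fun (\bigcup_n F n) (EFin \o h).
Proof. by apply/(measurable_fun_bigcup _ mF). Qed.

Lemma oo_measurable : measurable_fun `]0, t[ (EFin \o h).
Proof.
apply: (measurable_funS _ F_cover mhU); by apply: bigcup_measurable => n _; exact: mF.
Qed.

(** Exhausting the interval from the left by compact intervals, on each of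
    which the integrand is continuous. *)
Lemma integral_oo_le (B : R) :
  (forall s, 0 < s <= t -> 0 <= h s) ->
  (forall s, 0 < s <= t -> itg s t h <= B) ->
  (\int[mu]_(u in `]0%R, t[) (h u)%:E <= B%:E)%E.
Proof.
move=> h0 hB.
have h0F n u : F n u -> (0 <= (EFin \o h) u)%E.
  rewrite /F/= in_itv/= => /andP[su ut]; rewrite lee_fin; apply: h0.
  by rewrite ut andbT; apply: lt_le_trans su; case/andP: (s_in n).
have ndF : nondecreasing_seq F.
  move=> m n mn; rewrite subsetEset /F => u; rewrite /= !in_itv/= => /andP[su ->].
  rewrite andbT; apply: le_trans su; rewrite ler_pM2l// lef_pV2 ?posrE//.
  by rewrite ler_nat !ltnS.
have IF n : (\int[mu]_(u in F n) (h u)%:E)%E = (itg (t / n.+2%:R) t h)%:E.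
  transitivity (\int[mu]_(u in F n) (h (clamp (t / n.+2%:R) t u))%:E)%E.
    by apply: eq_integral => u; rewrite inE => /FE ->.
  rewrite itgE; last exact: (ch (s_in n)).
  by congr EFin; apply: itg_ext => u ?; rewrite clamp_id.
have L : (\int[mu]_(u in F i) (h u)%:E)%E @[i --> \oo] --> (\int[mu]_(u in \bigcup_i F i) (h u)%:E)%E.
  apply: ge0_nondecreasing_set_cvg_integral.
  - exact: ndF.
  - exact: mF.
  - exact: mhF.
  - exact: h0F.
apply: (@le_trans _ _ (\int[mu]_(u in \bigcup_i F i) (h u)%:E)%E).
  apply: ge0_subset_integral.
  - exact: measurable_itv.
  - by apply: bigcup_measurable => n _; exact: mF.
  - exact: mhU.
  - by move=> u [n _]; exact: h0F.
  - exact: F_cover.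
apply: (cvge_to_le L); apply: nearW => n; rewrite IF lee_fin.
exact: hB.
Qed.

End Improper.

End IntervalIntegrals.

Section OmegaIntegral.
Variables (R : realType) (T : R) (eta : R * R -> R).
Hypothesis Hs : structure_regular T eta.
Local Notation mu := (@lebesgue_measure R).
Local Notation mu2 := (mu \x mu)%E.

Lemma Omega_open t : 0 < t < T -> open (Omega eta t).
Proof.
move=> tT; have Ceta := lat_cont_slice (lat_contW (lat_cont_eta Hs)) (timewin_lt tT).
rewrite openE => -[x z] [/= Ox /andP[z0 ze]]; move: Ox.
rewrite /omega/= in_itv/= => /andP[x0 x1].
have cx : {for (x, z), continuous (fun q : R * R => q.1)} by exact: cont_fst.
have cz : {for (x, z), continuous (fun q : R * R => q.2)} by exact: cont_snd.
have ce : continuous (fun q : R * R => eta (q.1, t) - q.2).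
  apply: contB; last exact: cont_snd.
  exact: (cont_comp (f := fun q : R * R => q.1) (@cont_fst _ _) Ceta).
have cx1 : continuous (fun q : R * R => 1 - q.1).
  exact: (contB (@cont_cst _ _ (1 : R)) (@cont_fst R R)).
rewrite /interior; near=> q; split.
  rewrite /omega/= in_itv/=; apply/andP; split; first by near: q; exact: near_pos cx _.
  by rewrite -subr_gt0; near: q; apply: (near_pos (cx1 (x, z))); rewrite subr_gt0.
apply/andP; split; first by near: q; exact: near_pos cz _.
by rewrite -subr_gt0; near: q; apply: (near_pos (ce (x, z))); rewrite subr_gt0.
Unshelve. all: end_near. Qed.

(** Integration over the fluid domain at a fixed time is integration in [x] of
    the column integrals: Tonelli, then the vertical rescaling to [[0, 1]]. *)
Lemma Omega_integral (g : R * R * R -> R) t : 0 < t < T -> flu_cont T eta true g ->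
  (forall q, 0 <= g q) ->
  (\int[mu2]_(xz in Omega eta t) (g (xz, t))%:E)%E =
  (itg 0 1 (fun x => column eta g (x, t)))%:E.
Proof.
move=> tT cg g0; have tt := timewin_lt tT.
have Ceta := lat_cont_slice (lat_contW (lat_cont_eta Hs)) tt.
have e0 x := eta_gt0 Hs x tT.
have clt s : clamp t t s = t.
  by have /andP[a b] := @clamp_itv R t t s (lexx t); apply/eqP; rewrite eq_le a b.
pose K (q : R * R) := g (Psi eta t t (q.1, q.2 / eta (q.1, t), t)).
have ce1 : continuous (fun q : R * R => eta (q.1, t)).
  exact: (cont_comp (f := fun q : R * R => q.1) (@cont_fst _ _) Ceta).
have cev : continuous (fun q : R * R => (eta (q.1, t))^-1).
  move=> q; apply: cvgV; [by rewrite gt_eqF|exact: ce1].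
have cK : continuous K.
  refine (cont_comp (f := fun q : R * R => (q.1, q.2 / eta (q.1, t), t)) _ (cg t t tt)).
  by apply: cont_tuple3; [exact: cont_fst|apply: contM; [exact: cont_snd|exact: cev]|exact: cont_cst].
have mO := open_prod_measurable (Omega_open tT).
have KE x z : 0 <= z <= eta (x, t) -> K (x, z) = g (x, z, t).
  move=> /andP[z0 ze]; rewrite /K /Psi/= clt clamp_id; first by rewrite divfK ?gt_eqF.
  by rewrite divr_ge0 ?(ltW (e0 x))//= ler_pdivrMr// mul1r.
transitivity (\int[mu2]_(q in Omega eta t) (K q)%:E)%E.
  apply: eq_integral => -[x z]; rewrite inE => -[/= _ /andP[z0 ze]].
  by rewrite KE// !ltW.
have mf : measurable_fun setT ((EFin \o K) \_ (Omega eta t)).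
  apply/(measurable_restrictT _ mO); apply: measurable_funTS; apply/measurable_EFinP.
  exact: cont2_measurable.
have f0 q : (0 <= ((EFin \o K) \_ (Omega eta t)) q)%E.
  by rewrite patchE; case: ifP => _ //=; rewrite lee_fin; exact: g0.
rewrite integral_mkcond.
rewrite (fubini_tonelli1 (m1 := mu) (m2 := mu) ((EFin \o K) \_ (Omega eta t)) mf f0).
rewrite -(itg_oo _ _ (lat_cont_slice (lat_cont_column Hs cg) tt)) [RHS]integral_mkcond.
apply: eq_integral => x _; rewrite /fubini_F [RHS]patchE.
case: ifPn => [|nx]; last first.
  rewrite -[RHS](integral0 mu setT); apply: eq_integral => z _.
  rewrite patchE; case: ifPn => //; rewrite inE => -[/= Ox _].
  by move: nx; rewrite mem_set.
rewrite inE => Ox.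
transitivity (\int[mu]_(z in `]0%R, (eta (x, t))[) (K (x, z))%:E)%E.
  rewrite [RHS]integral_mkcond; apply: eq_integral => z _; rewrite !patchE.
  congr (if _ then _ else _); apply/idP/idP; rewrite !inE /= in_itv/=.
    by case.
  by move=> ze; split.
have cy : continuous (fun y => g (Psi eta t t (x, y, t))).
  have ct : continuous (fun y : R => (x, y, t)).
    by apply: cont_tuple3; [exact: cont_cst|exact: cont_id|exact: cont_cst].
  exact: (cont_comp ct (cg t t tt)).
have cKx : continuous (fun z => K (x, z)).
  have c2 : continuous (fun z : R => (x, z)) by apply: cont_tuple2; [exact: cont_cst|exact: cont_id].
  exact: (cont_comp c2 cK).
rewrite (itg_oo _ _ cKx); congr EFin.
have -> : itg 0 (eta (x, t)) (fun z => K (x, z)) = itg 0 1 (fun y => eta (x, t) * g (Psi eta t t (x, y, t))).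
  exact: (itg_scale (e0 x) cy).
by have := column_Psi eta g t t x t; rewrite clt => ->.
Qed.

End OmegaIntegral.

(** * The norms of the statement *)

Section EssentialBound.
Variable R : realType.
Local Notation mu := (@lebesgue_measure R).
Local Notation mu2 := (mu \x mu)%E.

(** A property that holds almost everywhere cannot fail on a whole set of positive
    measure. *)
Lemma ae_exists d (S : measurableType d) (nu : {measure set S -> \bar R})
    (B : set S) (P : S -> Prop) : measurable B -> (0 < nu B)%E ->
  (\forall x \ae nu, P x) -> exists2 x, B x & P x.
Proof.
move=> mB B0 [N [mN N0 sub]]; apply: contrapT => H.
have BN : B `<=` N.
  by move=> x Bx; apply: sub => Px; apply: H; exists x.
have : (nu B <= nu N)%E by apply: le_measure => //; rewrite inE.
by rewrite N0 leNgt B0.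
Qed.

Let ball_gt0 (c e : R) : 0 < e -> (0 < mu (ball c e))%E.
Proof.
by move=> e0; rewrite lebesgue_measure_ball ?(ltW e0)// lte_fin mulrn_wgt0.
Qed.

Lemma ae_ball (P : R -> Prop) (c e : R) : 0 < e -> (\forall x \ae mu, P x) ->
  exists2 x, ball c e x & P x.
Proof.
move=> e0; apply: ae_exists; last exact: ball_gt0.
exact: measurable_ball.
Qed.

Lemma ae_box (P : R * R -> Prop) (c d e : R) : 0 < e -> (\forall q \ae mu2, P q) ->
  exists2 q, (ball c e `*` ball d e) q & P q.
Proof.
move=> e0; apply: ae_exists.
  by apply: measurableX; exact: measurable_ball.
apply: (@lt_le_trans _ _ (mu (ball c e) * mu (ball d e))%E).
  by apply: mule_gt0; exact: ball_gt0.
by rewrite le_eqVlt; apply/orP; left; apply/eqP/esym/product_measure1E; exact: measurable_ball.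
Qed.

End EssentialBound.

Fact ereal_regroup (R : realType) (c0 c1 c2 a k l D : R) (A K L I1 I2 : \bar R) :
  (A = a%:E -> K = k%:E -> L = l%:E -> I1 + I2 <= D%:E ->
  c0%:E * A + I1 + c1%:E * K + I2 + c2%:E * L <= (c0 * a + c1 * k + c2 * l + D)%:E)%E.
Proof.
move=> -> -> -> H.
rewrite -!EFinM (addeAC _ I1) -(addeA _ I1 I2) (addeAC _ (I1 + I2)%E) -!EFinD.
by apply: (le_trans (leeD2l _ H)); rewrite -EFinD.
Qed.

Fact energy_cancel (R : realFieldType) (a k l p q B : R) :
  2^-1 * a + p / 2 * k + q / 2 * l + (B - (2^-1 * a + (p * (2^-1 * k) + q * (2^-1 * l)))) = B.
Proof. by ring. Qed.

Section Energy.
Variables (R : realType) (rho delta beta r : R) (eta0 : R -> R) (eps T : R).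
Variables (f v : R * R * R -> 'rV[R]_2) (p : R * R * R -> R) (eta : R * R -> R).
Hypothesis sol : classical_solution rho delta beta r eta0 eps T f v p eta.
Local Notation mu := (@lebesgue_measure R).

Let Hs : structure_regular T eta := sol_structure_regular sol.
Let Hf : fluid_regular T eta v p := sol_fluid_regular sol.
Local Notation etx := (px (pt eta)).
Local Notation exx := (px (px eta)).

Let WF g : {within fluid_cl eta T, continuous g} -> flu_cont T eta true g :=
  flu_cont_within Hs (s := true) (g := g).

Lemma L2sq_vecE t : 0 < t < T ->
  L2sq_vec eta v t = (itg 0 1 (fun x => column eta (velocity_sq v) (x, t)))%:E.
Proof.
move=> tT; rewrite -(Omega_integral Hs tT (WF (velocity_sq_within sol)) (@velocity_sq_ge0 _ v)).
by apply: eq_integral => q _; rewrite /normsq sum2E /velocity_sq /vcomp !expr2.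
Qed.

Lemma L2sq_gradE t : 0 < t < T ->
  L2sq_grad eta v t = (itg 0 1 (fun x => column eta (gradient_sq T v eta) (x, t)))%:E.
Proof.
move=> tT; rewrite -(Omega_integral Hs tT (WF (gradient_sq_within sol)) (@gradient_sq_ge0 _ T v eta)).
apply: eq_integral => -[x z]; rewrite inE => -[/= _ ze].
have Fq : fluid eta T (x, z, t) by [].
by rewrite /mxnormsq !sum2E /gradv !mxE /gradient_sq !(vdE sol _ _ Fq) !expr2 !addrA.
Qed.

Lemma L2sq_omegaE (g : R * R -> R) t : continuous (fun x => g (x, t)) ->
  L2sq_omega g t = (itg 0 1 (fun x => g (x, t) * g (x, t)))%:E.
Proof. by move=> cg; exact: (itg_oo 0 1 (contM cg cg)). Qed.

Lemma L2sq_omega_ext (g h : R * R -> R) t : (forall x, g (x, t) = h (x, t)) ->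
  L2sq_omega g t = L2sq_omega h t.
Proof. by move=> gh; apply: eq_integral => x _; rewrite gh. Qed.

Lemma L2sq_rateE t : 0 < t < T ->
  L2sq_omega (pt (px eta)) t = (itg 0 1 (fun x => etx (x, t) * etx (x, t)))%:E.
Proof.
move=> tT.
have c := lat_cont_slice (lat_cont_pxt Hs (isT : (1 <= 2)%N)) (timewin_lt tT).
rewrite -(L2sq_omegaE (g := etx) c).
apply: (@L2sq_omega_ext (pt (px eta)) etx t) => x.
by rewrite {1}/pt/= derive1E; case: (dt_px Hs x tT).
Qed.

Lemma total_energy_split t : 0 < t < T -> total_energy rho beta eps v eta t =
  2^-1 * itg 0 1 (fun x => column eta (velocity_sq v) (x, t)) +
  (rho * eps ^+ 5 * (2^-1 * itg 0 1 (fun x => pt eta (x, t) * pt eta (x, t))) +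
   beta * eps^-1 * (2^-1 * itg 0 1 (fun x => exx (x, t) * exx (x, t)))).
Proof.
move=> tT; have tt := timewin_lt tT.
have c1 := lat_cont_slice (lat_cont_column Hs (WF (velocity_sq_within sol))) tt.
have ct := lat_cont_slice (lat_cont_pxt Hs (isT : (0 <= 2)%N)) tt.
have c2 : continuous (fun x => pt eta (x, t) * pt eta (x, t)) := contM ct ct.
have cx := lat_cont_slice (lat_cont_px Hs (isT : (2 <= 4)%N)) tt.
have c3 : continuous (fun x => exx (x, t) * exx (x, t)) := contM cx cx.
have k c (g : R -> R) : continuous g -> continuous (fun x => c * g x).
  by move=> cg; exact: (contM (@cont_cst _ _ (c : R)) cg).
rewrite -(itgZ _ _ _ c1) -(itgZ _ _ 2^-1 c2) -(itgZ _ _ _ (k 2^-1 _ c2)).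
rewrite -(itgZ _ _ 2^-1 c3) -(itgZ _ _ _ (k 2^-1 _ c3)).
rewrite -itgD; [|exact: (k _ _ (k _ _ c2))|exact: (k _ _ (k _ _ c3))].
by rewrite -itgD; [|exact: (k _ _ c1)|exact: (contD (k _ _ (k _ _ c2)) (k _ _ (k _ _ c3)))].
Qed.

Hypotheses (delta0 : 0 < delta) (eps0 : 0 < eps).

(** The two time integrals over the open interval are limits of the integrals over
    $[s, t]$, on which the integrands are continuous. *)
Lemma dissipation_le (t B : R) : 0 < t < T ->
  (forall s, timewin T true s t -> slab s t (diss_density delta r eps T v eta) <= B) ->
  ((eps ^- 2 / 2)%:E * \int[mu]_(s in `]0%R, t[) L2sq_grad eta v s +
   (delta * eps `^ (2 - r))%:E *
     \int[mu]_(s in `]0%R, t[) L2sq_omega (pt (px eta)) s <= B%:E)%E.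
Proof.
move=> tT HB; have /andP[t0 tT'] := tT.
set c1 := eps ^- 2 / 2; set c2 := delta * eps `^ (2 - r).
have c10 : 0 <= c1 by rewrite divr_ge0 ?invr_ge0 ?exprn_ge0 ?(ltW eps0).
have c20 : 0 <= c2 by rewrite mulr_ge0 ?powR_ge0 ?(ltW delta0).
pose P s := itg 0 1 (fun x => column eta (gradient_sq T v eta) (x, s)).
pose Q s := itg 0 1 (fun x => etx (x, s) * etx (x, s)).
have in_T s : 0 < s <= t -> 0 < s < T by move=> /andP[-> st]; exact: le_lt_trans tT'.
have in_oo s : `]0, t[%classic s -> 0 < s < T.
  by rewrite /= in_itv/= => /andP[s0 st]; apply: in_T; rewrite s0 ltW.
have P0 s : 0 < s < T -> 0 <= P s.
  by move=> sT; apply: itg_ge0 => x _; apply: (column_ge0 sol x sT); exact: gradient_sq_ge0.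
have Q0 s : 0 <= Q s by apply: itg_ge0 => x _; rewrite -expr2 sqr_ge0.
have win s : 0 < s <= t -> timewin T true s t by move=> /andP[s0 st]; apply/and3P.
have Cx := lat_cont_pxt Hs (isT : (1 <= 2)%N).
have Cg := lat_cont_column Hs (WF (gradient_sq_within sol)).
have cP s : 0 < s <= t -> continuous (fun u => P (clamp s t u)).
  by move=> /win w; exact: (lat_cont_mean Cg w).
have cQ s : 0 < s <= t -> continuous (fun u => Q (clamp s t u)).
  by move=> /win w; exact: (lat_cont_mean (lat_cont_M Cx Cx) w).
have mI : measurable (`]0, t[ : set R) by exact: measurable_itv.
have E1 : (\int[mu]_(s in `]0%R, t[) L2sq_grad eta v s = \int[mu]_(s in `]0%R, t[) (P s)%:E)%E.
  by apply: eq_integral => s; rewrite inE => /in_oo; exact: L2sq_gradE.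
have E2 : (\int[mu]_(s in `]0%R, t[) L2sq_omega (pt (px eta)) s = \int[mu]_(s in `]0%R, t[) (Q s)%:E)%E.
  by apply: eq_integral => s; rewrite inE => /in_oo; exact: L2sq_rateE.
have mP := oo_measurable t0 cP; have mQ := oo_measurable t0 cQ.
have P0' s : `]0, t[%classic s -> (0 <= (P s)%:E)%E by move=> /in_oo /P0; rewrite lee_fin.
have Q0' s : `]0, t[%classic s -> (0 <= (Q s)%:E)%E by rewrite lee_fin.
have Z1 : (c1%:E * \int[mu]_(s in `]0%R, t[) (P s)%:E =
    \int[mu]_(s in `]0%R, t[) (c1%:E * (P s)%:E))%E.
  by apply/esym; apply: ge0_integralZl => //; exact: mP.
have Z2 : (c2%:E * \int[mu]_(s in `]0%R, t[) (Q s)%:E =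
    \int[mu]_(s in `]0%R, t[) (c2%:E * (Q s)%:E))%E.
  by apply/esym; apply: ge0_integralZl => //; exact: mQ.
have S : (\int[mu]_(s in `]0%R, t[) (c1%:E * (P s)%:E) +
    \int[mu]_(s in `]0%R, t[) (c2%:E * (Q s)%:E) =
    \int[mu]_(s in `]0%R, t[) (c1 * P s + c2 * Q s)%:E)%E.
  transitivity (\int[mu]_(s in `]0%R, t[) (c1%:E * (P s)%:E + c2%:E * (Q s)%:E))%E; last first.
    by apply: eq_integral => s _; rewrite -!EFinM -EFinD.
  apply/esym; apply: ge0_integralD.
  - exact: mI.
  - by move=> s /P0' ?; rewrite mule_ge0 ?lee_fin.
  - by apply: measurable_funeM; exact: mP.
  - by move=> s /Q0' ?; rewrite mule_ge0 ?lee_fin.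
  - by apply: measurable_funeM; exact: mQ.
rewrite E1 E2 Z1 Z2 S.
have kc c (g : R -> R) : continuous g -> continuous (fun x => c * g x).
  by move=> cg; exact: (contM (@cont_cst _ _ (c : R)) cg).
apply: (integral_oo_le (h := fun s => c1 * P s + c2 * Q s) t0).
- by move=> s st; exact: (contD (kc c1 _ (cP s st)) (kc c2 _ (cQ s st))).
- by move=> s /in_T sT; rewrite addr_ge0// mulr_ge0// P0.
move=> s st; have w := win s st; apply: le_trans (HB s w).
rewrite le_eqVlt; apply/orP; left; apply/eqP; apply: itg_ext => u /andP[su ut].
have uT : 0 < u < T by apply: in_T; rewrite ut andbT; case/andP: st => s0 _; exact: lt_le_trans su.
have tt := timewin_lt uT.
have k1 := lat_cont_slice Cg tt; have kx := lat_cont_slice Cx tt.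
have k2 : continuous (fun x => etx (x, u) * etx (x, u)) := contM kx kx.
rewrite /P /Q -(itgZ _ _ _ k1) -(itgZ _ _ _ k2) -(itgD _ _ (kc _ _ k1) (kc _ _ k2)).
by apply: itg_ext => x _; rewrite /diss_density; congr (_ + _); rewrite /c1 -mulrA.
Qed.

Lemma energy_le (t B : R) : 0 < t < T ->
  (forall s, timewin T true s t ->
     total_energy rho beta eps v eta t + slab s t (diss_density delta r eps T v eta) <= B) ->
  (energy rho delta beta r eps v eta t <= B%:E)%E.
Proof.
move=> tT HB; have tt := timewin_lt tT.
have ct := lat_cont_slice (lat_cont_pxt Hs (isT : (0 <= 2)%N)) tt.
have cx := lat_cont_slice (lat_cont_px Hs (isT : (2 <= 4)%N)) tt.
have D : forall s, timewin T true s t ->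
    slab s t (diss_density delta r eps T v eta) <= B - total_energy rho beta eps v eta t.
  by move=> s st; rewrite lerBrDl; exact: HB.
have E1 := L2sq_vecE tT.
have E2 := L2sq_omegaE (g := pt eta) ct.
have E3 := L2sq_omegaE (g := exx) cx.
apply: (le_trans (ereal_regroup 2^-1 (rho * eps ^+ 5 / 2) (beta * eps^-1 / 2)
  E1 E2 E3 (dissipation_le tT D))).
by rewrite (total_energy_split tT) energy_cancel.
Qed.

(** The force equals the left-hand side of the momentum equation, hence is
    continuous; if it exceeded the essential bound at one point, it would on a box,
    which meets every set of full measure. *)
Lemma force_bound (C : R) : (Linf_Linf T eta f <= C%:E)%E ->
  forall q i, cell T eta q -> `|f q 0 i| <= `|C|.
Proof.
move=> fC [[x0 z0] t0] i Cq; rewrite leNgt; apply/negP => H.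
pose g q := eps ^+ 2 * vt T v eta i q +
  (vcomp v 0 q * vd T v eta i 0 q + vcomp v 1 q * vd T v eta i 1 q) -
  (vd2 T v eta i 0 0 q + vd2 T v eta i 1 1 q) + prd T p eta i q.
have gf q : cell T eta q -> g q = f q 0 i by exact: (momentum sol i).
have cw : {within fluid_cl eta T, continuous g}.
  have W j := v_within sol j; have Wd a b := vd_within sol a b.
  have Wdd a b c := vd2_within sol a b c.
  exact: (contD (contB (contD (contM (@cont_cst _ _ (eps ^+ 2)) (vt_within sol i))
    (contD (contM (W 0) (Wd i 0)) (contM (W 1) (Wd i 1))))
    (contD (Wdd i 0 0) (Wdd i 1 1))) (prd_within sol i)).
have cg : {for (x0, z0, t0), continuous g} := fluid_cont Hs cw (proj1 Cq).
have N : \forall q \near (x0, z0, t0), cell T eta q /\ `|C| < `|f q 0 i|.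
  have c0 : \forall q \near (x0, z0, t0), cell T eta q.
    by apply: open_nbhs_nbhs; split => //; exact: (cell_open sol).
  have c1 : \forall q \near (x0, z0, t0), `|C| < `|g q|.
    have cn : `|g q| @[q --> (x0, z0, t0)] --> `|g (x0, z0, t0)| by exact: cvg_norm.
    by apply: (cvgr_gt _ cn); rewrite gf.
  by apply: filterS (filterI c0 c1) => q [cq gq]; split => //; rewrite -gf.
have /nbhs_ballP[e /= e0 He] := N.
move/ess_supP: fC => fC.
have [t bt] := ae_ball t0 e0 fC.
have c0 : ball (x0, z0, t0) e (x0, z0, t) by split => //; split; exact: ballxx.
have /= [Ct _] := He _ c0; have [/andP[tl tr] _] := cell_omega Ct.
rewrite patchE mem_set/=; last by rewrite in_itv/= tl tr.
move/ess_supP => ft.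
have [[x z] [/= bx bz]] := ae_box x0 z0 e0 ft.
have cx : ball (x0, z0, t0) e (x, z, t) by split => //; split.
have /= [Cx fx] := He _ cx; have [_ Ox] := cell_omega Cx.
rewrite patchE mem_set//= lee_fin => fC'.
have : `|f (x, z, t) 0 i| <= Num.sqrt (normsq (f (x, z, t))).
  rewrite -sqrtr_sqr ler_wsqrtr// /normsq sum2E.
  by case: (ord2P i) => ->; rewrite ?lerDl ?lerDr sqr_ge0.
move/le_trans/(_ fC') => H'; have := lt_le_trans fx H'.
by rewrite ltNge ler_norm.
Qed.

End Energy.

Section InitialBound.
Variables (R : realType) (rho delta beta r : R) (eta0 : R -> R) (eps T : R).
Variables (f v : R * R * R -> 'rV[R]_2) (p : R * R * R -> R) (eta : R * R -> R).
Hypothesis sol : classical_solution rho delta beta r eta0 eps T f v p eta.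

Lemma bounded01 (g : R -> R) : continuous g ->
  exists M, forall x, 0 <= x <= 1 -> `|g x| <= M.
Proof.
move=> cg.
have cn : {within `[0, 1], continuous (fun x => `|g x|)}.
  by apply: continuous_subspaceT => x; apply: cvg_norm; exact: cg.
have [c _ Hc] := EVT_max ler01 cn.
by exists `|g c| => x x01; apply: Hc; rewrite in_itv.
Qed.

(** The initial profile is $\varepsilon^{-1}\eta(\cdot, 0)$, and $\eta$ is continuous
    with two derivatives up to the initial time. The bound belongs to the profile and
    not to the solution: this makes the final constant uniform. *)
Lemma initial_bound : 0 < eps -> 0 < T -> exists M, forall x, 0 <= x <= 1 ->
  eta0 x <= M /\ `|derive1 (derive1 eta0) x| <= M.
Proof.
move=> eps0 T0; pose Hs := sol_structure_regular sol.
have T00 : timewin T false 0 0 by apply/and3P; split.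
have [M1 H1] := bounded01 (lat_cont_slice (lat_cont_eta Hs) T00).
have Cx : lat_cont T false (px (px eta)) by apply: lat_cont_within; exact: (eta_cont Hs (isT : (2 <= 2)%N)).
have [M2 H2] := bounded01 (lat_cont_slice Cx T00).
have e0 := ltW eps0; have ei : 0 <= eps^-1 by rewrite invr_ge0.
exists (eps^-1 * Num.max M1 M2) => x x01; split.
  have -> : eta0 x = eps^-1 * eta (x, 0) by rewrite (sol_init_eta sol) mulKf ?gt_eqF.
  by rewrite ler_wpM2l// le_max (le_trans (ler_norm _) (H1 x x01)).
have -> : derive1 (derive1 eta0) x = eps^-1 * px (px eta) (x, 0).
  by rewrite (init_second sol eps0 x T0) mulKf ?gt_eqF.
by rewrite normrM (ger0_norm ei) ler_wpM2l// le_max H2// orbT.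
Qed.

End InitialBound.

(** * The energy estimate *)

Unset Implicit Arguments.
Local Close Scope classical_set_scope.

Theorem proposition2p2 (R : realType) (rho delta beta r : R) (eta0 : R -> R)
    (T C_f : R) :
  0 < rho -> 0 < delta -> 0 < beta -> 1 <= r <= 3 ->
  H3_per eta0 -> (forall x, 0 < eta0 x) -> 0 < T ->
  exists2 C : R, 0 < C &
    forall (eps : R), 0 < eps < 1 ->
    forall (f v : R * R * R -> 'rV[R]_2) (p : R * R * R -> R) (eta : R * R -> R),
      classical_solution rho delta beta r eta0 eps T f v p eta ->
      (Linf_Linf T eta f <= C_f%:E)%E ->
      forall t : R, 0 < t < T ->
        (energy rho delta beta r eps v eta t <= (C * eps)%:E)%E.
Proof.
move=> rho0 delta0 beta0 _ _ _ T0.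
pose bounded M := forall x, 0 <= x <= 1 ->
  eta0 x <= M /\ `|derive1 (derive1 eta0) x| <= M.
(* without such a bound there is no solution at all, and any constant does *)
destruct (pselect (exists M, bounded M)) as [[M HM]|noM]; last first.
  exists 1 => // eps /andP[eps0 _] f v p eta sol.
  by case: noM; exact: (initial_bound sol eps0 T0).
exists (Num.max 1 (final_const beta T M `|C_f|)); first by rewrite lt_max ltr01.
move=> eps /andP[eps0 _] f v p eta sol fC t tT.
apply: (energy_le sol delta0 eps0 tT) => s st.
apply: (@le_trans _ _ (final_const beta T M `|C_f| * eps)).
  apply: (energy_final sol rho0 delta0 beta0 eps0 (fun x h => (HM x h).1)
    (fun x h => (HM x h).2) (normr_ge0 _) _ st).
  exact: (force_bound sol fC).
by rewrite ler_wpM2r ?(ltW eps0)// le_max lexx orbT.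
Qed.
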